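(* Let $N\in\mathbb N$, $N\ge1$, let $\|\cdot\|$ be a norm on $\mathbb R^N$, and let $\mathfrak C=(\mathbb R^N,\|\cdot\|,\mathcal L^N)$ where $\mathcal L^N$ is Lebesgue measure. Let $1<p<\infty$, let $(\rho_n)_n$ be mollifiers satisfying (M1)–(M3) with constant $C_0$, and let $f\in W^{1,p}(\mathbb R^N)$. Then $$\lim_{n\to\infty}\int_{\mathbb R^N}\int_{\mathbb R^N}\frac{|f(x)-f(y)|^p}{\|x-y\|^p}\,\rho_n(x,y)\,dx\,dy=C_0\int_{\mathbb R^N}\int_{S_1^{\mathfrak C}}|\nabla f(x)\cdot v|^p\,d\mathcal H^{N-1}_{\|\cdot\|}(v)\,dx,$$ where $$C_0=\lim_{n\to\infty}\int_0^\delta r^{N-1}\tilde\rho_n(r)\,dr .$$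
   Context: $B_1^{\mathfrak C}$ is the unit ball of $\|\cdot\|$ centred at $0$ and $S_1^{\mathfrak C}$ its boundary. $\mathcal H^{N-1}_{\|\cdot\|}$ is the boundary measure (Minkowski content) on spheres with respect to $\|\cdot\|$ and $\mathcal L^N$, i.e. the measure for which $\int_{\mathbb R^N}g\,d\mathcal L^N=\int_0^\infty r^{N-1}\int_{S_1^{\mathfrak C}}g(rv)\,d\mathcal H^{N-1}_{\|\cdot\|}(v)\,dr$ for Borel $g\ge0$; equivalently $\mathcal H^{N-1}_{\|\cdot\|}(A)=N\,\mathcal L^N(\{tv:v\in A,\ 0<t\le1\})$ for Borel $A\subset S_1^{\mathfrak C}$. Mollifiers $\rho_n:\mathbb R^N\times\mathbb R^N\to[0,\infty)$: (M1) $\sup_x\sup_n\|\rho_n(x,\cdot)\|_{L^1(\mathcal L^N)}<\infty$. (M2) There are non-negative non-increasing functions $\tilde\rho_n$ with $\rho_n(x,y)=\tilde\rho_n(\|x-y\|)$. (M3) For every $\delta>0$ the limit $C_0=\lim_n\int_0^\delta r^{N-1}\tilde\rho_n(r)\,dr$ exists in $(0,\infty)$ and does not depend on $\delta$, and $\lim_n\int_{\{y:\|x-y\|\ge\delta\}}\rho_n(x,y)\,dy=0$ for every $\delta>0$, $x\in\mathbb R^N$. $W^{1,p}(\mathbb R^N)$ is the usual Sobolev space and $\nabla f$ the weak gradient; $\cdot$ is the Euclidean inner product. *)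

(* Defs.v *)
From HB Require Import structures.
From mathcomp Require Import all_boot all_order all_algebra.
From mathcomp Require Import all_classical all_reals all_analysis.

Set Implicit Arguments.
Unset Strict Implicit.
Unset Printing Implicit Defensive.
Import Order.TTheory GRing.Theory Num.Theory.
Import numFieldNormedType.Exports.

Local Open Scope classical_set_scope.
Local Open Scope ring_scope.

(* The sigma-algebra of R^n = 'rV[R]_n is the one generated by the coordinate
   projections, as for n.-tuple; over the reals these are the Borel sets. *)
Section measurable_rV.
Context {d : measure_display} {T : measurableType d} (n : nat).

Let coors : 'I_n -> 'rV[T]_n -> T := fun i x => x ord0 i.

Let rV_set0 : g_sigma_preimage coors set0.
Proof. exact: sigma_algebra0. Qed.

Let rV_setC A : g_sigma_preimage coors A -> g_sigma_preimage coors (~` A).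
Proof. exact: sigma_algebraC. Qed.

Let rV_bigcup (F : (set 'rV[T]_n)^nat) :
  (forall i, g_sigma_preimage coors (F i)) ->
  g_sigma_preimage coors (\bigcup_i (F i)).
Proof. exact: sigma_algebra_bigcup. Qed.

HB.instance Definition _ := @isMeasurable.Build (measure_tuple_display d)
  'rV[T]_n (g_sigma_preimage coors) rV_set0 rV_setC rV_bigcup.

Lemma measurable_coord (i : 'I_n) :
  measurable_fun [set: 'rV[T]_n] (fun x => x ord0 i).
Proof.
move=> _ Y mY; rewrite setTI.
apply: (@sub_sigma_algebra _ setT
  (\big[setU/set0]_(j < n) preimage_set_system setT (coors j) measurable)).
rewrite -bigcup_seq/=; apply: (ex_intro2 _ _ i); first exact: mem_index_enum.
by apply: (ex_intro2 _ _ Y) => //; rewrite setTI.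
Qed.

Lemma measurable_fun_rVP {d1} {T1 : measurableType d1} (f : T1 -> 'rV[T]_n) :
  (forall i, measurable_fun [set: T1] (fun x => f x ord0 i)) ->
  measurable_fun [set: T1] f.
Proof.
move=> mf _ A mA; rewrite setTI.
have : (g_sigma_preimage coors `<=` image_set_system setT f measurable).
  apply: smallest_sub.
    by apply: sigma_algebra_image; exact: sigma_algebra_measurable.
  rewrite -bigcup_seq => B [i _ [C mC <-]].
  rewrite /image_set_system /= !setTI.
  by have := mf i measurableT C mC; rewrite setTI.
by move=> /(_ _ mA); rewrite /image_set_system /= setTI.
Qed.

End measurable_rV.

Section rV_cons.
Context {R : realType} (n : nat).

Definition rV_cons (z : measurableTypeR R * 'rV[R]_n) : 'rV[R]_n.+1 :=
  row_mx (z.1%:M : 'rV[R]_1) z.2.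

Definition rV_uncons (x : 'rV[R]_n.+1) : measurableTypeR R * 'rV[R]_n :=
  ((x : 'rV[R]_(1 + n)) ord0 (lshift n ord0), rsubmx (x : 'rV[R]_(1 + n))).

Lemma rV_consE0 z : rV_cons z ord0 (lshift n (ord0 : 'I_1)) = z.1.
Proof. by apply: etrans (row_mxEl _ _ _ _) _; rewrite mxE. Qed.

Lemma rV_consES z j : rV_cons z ord0 (rshift 1 j) = z.2 ord0 j.
Proof. exact: row_mxEr. Qed.

Lemma rV_consK : cancel rV_cons rV_uncons.
Proof.
by move=> z; rewrite /rV_uncons rV_consE0 row_mxKr -surjective_pairing.
Qed.

Lemma measurable_rV_cons : measurable_fun [set: _] rV_cons.
Proof.
apply: measurable_fun_rVP => i.
case: (@split_ordP 1 n i) => j ->.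
- rewrite (ord1 j) (_ : (fun _ => _) = fst); first exact: measurable_fst.
  by apply/funext => z; exact: rV_consE0.
- rewrite (_ : (fun _ => _) = (fun x : 'rV[R]_n => x ord0 j) \o snd).
    by apply: measurableT_comp; [exact: measurable_coord|exact: measurable_snd].
  by apply/funext => z; exact: rV_consES.
Qed.

Lemma measurable_rV_uncons : measurable_fun [set: _] rV_uncons.
Proof.
apply/measurable_fun_pairP; split => /=.
  exact: (@measurable_coord _ _ n.+1 (lshift n (ord0 : 'I_1))).
apply: measurable_fun_rVP => i /=.
rewrite (_ : (fun _ => _) =
    fun x : 'rV[R]_n.+1 => x ord0 (rshift 1 i : 'I_n.+1)).
  exact: measurable_coord.
by apply/funext => x /=; rewrite mxE.
Qed.

End rV_cons.

Section lebesgue_rV.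
Context {R : realType}.
Local Open Scope ereal_scope.

Section product_step.
Context (n : nat) (mu : {sigma_finite_measure set 'rV[R]_n -> \bar R}).

Definition lebesgue_rVS : set 'rV[R]_n.+1 -> \bar R :=
  pushforward (@lebesgue_measure R \x mu) (@rV_cons R n).

Let m_preimage A : measurable A -> measurable (@rV_cons R n @^-1` A).
Proof.
by move=> mA; rewrite -[X in measurable X]setTI; exact: measurable_rV_cons.
Qed.

Let lebesgue_rVS0 : lebesgue_rVS set0 = 0.
Proof. by rewrite /lebesgue_rVS /pushforward preimage_set0 measure0. Qed.

Let lebesgue_rVS_ge0 A : 0 <= lebesgue_rVS A.
Proof. by rewrite /lebesgue_rVS /pushforward; exact: measure_ge0. Qed.

Let lebesgue_rVS_sigma_additive : semi_sigma_additive lebesgue_rVS.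
Proof.
move=> F mF tF mUF; rewrite /lebesgue_rVS /pushforward preimage_bigcup.
apply: measure_semi_sigma_additive.
- by move=> k; exact: m_preimage.
- apply/trivIsetP => /= i j _ _ ij; rewrite -preimage_setI.
  by move/trivIsetP : tF => /(_ _ _ _ _ ij) ->//; rewrite preimage_set0.
- by rewrite -preimage_bigcup; exact: m_preimage.
Qed.

HB.instance Definition _ := isMeasure.Build _ _ _ lebesgue_rVS
  lebesgue_rVS0 lebesgue_rVS_ge0 lebesgue_rVS_sigma_additive.

Let lebesgue_rVS_sigma_finite : sigma_finite setT lebesgue_rVS.
Proof.
have /sigma_finiteP[F [TF ndF Foo]] := sigma_finiteT (@lebesgue_measure R).
have /sigma_finiteP[G [TG ndG Goo]] := sigma_finiteT mu.
exists (fun k => @rV_uncons R n @^-1` (F k `*` G k)).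
  rewrite -preimage_bigcup (_ : \bigcup_k (F k `*` G k) = setT) ?preimage_setT//.
  rewrite -setXTT TF TG predeqE => -[x y]; split.
    by move=> [k _ []/= ? ?]; split; exists k.
  move=> [/= [k _ Fkx] [l _ Gly]]; exists (maxn k l) => //; split.
  - by move: x Fkx; exact/subsetPset/ndF/leq_maxl.
  - by move: y Gly; exact/subsetPset/ndG/leq_maxr.
move=> k; have [mFk Fkoo] := Foo k; have [mGk Gkoo] := Goo k; split.
  rewrite -[X in measurable X]setTI; apply: measurable_rV_uncons => //.
  exact: measurableX.
rewrite /lebesgue_rVS /pushforward -comp_preimage.
rewrite (_ : @rV_uncons R n \o @rV_cons R n = id); last first.
  by apply/funext => z /=; exact: rV_consK.
by rewrite preimage_id product_measure1E// lte_mul_pinfty// ge0_fin_numE.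
Qed.

HB.instance Definition _ := @Measure_isSigmaFinite.Build _ _ _ lebesgue_rVS
  lebesgue_rVS_sigma_finite.

End product_step.

(* n-fold product of the one-dimensional Lebesgue measure *)
Fixpoint lebesgue_rV (n : nat) :
    {sigma_finite_measure set 'rV[R]_n -> \bar R} :=
  match n with
  | 0 => [the {sigma_finite_measure set 'rV[R]_0 -> \bar R} of
           \d_(0%R : 'rV[R]_0)]
  | n.+1 => [the {sigma_finite_measure set 'rV[R]_n.+1 -> \bar R} of
              lebesgue_rVS (lebesgue_rV n)]
  end.

End lebesgue_rV.

Section norm.
Context {R : realType} {N : nat}.
Implicit Types (nrm : 'rV[R]_N -> R) (A : set 'rV[R]_N).

Record is_norm nrm : Prop := IsNorm {
  is_norm_eq0 : forall x, nrm x = 0 -> x = 0 ;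
  is_normZ : forall a x, nrm (a *: x) = `|a| * nrm x ;
  is_norm_triangle : forall x y, nrm (x + y) <= nrm x + nrm y }.

Definition norm_sphere nrm : set 'rV[R]_N := [set v | nrm v = 1].

Definition cone A : set 'rV[R]_N :=
  [set x | exists2 v, A v & exists2 t : R, 0 < t <= 1 & x = t *: v].

(* The boundary measure H^{N-1}_{nrm} on the unit sphere; the factor N is the
   normalisation for which the polar coordinates formula
   \int g dL^N = \int_0^oo r^(N-1) \int_S g(r v) dH(v) dr holds. *)
Definition sphere_measure nrm : set 'rV[R]_N -> \bar R :=
  fun A => (N%:R%:E * lebesgue_rV N (cone (A `&` norm_sphere nrm)))%E.

End norm.

Section sobolev.
Context {R : realType} {N : nat}.
Implicit Types (f phi : 'rV[R]_N -> R) (Df : 'rV[R]_N -> 'rV[R]_N).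

Definition partial (i : 'I_N) phi : 'rV[R]_N -> R :=
  fun x => 'D_(delta_mx ord0 i) phi x.

(* All partial derivatives of order exactly k exist and are continuous; phi is
   C^oo iff this holds for every k. *)
Fixpoint Cn (k : nat) phi : Prop :=
  match k with
  | 0 => continuous phi
  | k.+1 => forall i, (forall x, derivable phi x (delta_mx ord0 i)) /\
                      Cn k (partial i phi)
  end.

Definition test_function phi : Prop :=
  (forall k, Cn k phi) /\ compact (closure [set x | phi x != 0]).

Definition weak_gradient f Df : Prop :=
  forall phi, test_function phi -> forall i,
  (\int[lebesgue_rV N]_x (f x * partial i phi x)%:E =
   - \int[lebesgue_rV N]_x (Df x ord0 i * phi x)%:E)%E.

(* f belongs to W^{1,p}(R^N) and Df represents its weak gradient *)
Record sobolev_W1 (p : R) f Df : Prop := SobolevW1 {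
  sobolev_W1_Lp : f \in Lfun (lebesgue_rV N) p%:E ;
  sobolev_W1_grad_Lp :
    forall i, (fun x => Df x ord0 i) \in Lfun (lebesgue_rV N) p%:E ;
  sobolev_W1_grad : weak_gradient f Df }.

Definition dot (u v : 'rV[R]_N) : R := \sum_(i < N) u ord0 i * v ord0 i.

End sobolev.

Section mollifiers.
Context {R : realType} {N : nat}.
Local Open Scope ereal_scope.

(* rhot is only required to be non-increasing on the open half-line, which
   allows kernels that are singular on the diagonal. *)
Record mollifiers (nrm : 'rV[R]_N -> R) (rho : nat -> 'rV[R]_N -> 'rV[R]_N -> R)
    (rhot : nat -> R -> R) (C0 : R) : Prop := Mollifiers {
  moll_ge0 : forall n x y, (0 <= rho n x y)%R ;
  moll_L1 : ereal_sup (range (fun x : 'rV[R]_N => ereal_sup (range (fun n =>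
    'N[lebesgue_rV N]_1[EFin \o rho n x])))) < +oo ;
  moll_profile_ge0 : forall n r, (0 <= r)%R -> (0 <= rhot n r)%R ;
  moll_profile_noninc : forall n r s,
    (0 < r)%R -> (r <= s)%R -> (rhot n s <= rhot n r)%R ;
  moll_profile : forall n x y, rho n x y = rhot n (nrm (x - y)%R) ;
  moll_C0_gt0 : (0 < C0)%R ;
  moll_C0 : forall delta : R, (0 < delta)%R ->
    \int[lebesgue_measure]_(r in `]0%R, delta[) (r ^+ N.-1 * rhot n r)%:E
      @[n --> \oo] --> C0%:E ;
  moll_tail : forall (delta : R) x, (0 < delta)%R ->
    \int[lebesgue_rV N]_(y in [set y | (delta <= nrm (x - y))%R])
      (rho n x y)%:E @[n --> \oo] --> 0 }.

End mollifiers.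

(* Main.v *)
(* Fubini and the translation x = y + h turn the double integral into the
   integral over h of |f(. + h) - f|_p^p / |h|^p against the radial kernel.  As
   h -> 0 this quotient is within o(1) of the 0-homogeneous function
   l(h) = |Df . h|_p^p / |h|^p: along one coordinate, pairing with a test
   function and the mean value theorem bound f(. + s e_i) - f - s D_i f by the
   oscillation of D_i f under small translations, which tends to 0 in L^p.  The
   kernels concentrate at 0, and in polar coordinates the integral of l against
   them is the spherical integral of l times int_0^delta r^(N-1) rhot_n(r) dr,
   which tends to C0. *)

Require Import Defs.
From HB Require Import structures.
From mathcomp Require Import all_boot all_order all_algebra.
From mathcomp Require Import all_classical all_reals all_analysis.
From mathcomp Require Import measurable_realfun ring lra.
Set Implicit Arguments.
Unset Strict Implicit.
Unset Printing Implicit Defensive.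
Import Order.TTheory GRing.Theory Num.Theory.
Import numFieldNormedType.Exports.
Local Open Scope classical_set_scope.
Local Open Scope ring_scope.

(** All that is known about [Df] is its pairing with test functions, so the bound on an increment of
    f comes from L^p-L^q duality. The mean value point then depends on the test function, which is
    harmless because the bound on the translates of D_i f holds for all |t| <= |s|. Estimates are
    made on integrals of p-th powers, with a factor 2^p in place of Minkowski and Young in place of
    Hoelder; the lost constants do no harm because they multiply quantities that can be made small.
    The polar formula is needed only for integrands l(h) psi(|h|) with l homogeneous of degree 0: by
    dilation alone, the image of l dL^N under the norm gives ]-oo, s[ the mass K s^N, hence has
    density K N r^(N-1), and this N is the normalising factor of [sphere_measure]. At distance d
    from 0 the difference quotient is bounded only by a multiple of d^(-p); that constant multiplies
    a kernel mass that tends to 0 once d is fixed. *)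

Definition mpushforward d d' (T1 : measurableType d) (T2 : measurableType d')
    (R : realType) (m : {measure set T1 -> \bar R}) (f : T1 -> T2)
    (mf : measurable_fun setT f) : {measure set T2 -> \bar R} :=
  measure_function_pushforward__canonical__measure_function_Measure m mf.

(** * Affine changes of variables *)

Section affine.
Context {R : realType}.
Local Open Scope ereal_scope.
Implicit Types (c : R).

Lemma measurable_affine c (a : R) :
  measurable_fun [set: measurableTypeR R]
    (fun x : measurableTypeR R => (c * x + a)%R : measurableTypeR R).
Proof. by apply: measurable_funD => //; apply: measurable_funM. Qed.

(** The rescaled image measure agrees with Lebesgue measure on half-open intervals, and these
    determine it. *)
Lemma lebesgue_measure_affine c (a : R) (A : set (measurableTypeR R)) :
  (0 < c)%R -> measurable A ->
  c%:E * lebesgue_measure ((fun x : R => c * x + a)%R @^-1` A) =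
  lebesgue_measure A.
Proof.
move=> c0 mA.
pose nu := mscale (NngNum (ltW c0)) (mpushforward lebesgue_measure
  (measurable_affine c a)).
have -> // : lebesgue_measure A = nu A.
apply: lebesgue_measure_unique => // X [[x y]] /= _ <-.
rewrite /nu /= /mscale /= /pushforward /=.
have -> : ((fun z : R => c * z + a) @^-1` `]x, y] =
    `](x - a) / c, (y - a) / c]%classic)%R.
  apply/seteqP; split => z /=; rewrite !in_itv/= ltr_pdivrMr// ler_pdivlMr//;
    rewrite ltrBlDr lerBrDr mulrC//.
rewrite !lebesgue_measure_itv/= !lte_fin.
rewrite ltr_pM2r ?invr_gt0// ltrD2r.
case: ifPn => _; last by rewrite mule0.
rewrite -!EFinB -EFinM; congr EFin; field; lra.
Qed.

Lemma integral_lebesgue_affine c (a : R) (G : measurableTypeR R -> \bar R) :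
  (0 < c)%R -> measurable_fun setT G -> (forall x, 0 <= G x) ->
  c%:E * \int[lebesgue_measure]_x G (c * x + a)%R = \int[lebesgue_measure]_x G x.
Proof.
move=> c0 mG G0.
pose nu := mpushforward lebesgue_measure (measurable_affine c a).
transitivity (\int[mscale (NngNum (ltW c0)) nu]_x G x).
  rewrite ge0_integral_mscale//; congr (_ * _).
  rewrite [RHS](@ge0_integral_pushforward _ _ _ _ R _ (measurable_affine c a)
    lebesgue_measure setT G)//.
apply: eq_measure_integral => A mA _.
exact: lebesgue_measure_affine.
Qed.

Lemma integral_lebesgue_rVS n (F : 'rV[R]_n.+1 -> \bar R) :
  measurable_fun setT F -> (forall x, 0 <= F x) ->
  \int[lebesgue_rV n.+1]_x F x =
  \int[lebesgue_measure]_a \int[lebesgue_rV n]_z F (rV_cons (a, z)).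
Proof.
move=> mF F0.
rewrite [LHS](@ge0_integral_pushforward _ _ _ _ R _ (@measurable_rV_cons R n)
  (@lebesgue_measure R \x lebesgue_rV n) setT F)//.
rewrite preimage_setT fubini_tonelli1//=.
exact: measurableT_comp mF (@measurable_rV_cons R n).
Qed.

Lemma measurable_fun_rV_affine n c (h : 'rV[R]_n) :
  measurable_fun setT (fun x : 'rV[R]_n => (c *: x + h)%R).
Proof.
apply: measurable_fun_rVP => i.
rewrite (_ : (fun _ => _) = fun x : 'rV_n => (c * x ord0 i + h ord0 i)%R).
  apply: measurable_funD => //; apply: measurable_funM => //.
  exact: measurable_coord.
by apply/funext => x; rewrite !mxE.
Qed.

(** Induction along the product structure: the first coordinate contributes one factor c, the others
    c^n. The case c = 1 is translation invariance; h = 0 is the dilation behind the polar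
    formula. *)
Lemma integral_rV_affine n c (h : 'rV[R]_n) (F : 'rV[R]_n -> \bar R) :
  (0 < c)%R -> measurable_fun setT F -> (forall x, 0 <= F x) ->
  (c ^+ n)%:E * \int[lebesgue_rV n]_x F (c *: x + h)%R =
  \int[lebesgue_rV n]_x F x.
Proof.
move=> c0; elim: n h F => [|n IH] h F mF F0.
  rewrite expr0 mul1e; apply: eq_integral => x _; congr F.
  by apply/rowP => -[].
rewrite !integral_lebesgue_rVS//; last first.
  by apply: (measurableT_comp mF); exact: measurable_fun_rV_affine.
pose h' := rV_uncons h.
have E a z : (c *: rV_cons (a, z) + h)%R =
    rV_cons ((c * a + h'.1)%R, (c *: z + h'.2)%R).
  apply/rowP => i; rewrite [LHS]mxE [X in (X + _)%R]mxE.
  case: (@split_ordP 1 n i) => j ->.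
    by rewrite (ord1 j) !rV_consE0 /h' /rV_uncons.
  by rewrite !rV_consES !mxE.
have mF' : measurable_fun setT (fun p => F (rV_cons p)).
  exact: measurableT_comp mF (@measurable_rV_cons R n).
pose G (a : measurableTypeR R) := \int[lebesgue_rV n]_z F (rV_cons (a, z)).
have mG : measurable_fun setT G.
  exact: (measurable_fun_fubini_tonelli_F _ mF').
have G0 a : 0 <= G a by exact: integral_ge0.
rewrite -[RHS](integral_lebesgue_affine h'.1 c0 mG G0).
rewrite exprS EFinM -muleA; congr (_ * _).
rewrite -ge0_integralZl//.
- apply: eq_integral => a _; rewrite -[RHS](IH h'.2)//; last first.
    exact: (measurable_fun_pair2 _ mF').
  by congr (_ * _); apply: eq_integral => z _; rewrite E.
- apply: (measurable_fun_fubini_tonelli_F (fun p => F (c *: rV_cons p + h)%R)) => //.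
  have mF'' := measurableT_comp mF (measurable_fun_rV_affine c h).
  exact: (measurableT_comp mF'' (@measurable_rV_cons R n)).
- by move=> a _; exact: integral_ge0.
- by rewrite lee_fin exprn_ge0// ltW.
Qed.

Lemma integral_rV_translate n (h : 'rV[R]_n) (F : 'rV[R]_n -> \bar R) :
  measurable_fun setT F -> (forall x, 0 <= F x) ->
  \int[lebesgue_rV n]_x F (x + h)%R = \int[lebesgue_rV n]_x F x.
Proof.
move=> mF F0; rewrite -(integral_rV_affine h ltr01 mF F0) expr1n mul1e.
by apply: eq_integral => x _; rewrite scale1r.
Qed.

End affine.

(** * Norms and measurability on R^N *)

Section row_vectors.
Context {R : realType} {n : nat}.
Implicit Types (x y : 'rV[R]_n) (e : R).

(** The built-in norm on row vectors is the maximum norm, so its balls are cubes; [nrm] is compared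
    with it later. *)
Lemma rV_norm_ltP x e : 0 < e ->
  (`|x| < e) <-> (forall i, `|x ord0 i| < e).
Proof.
move=> e0; rewrite /Num.Def.normr /= mx_normrE; split.
  by move=> /bigmax_ltP[_ H] i; exact: (H (ord0, i)).
by move=> H; apply/bigmax_ltP; split=> // -[i j] _ /=; rewrite (ord1 i) H.
Qed.

Lemma rV_norm_leP x e : 0 <= e ->
  (`|x| <= e) <-> (forall i, `|x ord0 i| <= e).
Proof.
move=> e0; rewrite /Num.Def.normr /= mx_normrE; split.
  by move=> /bigmax_leP[_ H] i; exact: (H (ord0, i)).
by move=> H; apply/bigmax_leP; split=> // -[i j] _ /=; rewrite (ord1 i) H.
Qed.

Lemma rV_coord_norm x i : `|x ord0 i| <= `|x|.
Proof. by move: i; apply/(rV_norm_leP x (normr_ge0 x)). Qed.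

Definition rV_box (a b : 'rV[R]_n) : set 'rV[R]_n :=
  [set x | forall i, a ord0 i < x ord0 i < b ord0 i].

Lemma rV_boxE a b : rV_box a b =
  \bigcap_i (fun x => x ord0 i) @^-1` `]a ord0 i, b ord0 i[%classic.
Proof.
apply/seteqP; split => x /=; last by move=> H i; have := H i I; rewrite /= in_itv.
by move=> H i _; rewrite /= in_itv /= H.
Qed.

Lemma measurable_rV_box a b : measurable (rV_box a b).
Proof.
rewrite rV_boxE; apply: fin_bigcap_measurable.
  exact: finite_finset.
move=> i _; rewrite -[X in measurable X]setTI; exact: measurable_coord.
Qed.

(** An open set is the countable union of the boxes with rational corners that it contains, and
    boxes are measurable for the sigma-algebra of the coordinates. *)
Lemma open_rV_measurable (U : set 'rV[R]_n) : open U -> measurable U.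
Proof.
move=> oU.
pose B (ab : 'rV[rat]_n * 'rV[rat]_n) : set 'rV[R]_n :=
  rV_box (map_mx ratr ab.1) (map_mx ratr ab.2).
rewrite (_ : U = \bigcup_ab (if `[< B ab `<=` U >] then B ab else set0)).
  apply: countable_bigcupT_measurable => // ab.
  by case: ifP => _ //; exact: measurable_rV_box.
apply/seteqP; split => [x Ux|x [ab _]]; last by case: asboolP => // + ?; exact.
have [e /= e0 eU] : exists2 e, 0 < e & ball x e `<=` U.
  by apply/nbhs_ballP; move: oU; rewrite openE => /(_ _ Ux).
have e2 : 0 < e / 2 by rewrite divr_gt0.
have /choice[a Ha] i : exists q : rat, x ord0 i - e / 2 < ratr q < x ord0 i.
  by have [q] := @rat_in_itvoo R (x ord0 i - e / 2) (x ord0 i) ltac:(lra);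
    rewrite in_itv/=; exists q.
have /choice[b Hb] i : exists q : rat, x ord0 i < ratr q < x ord0 i + e / 2.
  by have [q] := @rat_in_itvoo R (x ord0 i) (x ord0 i + e / 2) ltac:(lra);
    rewrite in_itv/=; exists q.
exists (\row_i a i, \row_i b i) => //.
rewrite asboolT; last first.
  move=> y /= Hy; apply: eU; rewrite -ball_normE /=; apply/rV_norm_ltP => // i.
  have := Hy i; have := Ha i; have := Hb i; rewrite !mxE ltr_norml; lra.
by move=> i; have := Ha i; have := Hb i; rewrite !mxE; lra.
Qed.

Lemma continuous_rV_measurable (F : 'rV[R]_n -> R) :
  continuous F -> measurable_fun setT F.
Proof.
move=> /continuousP cF.
apply: (measurability (@RGenOpens.G R)).
  exact: RGenOpens.measurableE.
move=> _ [_ [a [b ->]] <-]; rewrite setTI.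
apply: open_rV_measurable; apply: cF; exact: interval_open.
Qed.

End row_vectors.

Section norms.
Context {R : realType} {n : nat} (nrm : 'rV[R]_n -> R).
Hypothesis hnrm : is_norm nrm.

Lemma is_norm0 : nrm 0 = 0.
Proof. by have := is_normZ hnrm 0 0; rewrite scale0r normr0 mul0r. Qed.

Lemma is_normN x : nrm (- x) = nrm x.
Proof. by rewrite -scaleN1r is_normZ// normrN1 mul1r. Qed.

Lemma is_norm_ge0 x : 0 <= nrm x.
Proof.
have := is_norm_triangle hnrm x (- x).
by rewrite subrr is_norm0 is_normN -mulr2n pmulrn_lge0.
Qed.

Lemma is_norm_gt0 x : x != 0 -> 0 < nrm x.
Proof.
move=> x0; rewrite lt_neqAle is_norm_ge0 andbT eq_sym.
by apply: contra x0 => /eqP/(is_norm_eq0 hnrm)/eqP.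
Qed.

Lemma is_norm_sum (I : Type) (s : seq I) (F : I -> 'rV[R]_n) :
  nrm (\sum_(i <- s) F i) <= \sum_(i <- s) nrm (F i).
Proof.
elim/big_ind2 : _ => //; first by rewrite is_norm0.
by move=> x1 x2 y1 y2 H1 H2; rewrite (le_trans (is_norm_triangle hnrm _ _))// lerD.
Qed.

Lemma is_norm_le : exists2 C, 0 < C & forall x, nrm x <= C * `|x|.
Proof.
exists (1 + \sum_(i < n) nrm (delta_mx ord0 i)).
  by rewrite ltr_wpDr// sumr_ge0// => i _; exact: is_norm_ge0.
move=> x; rewrite {1}(row_sum_delta x) (le_trans (is_norm_sum _ _))//.
rewrite mulrDl mul1r mulr_suml ler_wpDl// ler_sum// => i _.
by rewrite is_normZ// mulrC ler_wpM2l ?is_norm_ge0// rV_coord_norm.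
Qed.

Lemma is_norm_continuous : continuous nrm.
Proof.
move=> x; have [C C0 HC] := is_norm_le.
apply/(@cvgrPdist_lt R R^o 'rV[R]_n (nbhs x)) => e e0; near=> y.
have xy : nrm (x - y) < e.
  rewrite (le_lt_trans (HC _))// mulrC -ltr_pdivlMr//.
  near: y; apply: cvgr_dist_lt => //; by rewrite divr_gt0.
have := is_norm_triangle hnrm (x - y) y; have := is_norm_triangle hnrm (y - x) x.
rewrite !subrK -(is_normN (y - x)) opprB ltr_norml; lra.
Unshelve. all: by end_near. Qed.

(** The constant is the minimum of [nrm] on the compact unit sphere of the maximum norm; homogeneity
    extends the bound to all vectors. *)
Lemma is_norm_ge : exists2 c, 0 < c & forall x, c * `|x| <= nrm x.
Proof.
pose S : set 'rV[R]_n := [set x | `|x| = 1].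
have cS : compact S.
  apply: bounded_closed_compact.
    exists 1; split; first exact: num_real.
    by move=> M M1 x /= Sx; rewrite Sx; exact: ltW.
  rewrite (_ : S = (fun x => `|x|) @^-1` [set 1]) //.
  by apply: closed_comp; [move=> x _; exact: norm_continuous|exact: closed_eq].
have nS x : x != 0 -> S (`|x|^-1 *: x).
  by move=> x0; rewrite /S /= normrZ normfV normr_id mulVf// normr_eq0.
(* An empty sphere means that 0 is the only vector (dimension 0), and any constant will do. *)
have [S0|/set0P S0] := eqVneq S set0.
  exists 1 => // x; have [->|/nS] := eqVneq x 0; last by rewrite S0.
  by rewrite normr0 mulr0 is_norm0.
have [|v Sv Hv] := EVT_min_rV S0 cS (f := nrm).
  by apply: continuous_subspaceT => x; exact: is_norm_continuous.
have v0 : v != 0 by apply/eqP => v0; move: Sv; rewrite /S /= v0 inE /= normr0; lra.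
exists (nrm v); first exact: is_norm_gt0.
move=> x; have [->|x0] := eqVneq x 0; first by rewrite normr0 mulr0 is_norm0.
have := Hv _ (mem_set (nS _ x0)); rewrite is_normZ// normfV normr_id.
by rewrite ler_pdivlMl ?normr_gt0// mulrC.
Qed.

End norms.

(** * Inequalities for real powers *)

Section powR_inequalities.
Context {R : realType}.
Implicit Types (a b e p q : R).

(** Bound |a + b| by twice the larger term. This crude form stands in for Minkowski's inequality. *)
Lemma powR_normD_le p : 0 < p -> forall a b,
  `|a + b| `^ p <= 2 `^ p * (`|a| `^ p + `|b| `^ p).
Proof.
move=> p0 a b.
wlog ab : a b / `|a| <= `|b|.
  move=> H; have [/H//|/ltW/H] := leP `|a| `|b|.
  by rewrite addrC [X in _ * X]addrC.
apply: (@le_trans _ _ ((2 * `|b|) `^ p)).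
  by rewrite ge0_ler_powR ?nnegrE ?mulr_ge0//; [lra|have := ler_normD a b; lra].
by rewrite powRM// ler_wpM2l ?powR_ge0// lerDr powR_ge0.
Qed.

Lemma powR_norm_sum_le p n : 0 < p -> exists2 K, 0 <= K &
  forall F : 'I_n -> R, `|\sum_(i < n) F i| `^ p <= K * \sum_(i < n) `|F i| `^ p.
Proof.
move=> p0; elim: n => [|n [K K0 IH]].
  by exists 0 => // F; rewrite !big_ord0 normr0 powR0 ?gt_eqF// mulr0.
exists (2 `^ p * (1 + K)); first by rewrite mulr_ge0 ?powR_ge0// addr_ge0.
move=> F; rewrite !big_ord_recl (le_trans (powR_normD_le p0 _ _))// -mulrA.
rewrite ler_wpM2l ?powR_ge0// mulrDl mul1r.
have H := IH (fun i => F (lift ord0 i)).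
have S0 : 0 <= \sum_(i < n) `|F (lift ord0 i)| `^ p.
  by rewrite sumr_ge0// => i _; exact: powR_ge0.
have H2 := powR_ge0 `|F ord0| p.
have := mulr_ge0 K0 H2; rewrite mulrDr; lra.
Qed.

Lemma powR_norm_near1 p e : 0 < e ->
  exists2 d, 0 < d < 1 & forall t, `|t - 1| <= d -> `|t `^ p - 1| <= e.
Proof.
move=> e0.
have c1 : {for 1, continuous (fun t : R => t `^ p)}.
  apply/differentiable_continuous/derivable1_diffP/derivable_powR.
  by rewrite in_itv/= ltr01.
move/cvgrPdist_le : c1 => /(_ e e0) /nbhs_ballP[d /= d0 Hd].
exists (Num.min d 1 / 2).
  by rewrite divr_gt0 ?lt_min ?d0//= ltr_pdivrMr// mul1r gt_min; lra.
move=> t td; rewrite distrC; have := Hd t; rewrite powR1; apply.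
rewrite /ball /= distrC (le_lt_trans td)// ltr_pdivrMr// gt_min.
by apply/orP; left; lra.
Qed.

(** If |b| <= d |a|, factor out |a|^p and use continuity of t^p at t = 1. Otherwise |a| and |a + b|
    are both at most (1/d + 1) |b|, and the last term absorbs everything. *)
Lemma powR_normD_sub p e : 0 < p -> 0 < e -> exists2 C, 0 <= C &
  forall a b, `| `|a + b| `^ p - `|a| `^ p| <= e * `|a| `^ p + C * `|b| `^ p.
Proof.
move=> p0 e0; have [d /andP[d0 d1] Hd] := powR_norm_near1 p e0.
have k0 : 0 <= d^-1 + 1 by rewrite addr_ge0// invr_ge0 ltW.
exists ((d^-1 + 1) `^ p); first exact: powR_ge0.
move=> a b; have [bda|abd] := leP `|b| (d * `|a|).
  have [a0|a0] := eqVneq a 0.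
    move: bda; rewrite a0 normr0 mulr0 normr_le0 => /eqP ->.
    by rewrite add0r normr0 powR0 ?gt_eqF// subrr normr0 !mulr0 addr0.
  apply: (@le_trans _ _ (e * `|a| `^ p)); last first.
    by rewrite lerDl mulr_ge0 ?powR_ge0.
  have -> : a + b = a * (1 + b / a) by field.
  rewrite normrM powRM// -{2}[`|a| `^ p]mulr1 -mulrBr normrM ger0_norm ?powR_ge0//.
  rewrite mulrC ler_wpM2r ?powR_ge0//; apply: Hd.
  have := ler_dist_dist (1 + b / a) 1; rewrite normr1 [1 + _]addrC addrK => /le_trans.
  by apply; rewrite normf_div ler_pdivrMr ?normr_gt0.
rewrite ler_wpDl ?mulr_ge0 ?powR_ge0 ?(ltW e0)//.
have ab : `|a| <= d^-1 * `|b| by rewrite ler_pdivlMl// ltW.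
have H x : 0 <= x -> x <= (d^-1 + 1) * `|b| ->
    0 <= x `^ p <= (d^-1 + 1) `^ p * `|b| `^ p.
  by move=> x0 xb; rewrite powR_ge0/= -powRM// ge0_ler_powR ?nnegrE ?mulr_ge0// ltW.
have /andP[H1 H2] := H `|a + b| (normr_ge0 _) ltac:(have := ler_normD a b; lra).
have /andP[H3 H4] := H `|a| (normr_ge0 _) ltac:(have := normr_ge0 b; lra).
by rewrite ler_norml; apply/andP; split; lra.
Qed.

(** Young's inequality for s|a| and |b|/s with s^p = e; the factor 1/p in front of |a|^p is then
    dropped. *)
Lemma powR_young p q e : 0 < p -> 0 < q -> p^-1 + q^-1 = 1 -> 0 < e ->
  exists2 C, 0 <= C & forall a b, `|a * b| <= e * `|a| `^ p + C * `|b| `^ q.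
Proof.
move=> p0 q0 pq e0.
have p1 : 1 <= p by rewrite -invf_le1// -pq lerDl invr_ge0 ltW.
pose s := e `^ p^-1; have s0 : 0 < s by exact: powR_gt0.
exists (s^-1 `^ q / q); first by rewrite divr_ge0 ?powR_ge0 ?ltW.
move=> a b.
have -> : `|a * b| = (s * `|a|) * (s^-1 * `|b|) by rewrite normrM; field; lra.
apply: le_trans (conjugate_powR _ _ p0 q0 pq) _; rewrite ?mulr_ge0 ?invr_ge0 ?(ltW s0)//.
rewrite !powRM ?invr_ge0 ?(ltW s0)// /s -powRrM mulVf ?gt_eqF// powRr1 ?(ltW e0)//.
rewrite -[leLHS]/(_ + _) [X in _ + X]mulrAC lerD2r.
by rewrite ler_pdivrMr// ler_peMr// mulr_ge0 ?powR_ge0// ltW.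
Qed.

End powR_inequalities.

(** * Smooth functions *)

Section smooth_line.
Context {R : realType}.
Implicit Types (f g : R -> R) (k m : nat) (a b x : R).

(** One-variable counterpart of [Cn], used for the factors of product test functions. *)
Fixpoint smooth_upto k f : Prop :=
  match k with
  | 0 => continuous f
  | k.+1 => (forall x, derivable f x 1) /\ smooth_upto k f^`()%classic
  end.

Definition smooth f := forall k, smooth_upto k f.

Lemma smooth_uptoS k f : smooth_upto k.+1 f -> smooth_upto k f.
Proof.
elim: k f => [|k IH] f [df cf]; last by split => //; exact: IH.
by move=> x; exact/differentiable_continuous/derivable1_diffP/df.
Qed.

Lemma smooth_upto_is_derive k f g : (forall x, is_derive x 1 f (g x)) ->
  smooth_upto k g -> smooth_upto k.+1 f.
Proof.
move=> fg; have -> : g = f^`()%classic by apply/funext => x; rewrite derive1E derive_val.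
by split.
Qed.

Lemma smooth_uptoD k f g :
  smooth_upto k f -> smooth_upto k g -> smooth_upto k (f + g).
Proof.
elim: k f g => [|k IH] f g; first by move=> cf cg x; exact: cvgD (cf x) (cg x).
move=> [df cf] [dg cg]; apply: (@smooth_upto_is_derive _ _ (f^`()%classic + g^`()%classic)).
  move=> x; rewrite [X in is_derive _ _ _ X](_ : _ = f^`()%classic x + g^`()%classic x)// !derive1E.
  by apply: is_deriveD; exact/derivableP.
exact: IH.
Qed.

Lemma smooth_uptoM k f g :
  smooth_upto k f -> smooth_upto k g -> smooth_upto k (f * g).
Proof.
elim: k f g => [|k IH] f g; first by move=> cf cg x; exact: cvgM (cf x) (cg x).
move=> sf sg; have := sf; have := sg; move=> [dg cg] [df cf].
apply: (@smooth_upto_is_derive _ _ (f * g^`()%classic + g * f^`()%classic)).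
  move=> x.
  rewrite [X in is_derive _ _ _ X](_ : _ = f x *: g^`()%classic x + g x *: f^`()%classic x)//.
  by rewrite !derive1E; apply: is_deriveM; exact/derivableP.
by apply: smooth_uptoD; apply: IH => //; exact: smooth_uptoS.
Qed.

Lemma smooth_upto_cst k a : smooth_upto k (cst a).
Proof.
elim: k a => [|k IH] a; first exact: cst_continuous.
exact: (@smooth_upto_is_derive _ _ (cst 0)).
Qed.

Lemma smooth_upto_affine k f a b :
  smooth_upto k f -> smooth_upto k (fun x => f (a * x + b)).
Proof.
elim: k f => [|k IH] f.
  move=> cf x; apply: (@cvg_comp _ _ _ _ f) (cf _).
  by apply: cvgD; [apply: cvgM; [exact: cvg_cst|exact: cvg_id]|exact: cvg_cst].
move=> [df cf].
apply: (@smooth_upto_is_derive _ _ (cst a * (fun x => f^`()%classic (a * x + b)))).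
  move=> x.
  have dg : is_derive x 1 (fun x => a * x + b) a.
    have : is_derive x 1 (a \*: (@id R) + cst b) (a *: 1 + 0) by exact: is_deriveD.
    by rewrite addr0 [_%:A]mulr1.
  apply: (is_derive_eq (is_derive1_comp (f := f) (derivableP (df _)) dg)).
  by rewrite mulrC -derive1E.
by apply: smooth_uptoM; [exact: smooth_upto_cst|exact: IH].
Qed.

Lemma smoothD f g : smooth f -> smooth g -> smooth (f + g).
Proof. by move=> sf sg k; exact: smooth_uptoD. Qed.

Lemma smoothM f g : smooth f -> smooth g -> smooth (f * g).
Proof. by move=> sf sg k; exact: smooth_uptoM. Qed.

Lemma smoothX f m : smooth f -> smooth (f ^+ m).
Proof.
move=> sf; elim: m => [|m IH]; last by rewrite exprS; exact: smoothM.
by rewrite expr0 => k; exact: (smooth_upto_cst k 1).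
Qed.

Lemma smooth_derive f : smooth f -> smooth f^`()%classic.
Proof. by move=> sf k; have [] := sf k.+1. Qed.

Lemma smooth_derivable f x : smooth f -> derivable f x 1.
Proof. by move=> /(_ 1%N)[]. Qed.

(* The functions x^-m exp(-1/x) extended by 0; the family is stable under
   differentiation up to linear combinations. *)
Definition flat m x : R := if 0 < x then x^-1 ^+ m * expR (- x^-1) else 0.

Lemma flat_ge0 m x : 0 <= flat m x.
Proof.
rewrite /flat; case: ifP => // x0.
by rewrite mulr_ge0 ?expR_ge0 ?exprn_ge0 ?invr_ge0 ?ltW.
Qed.

(** With y = 1/x, the exponential series gives exp y >= y^(m+1) / (m+1)!, hence y^m exp(-y) <=
    (m+1)! / y. This linear bound yields the limit at 0 for every m. *)
Lemma flat_le m x : flat m x <= m.+1`!%:R * `|x|.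
Proof.
rewrite /flat; case: ifP => x0; last by rewrite mulr_ge0.
rewrite gtr0_norm// expRN ler_pdivrMr ?expR_gt0//.
have y0 : 0 <= x^-1 by rewrite invr_ge0 ltW.
have := expR_ge1Dxn m y0.
have f0 : 0 < m.+1`!%:R :> R by rewrite ltr0n fact_gt0.
move=> H; have : m.+1`!%:R * x * (1 + x^-1 ^+ m.+1 / m.+1`!%:R) <=
   m.+1`!%:R * x * expR x^-1 by rewrite ler_wpM2l// mulr_ge0// ltW.
apply: le_trans; rewrite mulrDr mulr1 exprS.
have -> : m.+1`!%:R * x * (x^-1 * x^-1 ^+ m / m.+1`!%:R) = x^-1 ^+ m.
  by field; rewrite gt_eqF// gt_eqF.
by rewrite lerDr mulr_ge0 ?ltW.
Qed.

Lemma flat_cvg0 m : flat m x @[x --> 0] --> 0.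
Proof.
apply/norm_cvg0P; apply: (@squeeze_cvgr _ _ _ _ (cst 0) (fun x => m.+1`!%:R * `|x|)).
- by near=> x; rewrite normr_ge0 ger0_norm ?flat_ge0// flat_le.
- exact: cvg_cst.
- have : m.+1`!%:R * `|x| @[x --> (0 : R)] --> m.+1`!%:R * `|(0 : R)|.
    by apply: cvgMl_tmp; exact: norm_continuous.
  by rewrite normr0 mulr0.
Unshelve. all: by end_near. Qed.

Lemma flat_is_derive m x :
  is_derive x 1 (flat m) (flat m.+2 x - m%:R * flat m.+1 x).
Proof.
have [x0|x0|<-] := ltgtP 0 x.
- apply: (@near_eq_is_derive _ _ _ (fun y : R => y^-1 ^+ m * expR (- y^-1))).
    by near=> y; rewrite /flat ifT//; near: y; exact: lt_nbhsr.
  rewrite /flat x0.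
  have dV : is_derive x 1 (fun y : R => y^-1) (- x ^- 2).
    by apply: is_derive_eq; first apply: is_deriveV; [rewrite gt_eqF|rewrite [_%:A]mulr1].
  have dX := @is_deriveX _ _ _ m x 1 _ dV.
  have dE : is_derive x 1 (fun y : R => expR (- y^-1)) (expR (- x^-1) * x ^- 2).
    have dN := @is_deriveN _ _ _ _ x 1 _ dV.
    by rewrite -[x ^- 2]opprK; exact: (is_derive1_comp (is_derive_expR _) dN).
  rewrite (_ : (fun _ => _) = (fun y : R => y^-1) ^+ m * (fun y => expR (- y^-1)));
    last by apply/funext => y; rewrite !fctE.
  apply: (is_derive_eq (is_deriveM dX dE)).
  rewrite /GRing.scale /= !fctE -!exprVn; case: (m) => [|k] /=; first by ring.
  by rewrite !exprS; ring.
- apply: (@near_eq_is_derive _ _ _ (cst 0)).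
    near=> y; rewrite /flat ifF//; apply/negbTE; rewrite -leNgt ltW//.
    by near: y; exact: lt_nbhsl.
  by rewrite /flat ltNge (ltW x0)/= mulr0 subr0; exact: is_derive_cst.
- rewrite {2 3}/flat ltxx mulr0 subr0.
  (* At 0 the difference quotient of [flat m] is [flat m.+1], which tends to 0. *)
  have H : (fun h : R => h^-1 *: ((flat m \o shift 0) (h *: 1) - flat m 0)) @ 0^'
      --> (0 : R).
    apply: (@cvg_trans _ (flat m.+1 @ 0^')); last exact: cvg_within_filter (flat_cvg0 _).
    apply: near_eq_cvg; near=> h.
    rewrite /= addr0 [flat m 0]/flat ltxx subr0 [_ *: 1]mulr1 /flat.
    by case: ifP => _; rewrite ?scaler0// exprS -mulrA.
  by apply: DeriveDef; [apply/cvg_ex; exists 0|exact: cvg_lim].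
Unshelve. all: by end_near. Qed.

Lemma smooth_flat m : smooth (flat m).
Proof.
move=> k; elim: k m => [|k IH] m.
  move=> x; apply/differentiable_continuous/derivable1_diffP.
  by have [] := flat_is_derive m x.
apply: smooth_upto_is_derive (flat_is_derive m) _.
rewrite (_ : (fun _ => _) = flat m.+2 + cst (- m%:R) * flat m.+1).
  by apply: smooth_uptoD => //; apply: smooth_uptoM => //; exact: smooth_upto_cst.
by apply/funext => x; rewrite !fctE mulNr.
Qed.

(** The product u of the two flat functions lies in [0, 1[ and is positive exactly on ]a, b[. Hence
    1 - (1 - u)^(m+1) is smooth, takes values in [0, 1], vanishes off ]a, b[, and tends pointwise to
    the indicator of ]a, b[ as m grows: a smooth approximation obtained without convolution. *)
Definition bump a b m x : R :=
  1 - (1 - flat 0 (x - a) * flat 0 (b - x)) ^+ m.+1.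

Lemma smooth_bump a b m : smooth (bump a b m).
Proof.
have s1 : smooth (fun x => flat 0 (1 * x + - a)).
  by move=> k; exact: smooth_upto_affine (smooth_flat 0 k).
have s2 : smooth (fun x => flat 0 (- 1 * x + b)).
  by move=> k; exact: smooth_upto_affine (smooth_flat 0 k).
have sc c : smooth (cst c) by move=> k; exact: smooth_upto_cst.
have := smoothD (sc 1) (smoothM (sc (-1)) (smoothX m.+1
  (smoothD (sc 1) (smoothM (sc (-1)) (smoothM s1 s2))))).
congr smooth; apply/funext => x; rewrite !fctE /bump.
by rewrite !mulN1r mul1r [- x + b]addrC.
Qed.

Lemma flat0_lt1 x : flat 0 x < 1.
Proof.
rewrite /flat; case: ifP => // x0; rewrite expr0 mul1r expR_lt1 oppr_lt0 invr_gt0//.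
Qed.

Lemma flat_itv a b x : 0 <= flat 0 (x - a) * flat 0 (b - x) < 1.
Proof.
rewrite mulr_ge0 ?flat_ge0//= -[ltRHS]mulr1.
by rewrite (le_lt_trans (ler_wpM2l (flat_ge0 _ _) (ltW (flat0_lt1 _))))// ltr_pM2r// flat0_lt1.
Qed.

Lemma bump_itv a b m x : 0 <= bump a b m x <= 1.
Proof.
have /andP[H1 H2] := flat_itv a b x.
have H : 0 <= (1 - flat 0 (x - a) * flat 0 (b - x)) ^+ m.+1 <= 1.
  by rewrite exprn_ge0 ?exprn_ile1//; lra.
by rewrite /bump; lra.
Qed.

Lemma bump_out a b m x : ~~ (a < x < b) -> bump a b m x = 0.
Proof.
move=> xab; rewrite /bump (_ : _ * _ = 0) ?subr0 ?expr1n ?subrr//.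
move: xab; rewrite negb_and -!leNgt => /orP[xa|bx].
  by rewrite {1}/flat subr_gt0 ltNge xa mul0r.
by rewrite {2}/flat subr_gt0 ltNge bx mulr0.
Qed.

Lemma bump_cvg a b x : bump a b m x @[m --> \oo] --> ((a < x < b)%R%:R : R).
Proof.
have [xab|xab] := boolP (a < x < b); last first.
  by under eq_cvg do rewrite bump_out//; exact: cvg_cst.
rewrite -[X in _ --> X]subr0; apply: cvgB; first exact: cvg_cst.
have /andP[H1 H2] := flat_itv a b x.
have H3 : 0 < flat 0 (x - a) * flat 0 (b - x).
  case/andP: xab => xa xb.
  by rewrite mulr_gt0// /flat subr_gt0 ?xa ?xb expr0 mul1r expR_gt0.
set c := 1 - _; have H4 : c * c ^+ m @[m --> \oo] --> c * 0.
  by apply: cvgMl_tmp; apply: cvg_expr; rewrite /c ger0_norm; lra.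
rewrite mulr0 in H4; apply: cvg_trans H4; apply: near_eq_cvg.
by near=> m; rewrite exprS.
Unshelve. all: by end_near. Qed.

End smooth_line.

(** * Test functions on R^N *)

Section test_functions.
Context {R : realType} {N : nat}.
Implicit Types (phi psi : 'rV[R]_N -> R) (h x v : 'rV[R]_N) (k : nat).

Lemma compact_closure_supportP phi :
  compact (closure [set x | phi x != 0]) <->
  exists M, forall x, M < `|x| -> phi x = 0.
Proof.
split=> [/compact_bounded[M [_ HM]]|[M HM]].
  exists (M + 1) => x xM; apply/eqP/negPn/negP => px.
  have M1 : M < M + 1 by rewrite ltrDl.
  have := HM _ M1 x (subset_closure (px : [set x | phi x != 0] x)) => /=.
  by rewrite leNgt xM.
apply: bounded_closed_compact; last exact: closed_closure.
exists M; split; first exact: num_real.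
move=> m Mm; suff H : closure [set x | phi x != 0] `<=` [set x | `|x| <= m].
  by move=> x; exact: H.
have cB : closed [set x : 'rV[R]_N | `|x| <= m].
  rewrite (_ : mkset _ = (fun x => `|x|) @^-1` [set r | r <= m]) //.
  by apply: closed_comp; [move=> y _; exact: norm_continuous|exact: closed_le].
rewrite [X in _ `<=` X](closure_id _).1//.
apply: closure_subset => x /=; apply: contra_neqT; rewrite -ltNge => xm.
by apply: HM; exact: lt_trans xm.
Qed.

(** With its converse [rV_line_derive0], this turns a directional derivative into a derivative along
    a line, where the one-variable rules apply. *)
Lemma rV_line_derive (V : normedModType R) (F : 'rV[R]_N -> V) x v t d :
  is_derive (t *: v + x) v F d -> is_derive t 1 (fun s : R => F (s *: v + x)) d.
Proof.
have E : (fun h : R => h^-1 *: ((F \o shift (t *: v + x)) (h *: v) - F (t *: v + x))) =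
    (fun h : R => h^-1 *: (((fun s : R => F (s *: v + x)) \o shift t) (h *: 1) -
      F (t *: v + x))).
  apply/funext => h /=; congr (_ *: (F _ - _)).
  by rewrite [h *: 1]mulr1 scalerDl addrA.
move=> [H1 H2]; split.
  by rewrite /derivable -E; exact: H1.
by rewrite /derive -E; exact: H2.
Qed.

Lemma rV_line_derive0 (V : normedModType R) (F : 'rV[R]_N -> V) x v d :
  is_derive (0 : R) 1 (fun s : R => F (s *: v + x)) d -> is_derive x v F d.
Proof.
have E : (fun h : R => h^-1 *: ((F \o shift x) (h *: v) - F x)) =
    (fun h : R => h^-1 *: (((fun s : R => F (s *: v + x)) \o shift 0) (h *: 1) -
      F (0 *: v + x))).
  apply/funext => h /=; rewrite scale0r add0r addr0.
  by rewrite [h *: 1]mulr1.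
move=> [H1 H2]; split.
  by rewrite /derivable E; exact: H1.
by rewrite /derive E; exact: H2.
Qed.

Lemma Cn_is_derive k phi (psi : 'I_N -> 'rV[R]_N -> R) :
  (forall i x, is_derive x (delta_mx ord0 i) phi (psi i x)) ->
  (forall i, Cn k (psi i)) -> Cn k.+1 phi.
Proof.
move=> dphi cpsi i; split => [x|]; first exact: ex_derive.
have -> : partial i phi = psi i by apply/funext => x; exact: derive_val.
exact: cpsi.
Qed.

Lemma Cn_lin k a phi psi : Cn k phi -> Cn k psi ->
  Cn k (fun x => a * phi x + psi x).
Proof.
elim: k phi psi => [|k IH] phi psi /=.
  move=> cp cq; rewrite (_ : (fun _ => _) = (cst a * phi) + psi)//.
  move=> x; apply: continuousD; last exact: cq.
  by apply: continuousM; [exact: cst_continuous|exact: cp].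
move=> cp cq.
apply: (@Cn_is_derive _ _ (fun i x => a * partial i phi x + partial i psi x)).
  move=> i x; have [[dp _] [dq _]] := (cp i, cq i).
  have := @is_deriveD _ _ _ (a \*: phi) psi x (delta_mx ord0 i) _ _
    (@is_deriveZ _ _ _ phi a x _ _ (derivableP (dp x))) (derivableP (dq x)).
  by [].
by move=> i; apply: IH; [case: (cp i)|case: (cq i)].
Qed.

Lemma Cn_shift k h phi : Cn k phi -> Cn k (fun x => phi (x + h)).
Proof.
elim: k phi => [|k IH] phi /=.
  move=> cp x; apply: (@cvg_comp _ _ _ (fun x => x + h) phi) (cp _).
  exact: (cvgD cvg_id (cvg_cst h)).
move=> cp; apply: (@Cn_is_derive _ _ (fun i x => partial i phi (x + h))).
  move=> i x; have [dp _] := cp i; apply: rV_line_derive0.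
  rewrite (_ : (fun _ => _) = fun s => phi (s *: delta_mx ord0 i + (x + h))).
    by apply: rV_line_derive; rewrite scale0r add0r; exact/derivableP.
  by apply/funext => s; rewrite addrA.
by move=> i; apply: IH; case: (cp i).
Qed.

(** The j-th partial derivative replaces the j-th factor by its derivative, so products of smooth
    one-variable functions are stable under partial derivatives; hence the induction is over all
    families g. *)
Lemma Cn_prod k (g : 'I_N -> R -> R) : (forall i, smooth (g i)) ->
  Cn k (fun x => \prod_i g i (x ord0 i)).
Proof.
elim: k g => [|k IH] g sg.
  apply: continuous_big => [|i _ x].
    by move=> z; apply: cvgM; [exact: cvg_fst|exact: cvg_snd].
  apply: (@cvg_comp _ _ _ (fun x : 'rV[R]_N => x ord0 i) (g i)); last exact: (sg i 0%N).
  exact: coord_continuous.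
pose dg j i := if i == j then ((g i)^`()%classic : R -> R) else g i.
apply: (@Cn_is_derive _ _ (fun j x => \prod_i dg j i (x ord0 i))); last first.
  move=> j; apply: IH => i; rewrite /dg; case: eqP => _ //.
  exact: smooth_derive.
move=> j x; apply: rV_line_derive0.
pose c := \prod_(i | i != j) g i (x ord0 i).
rewrite (_ : (fun _ => _) = c \*: (fun s : R => g j (s + x ord0 j))); last first.
  apply/funext => s; rewrite (bigD1 j)//= !mxE !eqxx mulr1 mulrC.
  congr (_ * _); apply: eq_bigr => i ij.
  by rewrite !mxE (negbTE ij) mulr0 add0r.
rewrite (_ : \prod_i _ = c *: (g j)^`()%classic (0 + x ord0 j)); last first.
  rewrite (bigD1 j)//= /dg eqxx add0r mulrC; congr (_ * _).
  by apply: eq_bigr => i ij; rewrite (negbTE ij).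
apply: is_deriveZ.
have d1 : is_derive (0 : R) 1 (fun s : R => s + x ord0 j) 1.
  exact: is_derive_shift.
have d2 : is_derive (0 + x ord0 j) 1 (g j) ((g j)^`()%classic (0 + x ord0 j)).
  by rewrite derive1E; exact/derivableP/smooth_derivable.
have := @is_derive1_comp _ (g j) (fun s : R => s + x ord0 j) 0 _ _ d2 d1.
by rewrite mulr1.
Qed.

Lemma test_function_lin a phi psi : test_function phi -> test_function psi ->
  test_function (fun x => a * phi x + psi x).
Proof.
move=> [cp /compact_closure_supportP[M HM]] [cq /compact_closure_supportP[K HK]].
split; first by move=> k; exact: Cn_lin.
apply/compact_closure_supportP; exists (Num.max M K) => x.
by rewrite gt_max => /andP[xM xK]; rewrite HM// HK// mulr0 addr0.
Qed.

Lemma test_function_shift h phi : test_function phi ->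
  test_function (fun x => phi (x + h)).
Proof.
move=> [cp /compact_closure_supportP[M HM]]; split; first by move=> k; exact: Cn_shift.
apply/compact_closure_supportP; exists (M + `|h|) => x xM; apply: HM.
by have := ler_normB (x + h) h; rewrite addrK; lra.
Qed.

Lemma test_function0 : test_function (fun _ : 'rV[R]_N => 0 : R).
Proof.
split; last by apply/compact_closure_supportP; exists 0.
elim=> [|k IH]; first exact: cst_continuous.
exact: (@Cn_is_derive _ _ (fun=> fun=> 0)).
Qed.

Lemma test_function_partial i phi : test_function phi ->
  test_function (partial i phi).
Proof.
move=> [cp /compact_closure_supportP[M HM]].
split=> [k|]; first by have [] := cp k.+1 i.
apply/compact_closure_supportP; exists M => x Mx.
rewrite /partial; have /near_eq_derive -> : \near x, phi x = cst 0 x.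
  near=> y; apply: HM; near: y.
  have : {for x, continuous (fun x : 'rV[R]_N => `|x|)} by exact: norm_continuous.
  by move/(_ [set r | M < r]); apply; exact: lt_nbhsr.
by rewrite derive_cst.
Unshelve. all: by end_near. Qed.

Lemma test_function_continuous phi : test_function phi -> continuous phi.
Proof. by move=> [/(_ 0%N)]. Qed.

Lemma test_function_measurable phi : test_function phi -> measurable_fun setT phi.
Proof. by move=> /test_function_continuous/continuous_rV_measurable. Qed.

(** A single constant bounds both the values and the radius of the support, so that phi is dominated
    by a multiple of the indicator of a cube. *)
Lemma test_function_bounded phi : test_function phi ->
  exists2 B, 0 < B & forall x, `|phi x| <= B * (`|x| <= B)%R%:R.
Proof.
move=> tp; have cp := test_function_continuous tp.
have [_ cS] := tp; have /compact_closure_supportP[M HM] := cS.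
have /compact_bounded[K [_ HK]] : compact (phi @` closure [set x | phi x != 0]).
  by apply: continuous_compact => //; exact: continuous_subspaceT.
exists (`|M| + `|K| + 1); first by rewrite ltr_pwDr// addr_ge0.
move=> x; have [px|px] := eqVneq (phi x) 0.
  by rewrite px normr0 mulr_ge0// !addr_ge0.
have -> : `|x| <= `|M| + `|K| + 1.
  rewrite leNgt; apply: contra px => xM; rewrite HM//.
  by have := ler_norm M; have := normr_ge0 K; lra.
rewrite mulr1; have KK : K < `|K| + 1 by have := ler_norm K; lra.
have : `|phi x| <= `|K| + 1.
  by apply: (HK _ KK); exists x => //; exact: subset_closure.
by have := normr_ge0 M; lra.
Qed.

Lemma test_function_box (a b : 'rV[R]_N) m :
  test_function (fun x => \prod_i bump (a ord0 i) (b ord0 i) m (x ord0 i)).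
Proof.
split.
  move=> k; apply: (@Cn_prod k (fun i => bump (a ord0 i) (b ord0 i) m)) => i.
  exact: smooth_bump.
apply/compact_closure_supportP; exists (`|a| + `|b|) => x Mx.
have [i Hi] : exists i, ~~ (a ord0 i < x ord0 i < b ord0 i).
  apply/not_existsP => H; move: Mx; apply/negP; rewrite -leNgt.
  apply/rV_norm_leP; first by rewrite addr_ge0.
  move=> i; have /negP := H i; rewrite negbK => /andP[ax xb].
  have := rV_coord_norm a i; have := rV_coord_norm b i.
  rewrite !ler_norml; have := normr_ge0 a; have := normr_ge0 b; lra.
by rewrite (bigD1 i)//= bump_out// mul0r.
Qed.

End test_functions.

(** * Integrals of p-th powers *)

Lemma cvg_powR_norm0 (R : realType) (p : R) (u : nat -> R) : 0 < p ->
  u n @[n --> \oo] --> 0 -> `|u n| `^ p @[n --> \oo] --> 0.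
Proof.
move=> p0 u0; apply/cvgr0Pnorm_le => e e0; near=> n.
have un : `|u n| <= e `^ p^-1.
  by near: n; apply: cvgr0_norm_le => //; exact: powR_gt0.
rewrite ger0_norm ?powR_ge0//.
apply: le_trans (ge0_ler_powR (ltW p0) _ _ un) _; rewrite ?nnegrE ?powR_ge0//.
by rewrite -powRrM mulVf ?gt_eqF// powRr1// ltW.
Unshelve. all: by end_near. Qed.

Section power_integral.
Context d (T : measurableType d) (R : realType) (mu : {measure set T -> \bar R}).
Variable p : R.
Hypothesis p0 : 0 < p.
Implicit Types (f g w : T -> R).
Local Open Scope ereal_scope.

(** The p-th power of the L^p norm. Without the root it is itself an integral of a nonnegative
    function, to which monotonicity, additivity and Tonelli apply directly. *)
Definition pint g := \int[mu]_x (`|g x| `^ p)%:E.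

Lemma measurable_powR_norm g : measurable_fun setT g ->
  measurable_fun setT (fun x => (`|g x| `^ p)%R).
Proof.
move=> mg; apply: (measurableT_comp (measurable_powR p)).
exact: measurableT_comp.
Qed.

Lemma measurable_pint g : measurable_fun setT g ->
  measurable_fun setT (fun x => (`|g x| `^ p)%:E).
Proof. by move=> mg; apply/measurable_EFinP; exact: measurable_powR_norm. Qed.

Lemma pint_ge0 g : 0 <= pint g.
Proof. by apply: integral_ge0 => x _; rewrite lee_fin powR_ge0. Qed.

Lemma le_pint f g : measurable_fun setT f -> measurable_fun setT g ->
  (forall x, `|f x| <= `|g x|)%R -> pint f <= pint g.
Proof.
move=> mf mg fg; apply: ge0_le_integral => //.
- exact: measurable_pint.
- exact: measurable_pint.
- move=> x _; rewrite lee_fin ge0_ler_powR ?nnegrE//; exact: ltW.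
Qed.

Lemma pintD_le f g : measurable_fun setT f -> measurable_fun setT g ->
  pint (fun x => f x + g x)%R <= (2 `^ p)%:E * (pint f + pint g).
Proof.
move=> mf mg; have mpf := measurable_pint mf; have mpg := measurable_pint mg.
have pf0 x : setT x -> 0 <= (`|f x| `^ p)%:E by rewrite lee_fin powR_ge0.
have pg0 x : setT x -> 0 <= (`|g x| `^ p)%:E by rewrite lee_fin powR_ge0.
rewrite /pint -ge0_integralD// -ge0_integralZl//.
- apply: ge0_le_integral => //.
  + by apply: measurable_pint; exact: measurable_funD.
  + by apply: emeasurable_funM => //; exact: emeasurable_funD.
  + by move=> x _; rewrite -EFinD -EFinM lee_fin powR_normD_le.
- exact: emeasurable_funD.
- by move=> x _; rewrite adde_ge0// ?pf0// pg0.
Qed.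

Lemma pintZ c g : measurable_fun setT g ->
  pint (fun x => c * g x)%R = (`|c| `^ p)%:E * pint g.
Proof.
move=> mg; rewrite /pint -ge0_integralZl//.
- by apply: eq_integral => x _; rewrite normrM powRM// EFinM.
- exact: measurable_pint.
Qed.

(** The limit inherits the bound by g, so |2g|^p dominates |w - w_n|^p. *)
Lemma pint_dominated_cvg (w_ : nat -> T -> R) w g :
  (forall n, measurable_fun setT (w_ n)) -> measurable_fun setT w ->
  measurable_fun setT g ->
  (forall n x, `|w_ n x| <= g x)%R -> pint g < +oo ->
  (forall x, w_ n x @[n --> \oo] --> w x) ->
  pint (fun x => w x - w_ n x)%R @[n --> \oo] --> 0.
Proof.
move=> mw_ mw mg w_g gy w_w.
have wg x : (`|w x| <= g x)%R.
  have H : (fun n => `|w_ n x|)%R @ \oo --> `|w x|%R by apply: cvg_norm.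
  by rewrite -(cvg_lim _ H)//; apply: limr_le; [apply/cvg_ex; exists `|w x|%R|exact: nearW].
have mgg : measurable_fun setT (fun x => 2 * g x)%R by exact: measurable_funM.
have g0 x : (0 <= g x)%R by rewrite (le_trans _ (wg x)).
have -> : 0 = \int[mu]_x (cst 0 x) by rewrite integral0.
apply: (@dominated_cvg _ _ _ _ _ _ _ _ (fun x => (`|2 * g x| `^ p)%:E)) => //.
- by move=> n; apply: measurable_pint; exact: measurable_funB.
- move=> x _.
  have H : (w x - w_ n x)%R @[n --> \oo] --> (w x - w x)%R.
    by apply: cvgB; [exact: cvg_cst|exact: w_w].
  by rewrite subrr in H; apply: cvg_EFin; [exact: nearW|exact: cvg_powR_norm0].
- apply/integrableP; split; first exact: measurable_pint.
  under eq_integral => x _ do rewrite gee0_abs ?lee_fin ?powR_ge0//.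
  by rewrite -/(pint _) pintZ// lte_mul_pinfty// lee_fin powR_ge0.
- move=> n x _; rewrite gee0_abs ?lee_fin ?powR_ge0// ge0_ler_powR ?nnegrE ?(ltW p0)//.
  rewrite [leRHS]ger0_norm ?mulr_ge0//.
  by have := ler_normB (w x) (w_ n x); have := wg x; have := w_g n x; lra.
Qed.

End power_integral.

Lemma Lfun_pint d (T : measurableType d) (R : realType)
    (mu : {measure set T -> \bar R}) p (g : T -> R) : 1 <= p ->
  g \in Lfun mu p%:E -> measurable_fun setT g /\ (pint mu p g < +oo)%E.
Proof.
move=> p1 gp; split; first by move: gp => /andP[/[!inE]].
have /integrableP[_] := Lfun_integrable p1 gp.
by under eq_integral => x _ do rewrite gee0_abs ?lee_fin ?powR_ge0//.
Qed.

(** * Density of test functions in L^q *)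

Section boxes.
Context {R : realType} {N : nat}.
Implicit Types (a b x : 'rV[R]_N) (A : set 'rV[R]_N).

Definition rV_boxes : set (set 'rV[R]_N) :=
  [set A | exists a b, A = rV_box a b].

Definition rV_cube (m : R) : set 'rV[R]_N := rV_box (const_mx (- m)) (const_mx m).

Lemma rV_cubeP m x : 0 < m -> rV_cube m x <-> `|x| < m.
Proof.
move=> m0; split.
  by move=> H; apply/rV_norm_ltP => // i; have := H i; rewrite !mxE ltr_norml.
by move/(rV_norm_ltP _ m0) => H i; have := H i; rewrite !mxE ltr_norml.
Qed.

Lemma rV_box_setI a b a' b' : rV_box a b `&` rV_box a' b' =
  rV_box (\row_i Num.max (a ord0 i) (a' ord0 i)) (\row_i Num.min (b ord0 i) (b' ord0 i)).
Proof.
apply/seteqP; split => x /=.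
  move=> [H1 H2] i; rewrite !mxE gt_max lt_min.
  by have /andP[-> ->] := H1 i; have /andP[-> ->] := H2 i.
move=> H; split => i; have := H i; rewrite !mxE gt_max lt_min;
  by move=> /andP[/andP[H1 H2] /andP[H3 H4]]; apply/andP.
Qed.

(** The preimage of an open interval under one coordinate is the union of the boxes whose other
    sides are ]-k, k[. *)
Lemma measurable_rV_boxes : @measurable _ 'rV[R]_N `<=` <<s rV_boxes>>.
Proof.
apply: smallest_sub; first exact: smallest_sigma_algebra.
rewrite -bigcup_seq => B [i _ [Y mY <-]]; rewrite setTI.
have {mY} : (@RGenOpens.G R).-sigma.-measurable Y by rewrite -RGenOpens.measurableE.
move: Y; apply: smallest_sub.
  have := sigma_algebra_image (fun x : 'rV[R]_N => x ord0 i)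
    (smallest_sigma_algebra setT rV_boxes).
  rewrite /image_set_system.
  by under [X in sigma_algebra _ X]eq_set do rewrite setTI.
move=> _ [a [b ->]] /=.
pose F k := rV_box (\row_j if j == i then a else - k%:R) (\row_j if j == i then b else k%:R).
rewrite (_ : _ @^-1` _ = \bigcup_k F k).
  have [_ _ sU] := smallest_sigma_algebra setT rV_boxes.
  apply: sU => k; apply: sub_sigma_algebra.
  by exists (\row_j if j == i then a else - k%:R), (\row_j if j == i then b else k%:R).
apply/seteqP; split => x /=; last first.
  by move=> [k _ H]; have := H i; rewrite !mxE eqxx in_itv.
rewrite in_itv /= => xab.
have [k Hk] : exists k : nat, `|x| < k%:R.
  exists (Num.truncn `|x|).+1; exact: truncnS_gt.
exists k => // j; rewrite !mxE; case: eqP => [->//|_].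
by rewrite -ltr_norml (le_lt_trans (rV_coord_norm _ _)).
Qed.

Lemma lebesgue_rV_box a b : (lebesgue_rV N (rV_box a b) < +oo)%E.
Proof.
elim: N a b => [|n IH] a b.
  rewrite /= diracE; by case: (_ \in _); rewrite ?ltry.
rewrite (_ : lebesgue_rV n.+1 _ = (lebesgue_measure \x lebesgue_rV n)%E
  (@rV_cons R n @^-1` rV_box a b))//.
rewrite (_ : _ @^-1` _ = `]a ord0 (lshift n (ord0 : 'I_1)), b ord0 (lshift n (ord0 : 'I_1))[%classic
   `*` rV_box (rV_uncons a).2 (rV_uncons b).2).
  rewrite product_measure1E//; last exact: measurable_rV_box.
  apply: lte_mul_pinfty; [exact: measure_ge0| |exact: IH].
  by rewrite [X in X \is a fin_num]lebesgue_measure_itv/=; case: ifP => _.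
apply/seteqP; split => -[t z] /=.
  move=> H; split.
    by have := H (lshift n (ord0 : 'I_1) : 'I_(1 + n)); rewrite rV_consE0 in_itv.
  by move=> i; have := H (rshift 1 i); rewrite rV_consES !mxE.
move=> [Ht Hz] i; case: (@split_ordP 1 n i) => j ->.
  by rewrite (ord1 j) rV_consE0; rewrite in_itv in Ht.
by rewrite rV_consES; have := Hz j; rewrite !mxE.
Qed.

End boxes.

Lemma cvge0_le_exists (R : realType) (u : nat -> \bar R) (e : R) : 0 < e ->
  u n @[n --> \oo] --> 0%E -> exists n, (u n <= e%:E)%E.
Proof.
move=> e0 /fine_cvgP[fu /cvgr0_norm_le/(_ _ e0) ue].
have [n [fn un]] := filter_ex (filterI fu ue).
by exists n; rewrite -(fineK fn) lee_fin (le_trans (ler_norm _)).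
Qed.

Import HBNNSimple.

Section density.
Context {R : realType} {N : nat} (q : R).
Hypothesis q0 : 0 < q.
Implicit Types (w g : 'rV[R]_N -> R) (A : set 'rV[R]_N).
Notation mu := (lebesgue_rV N).

Definition test_approximable w : Prop := forall e : R, 0 < e ->
  exists2 phi, test_function phi & (pint mu q (fun x => w x - phi x)%R <= e%:E)%E.

Lemma test_approximable_lim w : measurable_fun setT w ->
  (forall e : R, 0 < e -> exists v, [/\ measurable_fun setT v,
     test_approximable v & (pint mu q (fun x => w x - v x)%R <= e%:E)%E]) ->
  test_approximable w.
Proof.
move=> mw H e e0.
(* Two errors e / c, multiplied by the factor 2^q of [pintD_le], add up to e. *)
pose c := 2 `^ q * 2; have c0 : 0 < c by rewrite mulr_gt0// powR_gt0.
have ec : 0 < e / c by rewrite divr_gt0.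
have [v [mv /(_ _ ec)[phi tphi Hphi] Hv]] := H _ ec.
exists phi => //; have mphi := test_function_measurable tphi.
have -> : (fun x => w x - phi x) = (fun x => (w x - v x) + (v x - phi x)).
  by apply/funext => x; rewrite addrA subrK.
apply: le_trans (pintD_le _ _ _ _) _ => //; try exact: measurable_funB.
apply: (@le_trans _ _ ((2 `^ q)%:E * ((e / c)%:E + (e / c)%:E))%E).
  apply: lee_wpmul2l; [by rewrite lee_fin powR_ge0|exact: leeD].
rewrite -EFinD -EFinM lee_fin /c le_eqVlt; apply/orP; left; apply/eqP.
by field; rewrite gt_eqF ?powR_gt0.
Qed.

Lemma test_approximable_cvg (w_ : nat -> 'rV[R]_N -> R) w g :
  (forall n, measurable_fun setT (w_ n)) -> measurable_fun setT w ->
  measurable_fun setT g ->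
  (forall n x, `|w_ n x| <= g x) -> (pint mu q g < +oo)%E ->
  (forall x, w_ n x @[n --> \oo] --> w x) ->
  (forall n, test_approximable (w_ n)) -> test_approximable w.
Proof.
move=> mw_ mw mg w_g gy w_w aw; apply: test_approximable_lim => // e e0.
have [n Hn] := cvge0_le_exists e0 (pint_dominated_cvg q0 mw_ mw mg w_g gy w_w).
by exists (w_ n).
Qed.

Lemma test_approximableD w v : measurable_fun setT w -> measurable_fun setT v ->
  test_approximable w -> test_approximable v ->
  test_approximable (fun x => w x + v x).
Proof.
move=> mw mv aw av e e0.
pose c := 2 `^ q * 2; have c0 : 0 < c by rewrite mulr_gt0// powR_gt0.
have ec : 0 < e / c by rewrite divr_gt0.
have [phi tphi Hphi] := aw _ ec; have [psi tpsi Hpsi] := av _ ec.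
have mphi := test_function_measurable tphi; have mpsi := test_function_measurable tpsi.
exists (fun x => 1 * phi x + psi x); first exact: test_function_lin.
have -> : (fun x => w x + v x - (1 * phi x + psi x)) =
    (fun x => (w x - phi x) + (v x - psi x)).
  by apply/funext => x; ring.
apply: le_trans (pintD_le _ _ _ _) _ => //; try exact: measurable_funB.
apply: (@le_trans _ _ ((2 `^ q)%:E * ((e / c)%:E + (e / c)%:E))%E).
  apply: lee_wpmul2l; [by rewrite lee_fin powR_ge0|exact: leeD].
rewrite -EFinD -EFinM lee_fin /c le_eqVlt; apply/orP; left; apply/eqP.
by field; rewrite gt_eqF ?powR_gt0.
Qed.

Lemma test_approximableZ c w : measurable_fun setT w ->
  test_approximable w -> test_approximable (fun x => c * w x).
Proof.
move=> mw aw e e0.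
have k0 : 0 < `|c| `^ q + 1 by rewrite ltr_wpDl// powR_ge0.
have [phi tphi Hphi] := aw (e / (`|c| `^ q + 1)) ltac:(by rewrite divr_gt0).
have mphi := test_function_measurable tphi.
exists (fun x => c * phi x + 0); first exact: test_function_lin tphi test_function0.
have -> : (fun x => c * w x - (c * phi x + 0)) = (fun x => c * (w x - phi x)).
  by apply/funext => x; ring.
rewrite pintZ//; last exact: measurable_funB.
apply: (@le_trans _ _ ((`|c| `^ q)%:E * (e / (`|c| `^ q + 1))%:E)%E).
  by apply: lee_wpmul2l; rewrite ?lee_fin ?powR_ge0.
rewrite -EFinM lee_fin mulrCA ler_piMr ?(ltW e0)// ler_pdivrMr// mul1r; lra.
Qed.

Lemma test_approximable0 : test_approximable (fun=> 0).
Proof.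
move=> e e0; exists (fun=> 0); first exact: test_function0.
rewrite /pint; under eq_integral => x _ do rewrite subrr normr0 powR0 ?gt_eqF//.
by rewrite integral0 lee_fin ltW.
Qed.

Lemma pint_indic A : measurable A -> pint mu q \1_A = mu A.
Proof.
move=> mA; rewrite -[in RHS](setIT A) -integral_indic// /pint; apply: eq_integral => x _.
rewrite indicE; case: (x \in A); rewrite ?normr1 ?powR1// normr0 powR0// gt_eqF//.
Qed.


(** The products of bumps are test functions; they tend pointwise to the indicator of the box and
    are dominated by it. *)
Lemma test_approximable_box a b : test_approximable \1_(rV_box a b).
Proof.
pose w_ m := fun x : 'rV[R]_N => \prod_i bump (a ord0 i) (b ord0 i) m (x ord0 i).
have tw m : test_function (w_ m) by exact: test_function_box.
have mB := measurable_rV_box a b.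
apply: (@test_approximable_cvg w_ _ \1_(rV_box a b)).
- by move=> m; exact: test_function_measurable.
- exact: measurable_indic.
- exact: measurable_indic.
- move=> m x; rewrite indicE; case: (boolP (x \in rV_box a b)) => xB.
    rewrite ger0_norm; last first.
      by apply: prodr_ge0 => i _; case/andP: (bump_itv (a ord0 i) (b ord0 i) m (x ord0 i)).
    by apply: prodr_ile1 => i _; exact: bump_itv.
  have [i Hi] : exists i, ~~ (a ord0 i < x ord0 i < b ord0 i).
    apply/not_existsP => H; move: xB; rewrite notin_setE; apply => i.
    by apply/negPn/negP; exact: H.
  by rewrite /w_ (bigD1 i)//= bump_out// mul0r normr0.
- by rewrite pint_indic//; exact: lebesgue_rV_box.
- move=> x.
  rewrite (_ : \1_(rV_box a b) x = \prod_i (a ord0 i < x ord0 i < b ord0 i)%R%:R).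
    apply: cvg_big => [z|i _]; last exact: bump_cvg.
    by apply: cvgM; [exact: cvg_fst|exact: cvg_snd].
  rewrite indicE; case: (boolP (x \in rV_box a b)) => xB.
    rewrite big1// => i _; rewrite inE in xB.
    by have := xB i => ->.
  have [i Hi] : exists i, ~~ (a ord0 i < x ord0 i < b ord0 i).
    apply/not_existsP => H; move: xB; rewrite notin_setE; apply => i.
    by apply/negPn/negP; exact: H.
  by rewrite (bigD1 i)//= (negbTE Hi) mul0r.
- move=> m e e0; exists (w_ m) => //; rewrite /pint.
  under eq_integral => x _ do rewrite subrr normr0 powR0 ?gt_eqF//.
  by rewrite integral0 lee_fin ltW.
Qed.

(** Dynkin's argument inside a cube: boxes are stable under intersection, and the sets with
    approximable indicator are stable under proper differences and increasing unions. The cube has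
    finite measure, so its indicator is the dominating function for the unions. *)
Lemma test_approximable_indic (k : R) A : measurable A ->
  test_approximable \1_(A `&` rV_cube k).
Proof.
move=> mA; pose W := @rV_cube R N k.
have mW : measurable W by exact: measurable_rV_box.
have Wy : (mu W < +oo)%E by exact: lebesgue_rV_box.
pose H : set (set 'rV[R]_N) :=
  [set B | [/\ measurable B, B `<=` W & test_approximable \1_B]].
(* The traces of boxes on the cube are again boxes, and the sigma-algebra that they generate on the
   cube is the trace of the whole one. *)
pose G := preimage_set_system W id (@rV_boxes R N).
have GE B : G B -> rV_boxes B.
  by move=> [_ [a [b ->]] <-]; rewrite preimage_id rV_box_setI; eexists; eexists.
have sub : <<s W, G >> `<=` H.
  apply: lambda_system_subset.
  - move=> _ _ [B1 HB1 <-] [B2 HB2 <-]; exists (B1 `&` B2).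
      case: HB1 HB2 => [a [b ->]] [a' [b' ->]].
      by rewrite rV_box_setI; eexists; eexists.
    by rewrite !preimage_id setIACA setIid.
  - split.
    + by move=> B [].
    + by split => //; exact: test_approximable_box.
    + move=> B C CB [mB BW aB] [mC CW aC]; split; first exact: measurableD.
        by move=> x [/BW].
      rewrite (_ : \1_(B `\` C) = fun x => \1_B x + (-1) * \1_C x).
        have mI1 : measurable_fun setT (\1_B : 'rV[R]_N -> R) by exact: measurable_indic.
        have mI2 : measurable_fun setT (\1_C : 'rV[R]_N -> R) by exact: measurable_indic.
        apply: (test_approximableD mI1 _ aB).
          exact: (measurable_funM (measurable_cst _) mI2).
        exact: (test_approximableZ (-1) mI2 aC).
      apply/funext => x; rewrite !indicE in_setD.
      case: (boolP (x \in C)) => xC; rewrite ?andbF ?andbT ?mulr0 ?addr0//.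
      by rewrite (mem_set (CB _ (set_mem xC))) mulr1 addrC addNr.
    + move=> F ndF HF; have mF i : measurable (F i) by case: (HF i).
      have mU : measurable (\bigcup_i F i) by exact: bigcupT_measurable.
      split => //; first by move=> x [i _ Fx]; case: (HF i) => _ + _; exact.
      apply: (@test_approximable_cvg (fun i => \1_(F i)) _ \1_W).
      * by move=> i; exact: measurable_indic.
      * exact: measurable_indic.
      * exact: measurable_indic.
      * move=> i x; rewrite !indicE ger0_norm// ler_nat.
        case: (boolP (x \in F i)) => // /set_mem Fx.
        by rewrite mem_set//; case: (HF i) => _ + _; exact.
      * by rewrite pint_indic.
      * move=> x; case: (boolP (x \in \bigcup_i F i)) => xF.
          have [j _ Fj] := set_mem xF.
          apply: cvg_near_cst; exists j => // i /= ji.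
          rewrite !indicE xF mem_set//.
          by move/subsetPset : (ndF _ _ ji); exact.
        rewrite [X in _ --> X](_ : _ = 0); last by rewrite indicE (negbTE xF).
        apply: cvg_near_cst; apply: nearW => i; rewrite indicE memNset//.
        by move=> Fx; move/negP: xF; apply; apply/mem_set; exists i.
      * by move=> i; case: (HF i).
  - move=> B GB; have [a [b E]] := GE _ GB; split.
    + by rewrite E; exact: measurable_rV_box.
    + by case: GB => C _ <- x [].
    + by rewrite E; exact: test_approximable_box.
  - by move=> X; rewrite /G g_sigma_preimageE => -[C _ <-] x [].
have : <<s W, G>> (A `&` W).
  rewrite /G g_sigma_preimageE; exists A; first exact: measurable_rV_boxes.
  by rewrite preimage_id setIC.
by move/sub => [].
Qed.

Lemma test_approximable_sum n (F : 'I_n -> 'rV[R]_N -> R) :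
  (forall i, measurable_fun setT (F i)) -> (forall i, test_approximable (F i)) ->
  test_approximable (fun x => \sum_i F i x).
Proof.
elim: n F => [|n IH] F mF aF.
  under eq_fun do rewrite big_ord0; exact: test_approximable0.
under eq_fun do rewrite big_ord_recl.
apply: (test_approximableD (mF ord0) _ (aF ord0)); last exact: IH.
exact: measurable_sum.
Qed.

(** Split into positive and negative parts, each the pointwise limit of simple functions that it
    dominates. *)
Lemma test_approximable_Lp w : measurable_fun setT w -> (pint mu q w < +oo)%E ->
  test_approximable w.
Proof.
move=> mw wy.
suff H (v : 'rV[R]_N -> R) : measurable_fun setT v -> (forall x, 0 <= v x) ->
    (pint mu q v < +oo)%E -> test_approximable v.
  pose v1 x := Num.max (w x) 0; pose v2 x := Num.max (- w x) 0.
  have mv1 : measurable_fun setT v1 by exact: measurable_maxr.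
  have mv2 : measurable_fun setT v2 by apply: measurable_maxr => //; exact: measurable_funN.
  have -> : w = fun x => v1 x + (-1) * v2 x.
    by apply/funext => x; rewrite /v1 /v2; have [] := leP (w x) 0;
      have [] := leP (- w x) 0; lra.
  have av1 : test_approximable v1.
    apply: (H _ mv1) => [x|]; first by rewrite le_max lexx orbT.
    apply: le_lt_trans wy; apply: le_pint => // x.
    by rewrite /v1; case: (leP (w x) 0) => _; rewrite ?normr0 ?normr_ge0 ?lexx.
  have av2 : test_approximable v2.
    apply: (H _ mv2) => [x|]; first by rewrite le_max lexx orbT.
    apply: le_lt_trans wy; apply: le_pint => // x.
    by rewrite /v2; case: (leP (- w x) 0) => _; rewrite ?normr0 ?normrN ?normr_ge0 ?lexx.
  apply: (test_approximableD mv1 _ av1 (test_approximableZ (-1) mv2 av2)).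
  exact: (measurable_funM (measurable_cst _) mv2).
move=> mv v0 vy.
have mvE : measurable_fun setT (EFin \o v) by exact/measurable_EFinP.
have vE0 x : setT x -> (0 <= (EFin \o v) x)%E by rewrite lee_fin.
pose s := nnsfun_approx measurableT mvE.
(* Cutting the k-th simple function off outside the cube of radius k leaves a finite combination of
   indicators of bounded sets; a given point is eventually inside the cube. *)
pose w_ k := fun x => s k x * \1_(rV_cube k%:R) x.
have ms k : measurable_fun setT (s k) by exact: measurable_funP.
have mc k : measurable (@rV_cube R N k) by exact: measurable_rV_box.
have mw_ k : measurable_fun setT (w_ k).
  by apply: measurable_funM => //; exact: measurable_indic.
have sv x : s k x @[k --> \oo] --> v x.
  have := @cvg_nnsfun_approx _ _ _ _ measurableT _ mvE vE0 x I.
  by move/fine_cvg.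
have s_le k x : s k x <= v x.
  have := @le_approx _ _ _ setT (EFin \o v) k x vE0 I.
  by rewrite -(nnsfun_approxE measurableT mvE) lee_fin.
have s_ge0 k x : 0 <= s k x by [].
apply: (@test_approximable_cvg w_ _ v) => //.
- move=> k x; rewrite /w_ indicE; case: (_ \in _).
    by rewrite mulr1 ger0_norm.
  by rewrite mulr0 normr0.
- move=> x; apply: cvg_trans (sv x); apply: near_eq_cvg.
  exists (Num.truncn `|x|).+1 => // k /= xk; rewrite /w_ indicE mem_set ?mulr1//.
  have xk' : `|x| < k%:R by rewrite (lt_le_trans (truncnS_gt _))// ler_nat.
  by apply/rV_cubeP => //; rewrite (le_lt_trans _ xk').
- move=> k; pose t := finmap.enum_fset (fset_set (s k @` setT)).
  rewrite (_ : w_ k = fun x => \sum_(i < size t)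
      t`_i *
      \1_(s k @^-1` [set t`_i] `&` rV_cube k%:R) x).
    have mA i : measurable (s k @^-1` [set t`_i]).
      by rewrite -[X in measurable X]setTI; exact: ms.
    apply: test_approximable_sum => i.
      apply: measurable_funM => //; apply: measurable_indic; exact: measurableI.
    apply: test_approximableZ; last exact: test_approximable_indic.
    by apply: measurable_indic; exact: measurableI.
  apply/funext => x; rewrite /w_ [in LHS](fimfunEord (s k)) mulr_suml.
  by apply: eq_bigr => i _; rewrite indicI -mulrA.
Qed.

End density.

(** * Duality and translations in L^p *)

Section conjugate_exponents.
Context d (T : measurableType d) (R : realType) (mu : {measure set T -> \bar R}).
Implicit Types (p q : R) (f g w : T -> R).

Lemma integrable_pint p g : 0 < p -> measurable_fun setT g ->
  (pint mu p g < +oo)%E -> mu.-integrable setT (fun x => (`|g x| `^ p)%:E).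
Proof.
move=> p0 mg gy; apply/integrableP; split; first exact: measurable_pint.
by under eq_integral => x _ do rewrite gee0_abs ?lee_fin ?powR_ge0//.
Qed.

Lemma integralZ_pint p (c : R) g : 0 < p -> 0 <= c -> measurable_fun setT g ->
  (\int[mu]_x (c%:E * (`|g x| `^ p)%:E) = c%:E * pint mu p g)%E.
Proof.
move=> p0 c0 mg; rewrite ge0_integralZl//; exact: measurable_pint.
Qed.

Lemma pint_fin_num p g : (pint mu p g < +oo)%E -> pint mu p g \is a fin_num.
Proof. by rewrite ge0_fin_numE// pint_ge0. Qed.

Variables p q : R.
Hypotheses (p0 : 0 < p) (q0 : 0 < q) (pq : p^-1 + q^-1 = 1).

(** Young's inequality suffices where only integrability, not Hoelder's bound, is wanted. *)
Lemma integrable_mul_pint f g : measurable_fun setT f -> measurable_fun setT g ->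
  (pint mu p f < +oo)%E -> (pint mu q g < +oo)%E ->
  mu.-integrable setT (fun x => (f x * g x)%:E).
Proof.
move=> mf mg fy gy; have [C C0 HC] := powR_young p0 q0 pq (@ltr01 R).
have If := integrable_pint p0 mf fy; have Ig := integrable_pint q0 mg gy.
apply: (le_integrable measurableT _ _ (integrableD measurableT If
  (integrableZl measurableT C Ig))).
  by apply/measurable_EFinP; exact: measurable_funM.
move=> x _ /=; rewrite lee_fin (le_trans (HC _ _))// mul1r.
exact: ler_norm.
Qed.

(* L^p-L^q duality with M/p + |phi|_q^q/q in place of M^(1/p) |phi|_q, so that
   only integrals of powers occur; the extremal test is g |g|^(p-2). *)
Lemma pint_le_young g (M : R) (P : (T -> R) -> Prop) :
  measurable_fun setT g -> (pint mu p g < +oo)%E ->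
  (forall w (e : R), measurable_fun setT w -> (pint mu q w < +oo)%E -> 0 < e ->
     exists2 phi, P phi & (pint mu q (fun x => (w x - phi x)%R) <= e%:E)%E) ->
  (forall phi, P phi -> measurable_fun setT phi /\ ((pint mu q phi < +oo)%E ->
    (\int[mu]_x (g x * phi x)%:E <= (M / p)%:E + (q^-1)%:E * pint mu q phi)%E)) ->
  (pint mu p g <= M%:E)%E.
Proof.
move=> mg gy dense HP.
(* Equality case of duality: g w = |g|^p and |w|^q = |g|^p. The exponent is written so that
   [mulr_powRB1] can absorb one factor |g| at a time. *)
pose w x := g x * `|g x| `^ (p - 1 - 1).
have mw : measurable_fun setT w.
  by apply: measurable_funM => //; exact: measurable_powR_norm.
have p1 : 0 < p - 1 by rewrite subr_gt0 -invf_lt1// -pq ltrDl invr_gt0.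
have pq' : (p - 1) * q = p.
  have : (p^-1 + q^-1) * (p * q) = p * q by rewrite pq mul1r.
  have -> : (p^-1 + q^-1) * (p * q) = q + p by field; rewrite !gt_eqF.
  by move=> H; rewrite mulrBl mul1r -H; ring.
have wq x : `|w x| `^ q = `|g x| `^ p.
  rewrite /w normrM [X in _ * X]ger0_norm ?powR_ge0// mulr_powRB1//.
  by rewrite -powRrM pq'.
have gw x : g x * w x = `|g x| `^ p.
  have -> : g x * w x = `|g x| * (`|g x| * `|g x| `^ (p - 1 - 1)).
    by rewrite /w !mulrA -normrM ger0_norm// -expr2 sqr_ge0.
  by rewrite !mulr_powRB1.
have Ig := integrable_pint p0 mg gy.
have [G GE] : exists G, pint mu p g = G%:E.
  by exists (fine (pint mu p g)); rewrite fineK// pint_fin_num.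
have G0 : 0 <= G by rewrite -lee_fin -GE pint_ge0.
have wG : pint mu q w = G%:E.
  by rewrite -GE; apply: eq_integral => x _; rewrite wq.
clear gy.
(* Since G - G/q = G/p, the goal becomes G <= M/p + G/q up to an arbitrary e. For phi = w this would
   be the hypothesis itself; w is only approximated by such phi. *)
rewrite GE lee_fin -(ler_pM2r (_ : 0 < p^-1)) ?invr_gt0//.
apply/ler_addgt0Pr => e e0.
(* Combining [S2] and [S3] below, eps G occurs with total coefficient 1 + 1/q = k; [eps] makes this
   share at most e/2. *)
pose k := q^-1 + 1; have k0 : 0 < k by rewrite addr_gt0// invr_gt0.
pose eps := e / (2 * k * (G + 1)).
have eps0 : 0 < eps by rewrite divr_gt0// !mulr_gt0// ltr_wpDl.
have [C C0 HC] := powR_young p0 q0 pq eps0.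
have [C' C'0 HC'] := powR_normD_sub q0 eps0.
(* Likewise the approximation error [eta] occurs with coefficient C + C'/q, which D bounds; the
   added 1 keeps D positive. *)
pose D := C' * q^-1 + C + 1.
have D0 : 0 < D by rewrite ltr_wpDl// addr_ge0// mulr_ge0// invr_ge0 ltW.
pose eta := e / (2 * D); have eta0 : 0 < eta by rewrite divr_gt0// mulr_gt0.
have [phi Pphi Hphi] := dense w eta mw ltac:(by rewrite wG ltry) eta0.
have [mphi _] := HP _ Pphi.
have mwp : measurable_fun setT (fun x => w x - phi x) by exact: measurable_funB.
have wpy : (pint mu q (fun x => (w x - phi x)%R) < +oo)%E.
  by rewrite (le_lt_trans Hphi)// ltry.
have Iwp := integrable_pint q0 mwp wpy.
have S1 : (pint mu q phi <= ((1 + eps) * G + C' * eta)%:E)%E.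
  apply: (@le_trans _ _ (\int[mu]_x ((1 + eps)%:E * (`|g x| `^ p)%:E +
      C'%:E * (`|w x - phi x| `^ q)%:E))%E).
    apply: ge0_le_integral => //.
    - exact: measurable_pint.
    - by apply: emeasurable_funD; apply: emeasurable_funM => //; exact: measurable_pint.
    - move=> x _; rewrite -!EFinM -EFinD lee_fin.
      have := HC' (w x) (phi x - w x).
      rewrite (_ : w x + (phi x - w x) = phi x); last by ring.
      rewrite wq [`|phi x - w x|]distrC ler_norml; lra.
  rewrite ge0_integralD//; last 4 first.
  - by move=> x _; rewrite mule_ge0 ?lee_fin ?powR_ge0// addr_ge0// ltW.
  - by apply: emeasurable_funM => //; exact: measurable_pint.
  - by move=> x _; rewrite mule_ge0 ?lee_fin ?powR_ge0.
  - by apply: emeasurable_funM => //; exact: measurable_pint.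
  rewrite !integralZ_pint// ?addr_ge0 ?(ltW eps0)//.
  rewrite GE -EFinM EFinD leeD2l// EFinM.
  by apply: lee_wpmul2l; rewrite ?lee_fin.
have phiy : (pint mu q phi < +oo)%E by rewrite (le_lt_trans S1)// ltry.
have Igp := integrable_mul_pint mg mphi ltac:(by rewrite GE ltry) phiy.
have [I IE] : exists I, (\int[mu]_x (g x * phi x)%:E)%E = I%:E.
  exists (fine (\int[mu]_x (g x * phi x)%:E)%E); rewrite fineK//.
  exact: integrable_fin_num.
(* Write g w = g phi + g (w - phi) and apply Young with weight eps to the last product. *)
have S2 : G <= I + (eps * G + C * eta).
  rewrite -lee_fin -GE.
  pose h x := (g x * phi x)%:E%E.
  apply: (@le_trans _ _ (\int[mu]_x ((g x * phi x)%:E + (eps%:E * (`|g x| `^ p)%:E +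
      C%:E * (`|w x - phi x| `^ q)%:E)))%E).
    apply: le_integral => //.
      apply: integrableD => //; apply: integrableD => //; exact: integrableZl.
    move=> x _; rewrite -!EFinM -!EFinD lee_fin -gw.
    have := HC (g x) (w x - phi x); have := ler_norm (g x * (w x - phi x)).
    rewrite -(gw x); lra.
  rewrite integralD//; last by apply: integrableD => //; exact: integrableZl.
  rewrite integralD//; [|exact: integrableZl|exact: integrableZl].
  rewrite !integralZl// IE -!/(pint _ _ _) GE !EFinD !EFinM leeD2l// leeD2l//.
  by apply: lee_wpmul2l; rewrite ?lee_fin.
have S3 : I <= M / p + q^-1 * ((1 + eps) * G + C' * eta).
  rewrite -lee_fin -IE (le_trans ((HP _ Pphi).2 phiy))// EFinD leeD2l// EFinM.
  apply: lee_wpmul2l; [by rewrite lee_fin invr_ge0 ltW|exact: S1].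
have e1 : eps * G * k <= e / 2.
  rewrite /eps.
  have -> : e / (2 * k * (G + 1)) * G * k = e / 2 * (G / (G + 1)).
    field; rewrite !gt_eqF//; lra.
  by rewrite ler_piMr ?divr_ge0 ?(ltW e0)// ler_pdivrMr ?mul1r; lra.
have e2 : eta * D = e / 2 by rewrite /eta; field; rewrite gt_eqF.
have e3 : eta * (C' * q^-1 + C) <= e / 2 by rewrite -e2 ler_wpM2l ?(ltW eta0)// lerDl.
have -> : G / p = G - q^-1 * G by rewrite -[X in X - _](mul1r G) -mulrBl -pq addrK mulrC.
move: S2 S3 e1 e3; rewrite /k; lra.
Qed.

End conjugate_exponents.

(** * Continuity of translations *)

Section translation.
Context {R : realType} {N : nat} (q : R).
Hypothesis q0 : 0 < q.
Implicit Types (w g : 'rV[R]_N -> R) (h : 'rV[R]_N).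
Notation mu := (lebesgue_rV N).

Lemma measurable_fun_shift d' (U : measurableType d') h (g : 'rV[R]_N -> U) :
  measurable_fun setT g -> measurable_fun setT (fun x : 'rV[R]_N => g (x + h)).
Proof.
move=> mg; have := measurableT_comp mg (measurable_fun_rV_affine 1 h).
by under eq_fun do rewrite scale1r.
Qed.

Lemma pint_shift h g : measurable_fun setT g ->
  pint mu q (fun x => g (x + h)) = pint mu q g.
Proof.
move=> mg; rewrite /pint (integral_rV_translate h (F := fun x => (`|g x| `^ q)%:E))//.
exact: measurable_pint.
Qed.

Lemma test_function_pint phi : test_function phi -> (pint mu q phi < +oo)%E.
Proof.
move=> tphi; have [B B0 HB] := test_function_bounded tphi.
have mc : measurable (@rV_cube R N (B + 1)) by exact: measurable_rV_box.
have mi : measurable_fun setT (\1_(rV_cube (B + 1)) : 'rV[R]_N -> R) by exact: measurable_indic.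
apply: (@le_lt_trans _ _ (pint mu q (fun x => B * \1_(rV_cube (B + 1)) x))).
  apply: le_pint => //.
  - exact: test_function_measurable.
  - exact: (measurable_funM (measurable_cst _) mi).
  - move=> x; rewrite (le_trans (HB x))// [leRHS]ger0_norm ?mulr_ge0 ?(ltW B0)//.
    rewrite ler_wpM2l ?(ltW B0)// indicE; case: (leP `|x| B) => // xB.
    rewrite mem_set//; apply/rV_cubeP; lra.
rewrite pintZ// pint_indic// lte_mul_pinfty ?lee_fin ?powR_ge0//.
exact: lebesgue_rV_box.
Qed.

(** By contradiction: a sequence of bad shifts tends to 0, and dominated convergence along it, with
    phi continuous, gives a good one. *)
Lemma pint_shift_test phi : test_function phi -> forall e : R, 0 < e ->
  exists2 d, 0 < d & forall h, `|h| < d ->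
    (pint mu q (fun x => (phi x - phi (x + h))%R) <= e%:E)%E.
Proof.
move=> tphi e e0; apply: contrapT => Hn.
have /choice[h Hh] (n : nat) : exists h : 'rV[R]_N, `|h| < n.+1%:R^-1 /\
    ~ (pint mu q (fun x => (phi x - phi (x + h))%R) <= e%:E)%E.
  apply: contrapT => H; apply: Hn; exists n.+1%:R^-1; first by rewrite invr_gt0.
  by move=> h hn; apply: contrapT => H'; apply: H; exists h.
have [B B0 HB] := test_function_bounded tphi.
have mphi := test_function_measurable tphi.
(* Shifts of length at most 1 keep the support within radius B + 1; B + 2 leaves room because the
   cube is open. *)
have mc : measurable (@rV_cube R N (B + 2)) by exact: measurable_rV_box.
have mi : measurable_fun setT (\1_(rV_cube (B + 2)) : 'rV[R]_N -> R) by exact: measurable_indic.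
have [n Hn'] : exists n, (pint mu q (fun x => (phi x - phi (x + h n))%R) <= e%:E)%E.
  apply: (cvge0_le_exists e0).
  apply: (@pint_dominated_cvg _ _ _ mu q q0 (fun n x => phi (x + h n)) phi
    (fun x => B * \1_(rV_cube (B + 2)) x)) => //.
  - by move=> n; exact: measurable_fun_shift.
  - exact: (measurable_funM (measurable_cst _) mi).
  - move=> n x; rewrite (le_trans (HB _))// ler_wpM2l ?(ltW B0)// indicE.
    case: (leP `|x + h n| B) => // xB; rewrite mem_set//; apply/rV_cubeP; first lra.
    have [hn _] := Hh n; have n1 : n.+1%:R^-1 <= 1 :> R by rewrite invf_le1// ler1n.
    apply: (@le_lt_trans _ _ (B + 1)); last by rewrite ltrD2l ltr1n.
    have := ler_normB (x + h n) (h n); rewrite addrK => /le_trans; apply.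
    by apply: lerD => //; exact: (ltW (lt_le_trans hn n1)).
  - rewrite pintZ// pint_indic// lte_mul_pinfty ?lee_fin ?powR_ge0//.
    exact: lebesgue_rV_box.
  - move=> x; have cx : {for x, continuous phi} by exact: test_function_continuous.
    apply: (@continuous_cvg _ _ _ _ _ (fun n => x + h n) phi x cx).
    rewrite -[X in _ --> X]addr0; apply: cvgD; first exact: cvg_cst.
    apply/cvgr0Pnorm_lt => d d0; near=> n.
    have [hn _] := Hh n; apply: (lt_trans hn); near: n.
    exact: (near_infty_natSinv_lt (PosNum d0)).
by have [_] := Hh n.
Unshelve. all: by end_near. Qed.

Lemma pint_shift_continuous g : measurable_fun setT g -> (pint mu q g < +oo)%E ->
  forall e : R, 0 < e -> exists2 d, 0 < d & forall h, `|h| < d ->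
    (pint mu q (fun x => (g (x + h) - g x)%R) <= e%:E)%E.
Proof.
move=> mg gy e e0.
(* Three errors e / c, two of them inside a nested use of [pintD_le], add up to e. *)
pose c := 2 `^ q * (1 + 2 `^ q * 2).
have t0 : 0 < 2 `^ q :> R by rewrite powR_gt0.
have c0 : 0 < c by rewrite mulr_gt0// addr_gt0// mulr_gt0.
have ec : 0 < e / c by rewrite divr_gt0.
have [phi tphi Hphi] := test_approximable_Lp q0 mg gy ec.
have mphi := test_function_measurable tphi.
have [d d0 Hd] := pint_shift_test tphi ec.
exists d => // h hd.
have mgp : measurable_fun setT (fun x => g x - phi x) by exact: measurable_funB.
have mph : measurable_fun setT (fun x : 'rV[R]_N => phi (x + h)) by exact: measurable_fun_shift.
have -> : (fun x => g (x + h) - g x) = fun x => (g (x + h) - phi (x + h)) +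
    ((-1) * (g x - phi x) + (-1) * (phi x - phi (x + h))).
  by apply/funext => x; ring.
have m1 : measurable_fun setT (fun x : 'rV[R]_N => g (x + h) - phi (x + h)).
  exact: (measurable_fun_shift h mgp).
have m2 : measurable_fun setT (fun x => (-1) * (g x - phi x)).
  exact: (measurable_funM (measurable_cst _) mgp).
have m3' : measurable_fun setT (fun x : 'rV[R]_N => phi x - phi (x + h)) by exact: measurable_funB.
have m3 : measurable_fun setT (fun x : 'rV[R]_N => (-1) * (phi x - phi (x + h))).
  exact: (measurable_funM (measurable_cst _) m3').
have m23 : measurable_fun setT (fun x : 'rV[R]_N =>
    (-1) * (g x - phi x) + (-1) * (phi x - phi (x + h))) by exact: measurable_funD.
apply: (le_trans (pintD_le mu q0 m1 m23)).
apply: (@le_trans _ _ ((2 `^ q)%:E * ((e / c)%:E + (2 `^ q)%:E * ((e / c)%:E + (e / c)%:E)))%E).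
  apply: lee_wpmul2l; first by rewrite lee_fin powR_ge0.
  apply: leeD; first by rewrite (pint_shift h mgp).
  apply: (le_trans (pintD_le mu q0 m2 m3)).
  apply: lee_wpmul2l; first by rewrite lee_fin powR_ge0.
  by rewrite !pintZ// normrN1 powR1 !mul1e; apply: leeD => //; exact: Hd.
rewrite -!(EFinD, EFinM) lee_fin le_eqVlt; apply/orP; left; apply/eqP.
by rewrite /c; field; rewrite !gt_eqF// addr_gt0// mulr_gt0.
Qed.

End translation.

(** * Increments of Sobolev functions *)

Lemma MVT_sym (R : realType) (F dF : R -> R) (s : R) :
  (forall t : R, is_derive t 1 F (dF t)) ->
  exists2 c, `|c| <= `|s| & F s - F 0 = dF c * s.
Proof.
move=> dFt.
have cF a b : {within `[a, b], continuous F}.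
  apply: continuous_subspaceT => x.
  by apply/differentiable_continuous/derivable1_diffP; have [] := dFt x.
have [s0|s0] := leP 0 s.
  have [c /[!in_itv]/= /andP[c0 cs] H] := MVT_segment s0 (fun x _ => dFt x) (cF 0 s).
  by exists c; [rewrite !ger0_norm|rewrite H subr0].
have [c /[!in_itv]/= /andP[sc c0] H] := MVT_segment (ltW s0) (fun x _ => dFt x) (cF s 0).
exists c; first by rewrite !ler0_norm// ?lerN2// ltW.
by rewrite -opprB H sub0r mulrN opprK.
Qed.

Lemma pintB_lty d (T : measurableType d) (R : realType)
    (mu : {measure set T -> \bar R}) (p : R) (u v : T -> R) : 0 < p ->
  measurable_fun setT u -> measurable_fun setT v ->
  (pint mu p u < +oo)%E -> (pint mu p v < +oo)%E ->
  (pint mu p (fun x => (u x - v x)%R) < +oo)%E.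
Proof.
move=> p0 mu' mv uy vy.
have mNv : measurable_fun setT (fun x => -1 * v x).
  exact: (measurable_funM (measurable_cst _) mv).
have -> : (fun x => u x - v x) = fun x => u x + (-1) * v x.
  by apply/funext => x; rewrite mulN1r.
apply: (le_lt_trans (pintD_le mu p0 mu' mNv)).
rewrite lte_mul_pinfty ?lee_fin ?powR_ge0// (pintZ _ _ _ mv) normrN1 powR1 mul1e.
exact: (lte_add_pinfty uy vy).
Qed.

Section coordinate.
Context {R : realType} {N : nat} (p : R).
Hypothesis p1 : 1 < p.
Implicit Types (f : 'rV[R]_N -> R) (Df : 'rV[R]_N -> 'rV[R]_N) (i : 'I_N) (t s : R).
Notation mu := (lebesgue_rV N).
Local Notation basis i := (delta_mx ord0 i : 'rV[R]_N).

Lemma integral_rV_shift (h : 'rV[R]_N) (F : 'rV[R]_N -> \bar R) :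
  measurable_fun setT F ->
  (\int[mu]_x F (x + h)%R = \int[mu]_x F x)%E.
Proof.
move=> mF; rewrite [RHS]integralE [LHS]integralE; congr (_ - _)%E.
- rewrite -[RHS](integral_rV_translate h)//.
    by apply: eq_integral => x _; rewrite !(funeposE, funenegE).
  exact: measurable_funepos.
- rewrite -[RHS](integral_rV_translate h)//.
    by apply: eq_integral => x _; rewrite !(funeposE, funenegE).
  exact: measurable_funeneg.
Qed.

Let p0 : 0 < p := lt_trans ltr01 p1.
Let q := p / (p - 1).

Let q0 : 0 < q.
Proof. by rewrite divr_gt0// subr_gt0. Qed.

Let pq : p^-1 + q^-1 = 1.
Proof. by rewrite /q invf_div; field; rewrite gt_eqF. Qed.

Lemma partial_shift i phi (h x : 'rV[R]_N) : test_function phi ->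
  partial i (fun x => phi (x + h)) x = partial i phi (x + h).
Proof.
move=> [/(_ 1%N) cp _]; apply: derive_val; apply: rV_line_derive0.
have [dp _] := cp i.
rewrite (_ : (fun _ => _) = fun s => phi (s *: basis i + (x + h))).
  by apply: rV_line_derive; rewrite scale0r add0r; exact/derivableP.
by apply/funext => s; rewrite addrA.
Qed.

(** The difference quotient falls on the smooth factor phi. For parameters within 1 of t the
    derivative is dominated by B |f| on a fixed cube, which is integrable because the indicator of
    the cube is in L^q. *)
Lemma pairing_is_derive f phi i t : measurable_fun setT f -> (pint mu p f < +oo)%E ->
  test_function phi ->
  is_derive t 1 (fun t => \int[mu]_x (f x * phi (x + t *: basis i)))
    (\int[mu]_x (f x * partial i phi (x + t *: basis i))).
Proof.
move=> mf fy tphi.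
have tdphi := test_function_partial i tphi.
have [B B0 HB] := test_function_bounded tdphi.
have dline s x : is_derive s 1 (fun s : R => f x * phi (x + s *: basis i))
    (f x * partial i phi (x + s *: basis i)).
  have [/(_ 1%N) /(_ i)[dp _] _] := tphi.
  have H : is_derive s 1 (fun s : R => phi (x + s *: basis i))
      (partial i phi (x + s *: basis i)).
    rewrite (_ : (fun _ => _) = fun s : R => phi (s *: basis i + x)); last first.
      by apply/funext => r; rewrite addrC.
    by apply: rV_line_derive; rewrite addrC; exact/derivableP.
  exact: (@is_deriveZ _ _ _ (fun s : R => phi (x + s *: basis i)) (f x) s 1 _ H).
(* If |s| < |t| + 1 and x + s e_i has norm at most B, then |x| < B + |t| + 1 < K. *)
pose K := B + `|t| + 2.
have K0 : 0 < K by rewrite /K ltr_wpDl// addr_ge0// ltW.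
have mc : measurable (@rV_cube R N K) by exact: measurable_rV_box.
have mi : measurable_fun setT (\1_(rV_cube K) : 'rV[R]_N -> R) by exact: measurable_indic.
have iy : (pint mu q (\1_(rV_cube K) : 'rV[R]_N -> R) < +oo)%E.
  by rewrite pint_indic//; exact: lebesgue_rV_box.
have Ifi := integrable_mul_pint p0 q0 pq mf mi fy iy.
pose G x := B * `|f x * \1_(rV_cube K) x|.
have IG : mu.-integrable setT (EFin \o G).
  have := integrableZl measurableT B (integrable_abse Ifi).
  by apply: eq_integrable.
have It s : mu.-integrable setT (EFin \o (fun x => f x * phi (x + s *: basis i))).
  have tsh := test_function_shift (s *: basis i) tphi.
  exact: (integrable_mul_pint p0 q0 pq mf (test_function_measurable tsh) fy
    (test_function_pint q0 tsh)).
have G0 x : 0 <= G x by rewrite mulr_ge0// ltW.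
have tI : `]t - 1, t + 1[%classic t by rewrite /= in_itv/=; lra.
pose F s x := f x * phi (x + s *: basis i).
have dF s x : partial1of2 F s x = f x * partial i phi (x + s *: basis i).
  by rewrite partial1of2E; exact: derive_val.
have GF s x : `]t - 1, t + 1[%classic s -> setT x -> `|partial1of2 F s x| <= G x.
  rewrite /= in_itv /= => st _; rewrite dF /G !normrM.
  have h1 : `|s *: basis i| < `|t| + 1.
    rewrite normrZ.
    have b1 : `|basis i| <= 1.
      apply/rV_norm_leP => // j; rewrite !mxE; case: (_ && _); rewrite ?normr1// normr0//.
    apply: (@le_lt_trans _ _ `|s|); first by rewrite ler_piMr.
    by rewrite ltr_norml; have := ler_norm t; have := ler_norm (- t); rewrite normrN; lra.
  rewrite mulrCA ler_wpM2l// (le_trans (HB _))// ler_wpM2l ?(ltW B0)//.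
  rewrite indicE [leRHS]ger0_norm//.
  case: (leP `|x + s *: basis i| B) => // xB; rewrite mem_set//; apply/rV_cubeP => //.
  have := ler_normB (x + s *: basis i) (s *: basis i); rewrite addrK => /le_lt_trans; apply.
  by apply: (@le_lt_trans _ _ (B + (`|t| + 1))); [apply: lerD => //; exact: ltW|rewrite /K; lra].
have Fder s x : `]t - 1, t + 1[%classic s -> setT x -> derivable (F^~ x) s 1.
  by move=> _ _; have [] := dline s x.
apply: DeriveDef.
  exact: (derivable_under_integral measurableT tI (fun s _ => It s) Fder G0 IG GF).
rewrite -derive1E.
rewrite (differentiation_under_integral measurableT tI (fun s _ => It s) Fder G0 IG GF).
by apply: eq_Rintegral => x _; exact: dF.
Qed.

(* The mean value theorem is applied to t |-> int f(x) phi(x + t e_i) dx. *)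
Lemma sobolev_coordinate_pairing f Df i s phi : sobolev_W1 p f Df ->
  test_function phi -> exists2 c, `|c| <= `|s| &
  \int[mu]_x ((f (x + s *: basis i) - f x - s * Df x ord0 i) * phi x) =
  \int[mu]_x ((s * (Df (x + c *: basis i) ord0 i - Df x ord0 i)) * phi x).
Proof.
move=> [fp Dfp wg] tphi.
have [mf fy] := Lfun_pint (ltW p1) fp.
have [mD Dy] := Lfun_pint (ltW p1) (Dfp i).
(* Moving a translation from f to phi reverses its sign, hence the mean value theorem at [- s] and
   the witness [- c]. *)
have [c cs Hc] := MVT_sym (- s) (fun t => pairing_is_derive i t mf fy tphi).
rewrite normrN in cs.
exists (- c); first by rewrite normrN.
(* The weak gradient is tested against the translate of phi by c e_i. *)
have W := wg _ (test_function_shift (c *: basis i) tphi) i.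
clear wg fp Dfp cs.
have mphi := test_function_measurable tphi.
have phiy := test_function_pint q0 tphi.
pose D x := Df x ord0 i; rewrite -/(D) in mD Dy.
have move_shift (u : 'rV[R]_N -> R) t : measurable_fun setT u ->
    \int[mu]_x (u x * phi (x + t *: basis i)) =
    \int[mu]_x (u (x + (- t) *: basis i) * phi x).
  move=> mu'; rewrite /Rintegral; congr fine.
  rewrite -[RHS](integral_rV_shift (t *: basis i)).
    by apply: eq_integral => x _; rewrite -addrA -scalerDl addrN scale0r addr0.
  apply/measurable_EFinP; apply: measurable_funM => //.
  exact: measurable_fun_shift.
have E1 : \int[mu]_x (f x * phi (x + (- s) *: basis i)) =
    \int[mu]_x (f (x + s *: basis i) * phi x) by rewrite (move_shift _ _ mf) opprK.
have E2 : \int[mu]_x (f x * phi (x + 0 *: basis i)) = \int[mu]_x (f x * phi x).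
  by apply: eq_Rintegral => x _; rewrite scale0r addr0.
have E3 : \int[mu]_x (f x * partial i phi (x + c *: basis i)) =
    - \int[mu]_x (D (x + (- c) *: basis i) * phi x).
  rewrite -(move_shift D c mD).
  have H : \int[mu]_x (f x * partial i (fun y => phi (y + c *: basis i)) x) =
      - \int[mu]_x (D x * phi (x + c *: basis i)).
    by have := congr1 fine W; rewrite fineN.
  apply: etrans H; apply: eq_Rintegral => x _.
  by rewrite (partial_shift _ _ _ tphi).
pose Dc x := D (x + (- c) *: basis i).
have mfs : measurable_fun setT (fun x : 'rV[R]_N => f (x + s *: basis i)).
  exact: measurable_fun_shift.
have mDc : measurable_fun setT Dc by exact: measurable_fun_shift.
have fsy : (pint mu p (fun x => f (x + s *: basis i)%R) < +oo)%E.
  by rewrite (pint_shift p _ mf).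
have Dcy : (pint mu p Dc < +oo)%E by rewrite (pint_shift p _ mD).
have I1 := integrable_mul_pint p0 q0 pq mfs mphi fsy phiy.
have I2 := integrable_mul_pint p0 q0 pq mf mphi fy phiy.
have I3 := integrable_mul_pint p0 q0 pq mD mphi Dy phiy.
have I4 := integrable_mul_pint p0 q0 pq mDc mphi Dcy phiy.
have I5 := integrableZl measurableT s I3.
clear fy fsy Dy Dcy phiy W.
pose u1 x := f (x + s *: basis i) * phi x; pose u2 x := f x * phi x.
pose u3 x := D x * phi x; pose u4 x := Dc x * phi x.
have J1 : mu.-integrable setT (EFin \o u1) := I1.
have J2 : mu.-integrable setT (EFin \o u2) := I2.
have J3 : mu.-integrable setT (EFin \o u3) := I3.
have J4 : mu.-integrable setT (EFin \o u4) := I4.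
have J5 : mu.-integrable setT (EFin \o (fun x => s * u3 x)) := I5.
have J12 : mu.-integrable setT (EFin \o (fun x => u1 x - u2 x)).
  rewrite (_ : EFin \o _ = ((EFin \o u1) \- (EFin \o u2))%E)//.
  exact: integrableB.
have J43 : mu.-integrable setT (EFin \o (fun x => u4 x - u3 x)).
  rewrite (_ : EFin \o _ = ((EFin \o u4) \- (EFin \o u3))%E)//.
  exact: integrableB.
clear I1 I2 I3 I4 I5.
have -> : \int[mu]_x ((f (x + s *: basis i) - f x - s * D x) * phi x) =
    \int[mu]_x u1 x - \int[mu]_x u2 x - s * \int[mu]_x u3 x.
  rewrite -(RintegralZl s measurableT J3) -(RintegralB measurableT J1 J2).
  rewrite -(RintegralB measurableT J12 J5).
  by apply: eq_Rintegral => x _; rewrite /u1 /u2 /u3; ring.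
have -> : \int[mu]_x ((s * (Dc x - D x)) * phi x) =
    s * (\int[mu]_x u4 x - \int[mu]_x u3 x).
  rewrite -(RintegralB measurableT J4 J3) -(RintegralZl s measurableT J43).
  by apply: eq_Rintegral => x _; rewrite /u3 /u4; ring.
move: Hc; rewrite E1 E2 E3.
rewrite -/(\int[mu]_x u1 x) -/(\int[mu]_x u2 x) -/(\int[mu]_x u4 x); lra.
Qed.

(** Duality with M = |s|^p e. For each phi the remainder pairs like s (D_i f(. + c e_i) - D_i f); c
    varies with phi, but the assumed bound covers every admissible c, and Young gives the form that
    [pint_le_young] expects. *)
Lemma sobolev_coordinate f Df i s (e : R) : sobolev_W1 p f Df ->
  (forall t, `|t| <= `|s| ->
    (pint mu p (fun x => (Df (x + t *: basis i) ord0 i - Df x ord0 i)%R) <= e%:E)%E) ->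
  (pint mu p (fun x => (f (x + s *: basis i) - f x - s * Df x ord0 i)%R)
    <= (`|s| `^ p * e)%:E)%E.
Proof.
move=> sf; have [fp Dfp _] := sf.
have [mf fy] := Lfun_pint (ltW p1) fp.
have [mD Dy] := Lfun_pint (ltW p1) (Dfp i); clear fp Dfp.
pose D x := Df x ord0 i; rewrite -/(D) in mD Dy.
pose g x := f (x + s *: basis i) - f x - s * D x.
have mfs : measurable_fun setT (fun x : 'rV[R]_N => f (x + s *: basis i)).
  exact: measurable_fun_shift.
have fsy : (pint mu p (fun x => f (x + s *: basis i)%R) < +oo)%E.
  by rewrite (pint_shift p _ mf).
have msD : measurable_fun setT (fun x => s * D x).
  exact: (measurable_funM (measurable_cst _) mD).
have sDy : (pint mu p (fun x => s * D x)%R < +oo)%E.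
  by rewrite pintZ// lte_mul_pinfty ?lee_fin ?powR_ge0.
have mff : measurable_fun setT (fun x : 'rV[R]_N => f (x + s *: basis i) - f x).
  exact: measurable_funB.
have mg : measurable_fun setT g by exact: measurable_funB.
have gy : (pint mu p g < +oo)%E.
  exact: (pintB_lty p0 mff msD (pintB_lty p0 mfs mf fsy fy) sDy).
clear fsy sDy => He.
apply: (@pint_le_young _ _ _ mu p q p0 q0 pq g _ test_function mg gy).
  move=> w e' mw wy e'0; exact: (test_approximable_Lp q0 mw wy e'0).
move=> phi tphi; have mphi := test_function_measurable tphi.
split => // _; have phiy := test_function_pint q0 tphi.
have [c cs E] := sobolev_coordinate_pairing i s sf tphi.
have {}He := He _ cs.
pose Dc x := D (x + c *: basis i).
have mDc : measurable_fun setT Dc by exact: measurable_fun_shift.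
have Dcy : (pint mu p Dc < +oo)%E by rewrite (pint_shift p _ mD).
have mDD' : measurable_fun setT (fun x => Dc x - D x) by exact: measurable_funB.
have mDD : measurable_fun setT (fun x => s * (Dc x - D x)).
  exact: (measurable_funM (measurable_cst _) mDD').
have DDy : (pint mu p (fun x => s * (Dc x - D x))%R < +oo)%E.
  rewrite (pintZ _ _ s mDD').
  apply: lte_mul_pinfty; [by rewrite lee_fin powR_ge0|by []|].
  exact: (pintB_lty p0 mDc mD Dcy Dy).
have Ig := integrable_mul_pint p0 q0 pq mg mphi gy phiy.
have IDD := integrable_mul_pint p0 q0 pq mDD mphi DDy phiy.
have ID := integrable_pint p0 mDD DDy.
have Iphi := integrable_pint q0 mphi phiy.
clear gy phiy DDy Dcy Dy fy.
have -> : (\int[mu]_x (g x * phi x)%:E = \int[mu]_x ((s * (Dc x - D x)) * phi x)%:E)%E.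
  rewrite -[LHS](fineK (integrable_fin_num measurableT Ig)).
  rewrite -[RHS](fineK (integrable_fin_num measurableT IDD)).
  by congr (_%:E); exact: E.
have IZ1 := integrableZl measurableT p^-1 ID.
have IZ2 := integrableZl measurableT q^-1 Iphi.
apply: (@le_trans _ _ (\int[mu]_x ((p^-1)%:E * (`|s * (Dc x - D x)| `^ p)%:E +
     (q^-1)%:E * (`|phi x| `^ q)%:E))%E).
  apply: (le_integral measurableT IDD (integrableD measurableT IZ1 IZ2)).
  move=> x _; rewrite -!EFinM -EFinD lee_fin (le_trans (ler_norm _))// normrM.
  rewrite (mulrC p^-1) (mulrC q^-1).
  exact: conjugate_powR.
rewrite (integralD measurableT IZ1 IZ2).
rewrite !integralZ_pint ?invr_ge0 ?(ltW p0) ?(ltW q0)// leeD2r//.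
rewrite (pintZ _ _ s mDD').
rewrite mulrC !EFinM; apply: lee_wpmul2l; first by rewrite lee_fin invr_ge0 ltW.
by apply: lee_wpmul2l; [rewrite lee_fin powR_ge0|exact: He].
Qed.

End coordinate.

Lemma pint_sum_le d (T : measurableType d) (R : realType)
    (mu : {measure set T -> \bar R}) (p : R) n : 0 < p ->
  exists2 K, 0 <= K & forall F : 'I_n -> T -> R,
    (forall i, measurable_fun setT (F i)) ->
    (pint mu p (fun x => \sum_i F i x)%R <= K%:E * \sum_i pint mu p (F i))%E.
Proof.
move=> p0; have [K K0 HK] := powR_norm_sum_le n p0.
exists K => // F mF.
have mp i := measurable_pint p (mF i).
rewrite /pint -ge0_integral_sum//.
rewrite -ge0_integralZl//; last first.
- by move=> x _; apply: sume_ge0 => i _; rewrite lee_fin powR_ge0.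
- exact: emeasurable_sum.
apply: ge0_le_integral => //.
- by apply: measurable_pint; exact: measurable_sum.
- by apply: emeasurable_funM => //; exact: emeasurable_sum.
- by move=> x _; rewrite sumEFin -EFinM lee_fin.
Qed.

Section increments.
Context {R : realType} {N : nat} (p : R).
Hypothesis p1 : 1 < p.
Variables (f : 'rV[R]_N -> R) (Df : 'rV[R]_N -> 'rV[R]_N).
Hypothesis sf : sobolev_W1 p f Df.
Variable nrm : 'rV[R]_N -> R.
Hypothesis hnrm : is_norm nrm.
Implicit Types (i j : 'I_N) (h x : 'rV[R]_N) (e : R).
Notation mu := (lebesgue_rV N).
Local Notation basis i := (delta_mx ord0 i : 'rV[R]_N).
Local Notation D i := (fun x : 'rV[R]_N => Df x ord0 i).

Let p0 : 0 < p := lt_trans ltr01 p1.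

Let mf : measurable_fun setT f.
Proof. by have [fp _ _] := sf; have [] := Lfun_pint (ltW p1) fp. Qed.

Let fy : (pint mu p f < +oo)%E.
Proof. by have [fp _ _] := sf; have [] := Lfun_pint (ltW p1) fp. Qed.

Let mD i : measurable_fun setT (D i).
Proof. by have [_ Dp _] := sf; have [] := Lfun_pint (ltW p1) (Dp i). Qed.

Let Dy i : (pint mu p (D i) < +oo)%E.
Proof. by have [_ Dp _] := sf; have [] := Lfun_pint (ltW p1) (Dp i). Qed.

Lemma measurable_dot h : measurable_fun setT (fun x => dot (Df x) h).
Proof.
rewrite /dot; apply: measurable_sum => i; exact: measurable_funM.
Qed.

Lemma measurable_increment h : measurable_fun setT (fun x => f (x + h) - f x).
Proof. by apply: measurable_funB => //; exact: measurable_fun_shift. Qed.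

Lemma powR_coord_le : exists2 c, 0 < c & forall h i, `|h ord0 i| `^ p <= c * nrm h `^ p.
Proof.
have [c c0 Hc] := is_norm_ge hnrm.
exists (c^-1 `^ p); first by rewrite powR_gt0// invr_gt0.
move=> h i; rewrite -powRM ?invr_ge0 ?(ltW c0) ?is_norm_ge0//.
rewrite ge0_ler_powR ?nnegrE ?(ltW p0) ?mulr_ge0 ?invr_ge0 ?(ltW c0) ?is_norm_ge0//.
by rewrite (le_trans (rV_coord_norm _ _))// ler_pdivlMl.
Qed.

(** It makes the limit quotient l a bounded function, and gives the term that absorbs e1 in
    [increment_dot_near]. *)
Lemma pint_dot_le : exists2 C, 0 <= C & forall h,
  (pint mu p (fun x => dot (Df x) h) <= (C * nrm h `^ p)%:E)%E.
Proof.
have [c c0 Hc] := powR_coord_le.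
have [K K0 HK] := pint_sum_le mu N p0.
have /choice[G HG] i : exists G : R, pint mu p (D i) = G%:E.
  by exists (fine (pint mu p (D i))); rewrite fineK// pint_fin_num.
have G0 i : 0 <= G i by rewrite -lee_fin -HG pint_ge0.
exists (K * \sum_i (c * G i)).
  by rewrite mulr_ge0// sumr_ge0// => i _; rewrite mulr_ge0// ltW.
move=> h.
have mF i : measurable_fun setT (fun x => h ord0 i * Df x ord0 i).
  exact: (measurable_funM (measurable_cst _) (mD i)).
have -> : (fun x => dot (Df x) h) = fun x => \sum_i h ord0 i * Df x ord0 i.
  by apply/funext => x; apply: eq_bigr => i _; rewrite mulrC.
apply: (le_trans (HK _ mF)); rewrite -mulrA EFinM.
apply: lee_wpmul2l; first by rewrite lee_fin.
rewrite mulr_suml -sumEFin; apply: lee_sum => i _.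
rewrite (pintZ _ _ _ (mD i)) HG -EFinM lee_fin mulrAC ler_wpM2r//.
Qed.

Lemma translation_uniform e : 0 < e -> exists2 d, 0 < d & forall h i, `|h| < d ->
  (pint mu p (fun x => (Df (x + h) ord0 i - Df x ord0 i)%R) <= e%:E)%E.
Proof.
move=> e0.
have /choice[d Hd] i : exists d, 0 < d /\ forall h, `|h| < d ->
    (pint mu p (fun x => (Df (x + h) ord0 i - Df x ord0 i)%R) <= e%:E)%E.
  by have [d d0 H] := pint_shift_continuous p0 (mD i) (Dy i) e0; exists d.
exists (\big[Num.min/1]_i d i).
  by apply/bigmin_gtP; split => // i _; case: (Hd i).
move=> h i /bigmin_gtP[_ hd]; case: (Hd i) => _; apply; exact: hd.
Qed.

(* Joins 0 to h by changing one coordinate at a time. *)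
Definition rV_take h (j : nat) : 'rV[R]_N := \row_i (if (i < j)%N then h ord0 i else 0).

Lemma rV_take_norm h (j : nat) : `|rV_take h j| <= `|h|.
Proof.
apply/rV_norm_leP => // i; rewrite mxE; case: ifP => _; rewrite ?normr0//.
exact: rV_coord_norm.
Qed.

Lemma rV_take0 h : rV_take h 0 = 0.
Proof. by apply/rowP => i; rewrite !mxE. Qed.

Lemma rV_take_all h : rV_take h N = h.
Proof. by apply/rowP => i; rewrite mxE ltn_ord. Qed.

Lemma rV_takeS h j : rV_take h j.+1 = rV_take h j + h ord0 j *: basis j.
Proof.
apply/rowP => i; rewrite !mxE eqxx /= ltnS leq_eqVlt.
have [->|ij] := eqVneq i j; first by rewrite eqxx ltnn mulr1 add0r.
by rewrite -(inj_eq val_inj) /= in ij; rewrite (negbTE ij) mulr0 addr0.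
Qed.

(** Telescope along the path [rV_take]. Step j leaves the one-coordinate remainder [A j] at a
    translated base point, which translation invariance removes, and the error [B j] of returning
    D_j f to the base point x. *)
Lemma sobolev_increment e : 0 < e -> exists2 d, 0 < d & forall h, nrm h < d ->
  (pint mu p (fun x => (f (x + h) - f x - dot (Df x) h)%R) <= (e * nrm h `^ p)%:E)%E.
Proof.
move=> e0; have [c c0 Hc] := powR_coord_le; have [b b0 Hb] := is_norm_ge hnrm.
have [K K0 HK] := pint_sum_le mu N p0.
(* The total constant: K for the sum over j, 2^p for A + B, N summands, and c for each of the two
   bounds. *)
pose M := K * (2 `^ p * (N%:R * (2 * c))).
have M0 : 0 <= M by rewrite !mulr_ge0 ?powR_ge0// ltW.
have eta0 : 0 < e / (M + 1) by rewrite divr_gt0// ltr_wpDl.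
set eta := e / (M + 1) in eta0.
have [d d0 Hd] := translation_uniform eta0.
exists (d * b); first by rewrite mulr_gt0.
move=> h hd.
have hd' : `|h| < d by rewrite -(ltr_pM2r b0) (le_lt_trans _ hd)// mulrC.
pose A j x := f (x + rV_take h j + h ord0 j *: basis j) - f (x + rV_take h j) -
  h ord0 j * Df (x + rV_take h j) ord0 j.
pose B j x := h ord0 j * (Df (x + rV_take h j) ord0 j - Df x ord0 j).
have mA0 j : measurable_fun setT (fun x : 'rV[R]_N => f (x + h ord0 j *: basis j) - f x -
    h ord0 j * Df x ord0 j).
  apply: measurable_funB; first exact: measurable_increment.
  exact: (measurable_funM (measurable_cst _) (mD j)).
have mA j : measurable_fun setT (A j).
  exact: (measurable_fun_shift (rV_take h j) (mA0 j)).
have mB0 j : measurable_fun setT (fun x => Df (x + rV_take h j) ord0 j - Df x ord0 j).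
  apply: measurable_funB; last exact: mD.
  exact: (measurable_fun_shift (rV_take h j) (mD j)).
have mB j : measurable_fun setT (B j).
  exact: (measurable_funM (measurable_cst _) (mB0 j)).
have -> : (fun x => f (x + h) - f x - dot (Df x) h) = fun x => \sum_j (A j x + B j x).
  apply/funext => x.
  have tele : \sum_(j < N) (f (x + rV_take h j.+1) - f (x + rV_take h j)) =
      f (x + h) - f x.
    rewrite -(big_mkord xpredT (fun j : nat => f (x + rV_take h j.+1) - f (x + rV_take h j))).
    by rewrite telescope_sumr// rV_take_all rV_take0 addr0.
  rewrite -tele /dot -sumrB; apply: eq_bigr => j _.
  by rewrite /A /B rV_takeS addrA; ring.
have mAB j : measurable_fun setT (fun x => A j x + B j x) by exact: measurable_funD.
apply: (le_trans (HK _ mAB)).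
have Aj j : (pint mu p (A j) <= (c * nrm h `^ p * eta)%:E)%E.
  rewrite (pint_shift p (rV_take h j) (mA0 j)).
  apply: (@le_trans _ _ (`|h ord0 j| `^ p * eta)%:E).
    apply: (sobolev_coordinate p1 sf) => t tj; apply: Hd.
    rewrite normrZ (le_lt_trans _ hd')//.
    have b1 : `|basis j| <= 1.
      apply/rV_norm_leP => // i; rewrite !mxE; case: (_ && _); rewrite ?normr1// normr0//.
    apply: (@le_trans _ _ `|t|); first by rewrite ler_piMr.
    exact: (le_trans tj (rV_coord_norm _ _)).
  by rewrite lee_fin ler_wpM2r// ltW.
have Bj j : (pint mu p (B j) <= (c * nrm h `^ p * eta)%:E)%E.
  rewrite (pintZ _ _ _ (mB0 j)) EFinM; apply: lee_pmul.
  - by rewrite lee_fin powR_ge0.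
  - exact: pint_ge0.
  - by rewrite lee_fin.
  - by apply: Hd; rewrite (le_lt_trans (rV_take_norm _ _)).
apply: (@le_trans _ _ (K%:E * \sum_(j < N) (2 `^ p * (2 * (c * nrm h `^ p * eta)))%:E)%E).
  apply: lee_wpmul2l; first by rewrite lee_fin.
  apply: lee_sum => j _; apply: (le_trans (pintD_le mu p0 (mA j) (mB j))).
  rewrite EFinM; apply: lee_wpmul2l; first by rewrite lee_fin powR_ge0.
  by rewrite mulr_natl mulr2n EFinD leeD.
rewrite sumEFin -EFinM lee_fin sumr_const card_ord -[X in K * X]mulr_natl.
have -> : K * (N%:R * (2 `^ p * (2 * (c * nrm h `^ p * eta)))) =
   (M * eta) * nrm h `^ p by rewrite /M; ring.
rewrite ler_wpM2r ?powR_ge0// /eta mulrCA ler_piMr ?(ltW e0)//.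
by rewrite ler_pdivrMr ?mul1r; lra.
Qed.

(** Apply [powR_normD_sub] with the slope as a and the remainder of [sobolev_increment] as b. *)
Lemma increment_dot_near e : 0 < e -> exists2 d, 0 < d & forall h, nrm h < d ->
  (pint mu p (fun x => (f (x + h) - f x)%R) <=
     pint mu p (fun x => dot (Df x) h) + (e * nrm h `^ p)%:E)%E /\
  (pint mu p (fun x => dot (Df x) h) <=
     pint mu p (fun x => (f (x + h) - f x)%R) + (e * nrm h `^ p)%:E)%E.
Proof.
move=> e0; have [L L0 HL] := pint_dot_le.
(* [e1] is paired with the bound L of the slope, and [e2] below with the constant C, which depends
   on [e1]; each product is at most e/2. *)
pose e1 := e / (2 * (L + 1)).
have e10 : 0 < e1 by rewrite divr_gt0// mulr_gt0// ltr_wpDl.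
have [C C0 HC] := powR_normD_sub p0 e10.
pose e2 := e / (2 * (C + 1)).
have e20 : 0 < e2 by rewrite divr_gt0// mulr_gt0// ltr_wpDl.
have [d d0 Hd] := sobolev_increment e20.
exists d => // h hd; have {}Hd := Hd h hd; have {}HL := HL h.
pose a x := dot (Df x) h; pose b x := f (x + h) - f x - dot (Df x) h.
have ma : measurable_fun setT a := measurable_dot h.
have mab : measurable_fun setT (fun x => f (x + h) - f x) := measurable_increment h.
have mb : measurable_fun setT b by exact: measurable_funB.
have small : (e1%:E * pint mu p a + C%:E * pint mu p b <= (e * nrm h `^ p)%:E)%E.
  apply: (@le_trans _ _ (e1%:E * (L * nrm h `^ p)%:E + C%:E * (e2 * nrm h `^ p)%:E)%E).
    by apply: leeD; apply: lee_wpmul2l => //; rewrite lee_fin// ltW.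
  rewrite -!EFinM -EFinD lee_fin (mulrA e1) (mulrA C) -mulrDl ler_wpM2r ?powR_ge0//.
  have h1 : e1 * L <= e / 2.
    have -> : e1 * L = e / 2 * (L / (L + 1)) by rewrite /e1; field; rewrite !gt_eqF//; lra.
    by rewrite ler_piMr ?divr_ge0 ?(ltW e0)// ler_pdivrMr ?mul1r; lra.
  have h2 : C * e2 <= e / 2.
    have -> : C * e2 = e / 2 * (C / (C + 1)) by rewrite /e2; field; rewrite !gt_eqF//; lra.
    by rewrite ler_piMr ?divr_ge0 ?(ltW e0)// ler_pdivrMr ?mul1r; lra.
  apply: le_trans (lerD h1 h2) _; lra.
have abE x : a x + b x = f (x + h) - f x by rewrite /a /b; ring.
clear Hd HL.
(* The pointwise inequality bounds an absolute value, so the same integration serves both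
   directions. *)
have key (u v : 'rV[R]_N -> R) : measurable_fun setT u -> measurable_fun setT v ->
    (forall x, `|u x| `^ p <= `|v x| `^ p + (e1 * `|a x| `^ p + C * `|b x| `^ p)) ->
    (pint mu p u <= pint mu p v + (e * nrm h `^ p)%:E)%E.
  move=> mu' mv H.
  apply: (@le_trans _ _ (pint mu p v + (e1%:E * pint mu p a + C%:E * pint mu p b))%E);
    last exact: leeD2l.
  rewrite -(integralZ_pint mu p0 (ltW e10) ma) -(integralZ_pint mu p0 C0 mb).
  have mpa : measurable_fun setT (fun x => e1%:E * (`|a x| `^ p)%:E)%E.
    by apply: emeasurable_funM => //; exact: measurable_pint.
  have mpb : measurable_fun setT (fun x => C%:E * (`|b x| `^ p)%:E)%E.
    by apply: emeasurable_funM => //; exact: measurable_pint.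
  have pa0 x : setT x -> (0 <= e1%:E * (`|a x| `^ p)%:E)%E.
    by move=> _; rewrite mule_ge0// lee_fin ?powR_ge0// ltW.
  have pb0 x : setT x -> (0 <= C%:E * (`|b x| `^ p)%:E)%E.
    by move=> _; rewrite mule_ge0// lee_fin ?powR_ge0.
  rewrite -(ge0_integralD mu measurableT pa0 mpa pb0 mpb).
  have mpv := measurable_pint p mv.
  have pv0 x : setT x -> (0 <= (`|v x| `^ p)%:E)%E by rewrite lee_fin powR_ge0.
  have pab0 x : setT x -> (0 <= e1%:E * (`|a x| `^ p)%:E + C%:E * (`|b x| `^ p)%:E)%E.
    by move=> tx; rewrite adde_ge0// ?pa0// pb0.
  have mpab := emeasurable_funD mpa mpb.
  rewrite -(ge0_integralD mu measurableT pv0 mpv pab0 mpab).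
  apply: ge0_le_integral => //.
  - exact: measurable_pint.
  - exact: emeasurable_funD.
  - by move=> x _; rewrite -!EFinM -!EFinD lee_fin.
split; apply: (key) => // x; have := HC (a x) (b x); rewrite abE ler_norml -/(a x); lra.
Qed.

End increments.

(** * Polar coordinates *)

Section density_measure.
Context d (T : measurableType d) (R : realType) (mu : {measure set T -> \bar R}).
Local Open Scope ereal_scope.
Variable g : T -> \bar R.
Hypotheses (mg : measurable_fun setT g) (g0 : forall x, 0 <= g x).

(* The hypotheses are arguments so that density carries a canonical measure. *)
Definition density (mg : measurable_fun setT g) (g0 : forall x, 0 <= g x) (A : set T) :=
  \int[mu]_(x in A) g x.

Let density0 : density mg g0 set0 = 0.
Proof. exact: integral_set0. Qed.

Let density_ge0 A : 0 <= density mg g0 A.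
Proof. exact: integral_ge0. Qed.

Let density_sigma_additive : semi_sigma_additive (density mg g0).
Proof.
move=> F mF tF mUF; rewrite /density ge0_integral_bigcup//; last exact: measurable_funTS.
by apply: is_cvg_nneseries => n _ _; exact: integral_ge0.
Qed.

HB.instance Definition _ := isMeasure.Build _ _ _ (density mg g0)
  density0 density_ge0 density_sigma_additive.

End density_measure.

Section layer_cake.
Context d (T : measurableType d) (R : realType)
  (mu : {sigma_finite_measure set T -> \bar R}).
Local Open Scope ereal_scope.

(** Write psi x as the length of [0, psi x[ and exchange the integrals. For psi composed with the
    norm, the level sets are preimages under the norm, the sets on which radial image measures are
    compared. *)
Lemma layer_cake (g psi : T -> R) :
  measurable_fun setT g -> measurable_fun setT psi ->
  (forall x, 0 <= g x)%R -> (forall x, 0 <= psi x)%R ->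
  \int[mu]_x (g x * psi x)%:E =
  \int[lebesgue_measure]_t \int[mu]_(x in [set x | (0 <= t < psi x)%R]) (g x)%:E.
Proof.
move=> mg mpsi g0 psi0.
pose F (z : T * measurableTypeR R) : \bar R := (g z.1 * (0 <= z.2 < psi z.1)%R%:R)%:E.
have mb : measurable_fun setT (fun z : T * measurableTypeR R => (0 <= z.2 < psi z.1)%R).
  apply: measurable_and.
    apply: measurable_fun_ler; first exact: measurable_cst.
    exact: measurable_snd.
  apply: measurable_fun_ltr; first exact: measurable_snd.
  exact: (measurableT_comp mpsi measurable_fst).
have mF : measurable_fun setT F.
  apply/measurable_EFinP; apply: measurable_funM.
    exact: (measurableT_comp mg measurable_fst).
  rewrite (_ : (fun _ => _) = fun z : T * measurableTypeR R =>
      if (0 <= z.2 < psi z.1)%R then 1%R else 0%R); last first.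
    by apply/funext => z; case: ifP.
  exact: measurable_fun_ifT.
have F0 z : 0 <= F z by rewrite lee_fin mulr_ge0.
transitivity (\int[mu]_x \int[lebesgue_measure]_t F (x, t)).
  apply: eq_integral => x _.
  transitivity (\int[lebesgue_measure]_t ((g x)%:E * (\1_`[0%R, psi x[ t)%:E)).
    rewrite ge0_integralZl//.
    - rewrite integral_indic// setIT.
      rewrite [X in _ * X]lebesgue_measure_itv/= lte_fin.
      case: ltP => px; first by rewrite oppr0 adde0 EFinM.
      by rewrite (_ : psi x = 0%R) ?mulr0 ?mule0//; apply/eqP; rewrite eq_le px psi0.
    - apply/measurable_EFinP; exact: measurable_indic.
    - by rewrite lee_fin.
  apply: eq_integral => t _; rewrite -EFinM /F/= indicE.
  by congr (_ * (nat_of_bool _)%:R)%:E; apply/idP/idP => [/set_mem|] /=; rewrite ?in_itv// => H;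
    apply/mem_set; rewrite /= in_itv.
rewrite (fubini_tonelli F mF F0); apply: eq_integral => t _.
rewrite [RHS]integral_mkcond; apply: eq_integral => x _; rewrite patchE /F /=.
have [tx|tx] := boolP (0 <= t < psi x)%R.
  by rewrite mem_set// mulr1.
by rewrite memNset ?mulr0//; exact/negP.
Qed.

End layer_cake.

Section polar.
Context {R : realType} {N : nat} (hN : (1 <= N)%N) (nrm : 'rV[R]_N -> R).
Hypothesis hnrm : is_norm nrm.
Notation mu := (lebesgue_rV N).
Local Open Scope ereal_scope.

(** The cone over the whole unit sphere; 0 is left out because x / nrm x has no direction there. *)
Definition pointed_ball : set 'rV[R]_N := [set x | (0 < nrm x <= 1)%R].

Lemma measurable_is_norm : measurable_fun setT nrm.
Proof. by apply: continuous_rV_measurable; exact: is_norm_continuous. Qed.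

Lemma measurable_preimage_norm (A : set R) : measurable A -> measurable (nrm @^-1` A).
Proof. by move=> mA; rewrite -[X in measurable X]setTI; exact: measurable_is_norm. Qed.

Lemma measurable_pointed_ball : measurable pointed_ball.
Proof.
rewrite (_ : pointed_ball = nrm @^-1` `]0%R, 1%R]%classic).
  by apply: measurable_preimage_norm; exact: measurable_itv.
by apply/seteqP; split => x; rewrite /= in_itv.
Qed.

Lemma lebesgue_norm_ball (r : R) : mu (nrm @^-1` `]-oo, r]%classic) < +oo.
Proof.
have [c c0 Hc] := is_norm_ge hnrm.
have r0 : (0 < `|r| / c + 1)%R by rewrite ltr_wpDl// divr_ge0// ltW.
apply: (@le_lt_trans _ _ (mu (@rV_cube R N (`|r| / c + 1)))).
  apply: le_measure; rewrite ?inE.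
  - by apply: measurable_preimage_norm; exact: measurable_itv.
  - exact: measurable_rV_box.
  - move=> x; rewrite /= in_itv/= => xr; apply/rV_cubeP => //.
    apply: (@le_lt_trans _ _ (`|r| / c)%R); last by rewrite ltrDl.
    by rewrite ler_pdivlMr// mulrC (le_trans (Hc x))// (le_trans xr)// ler_norm.
exact: lebesgue_rV_box.
Qed.

Lemma integral_power (s : R) : (0 <= s)%R ->
  \int[lebesgue_measure]_(r in `]0%R, s[) (r ^+ N.-1)%:E = (s ^+ N / N%:R)%:E.
Proof.
rewrite le_eqVlt => /predU1P[<-|s0].
  by rewrite set_itv_ge ?bnd_simp// integral_set0 expr0n gtn_eqF// mul0r.
have mX (A : set R) : measurable A -> measurable_fun A (fun r : R => (r ^+ N.-1)%:E).
  by move=> _; apply/measurable_EFinP; apply: measurable_funTS.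
have N0 : N%:R != 0%R :> R by rewrite pnatr_eq0 -lt0n.
have dX (r : R) : is_derive r 1%R (fun r : R => r ^+ N / N%:R)%R (r ^+ N.-1)%R.
  rewrite (_ : (fun _ => _) = N%:R^-1 *: (@id R ^+ N))%R; last first.
    by apply/funext => x; rewrite !fctE mulrC.
  by apply: is_derive_eq; rewrite /GRing.scale/=; field.
have cX (r : R) : {for r, continuous (fun r : R => r ^+ N / N%:R)%R}.
  by apply: differentiable_continuous; apply/derivable1_diffP.
rewrite integral_itv_obnd_cbnd ?integral_itv_bndo_bndc//; [|exact: mX..].
rewrite (@continuous_FTC2 _ (fun r => r ^+ N.-1)%R (fun r => r ^+ N / N%:R)%R)//.
- by rewrite expr0n gtn_eqF// mul0r sube0.
- apply: continuous_subspaceT => r; exact: exprn_continuous.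
- split.
  + by move=> r _.
  + by apply: cvg_at_right_filter; exact: cX.
  + by apply: cvg_at_left_filter; exact: cX.
- by move=> r _; rewrite derive1E; apply: derive_val.
Qed.

Section homogeneous.
Variable l : 'rV[R]_N -> R.
Hypotheses (ml : measurable_fun setT l) (l0 : forall x, (0 <= l x)%R).
Hypotheses (lz : l 0%R = 0%R) (lhom : forall c x, (0 < c)%R -> l (c *: x)%R = l x).
Variable K : R.
Hypothesis KE : \int[mu]_(x in nrm @^-1` `]-oo, 1%R[%classic) (l x)%:E = K%:E.

Let ml' : measurable_fun setT (EFin \o l).
Proof. exact/measurable_EFinP. Qed.

Let l0' x : 0 <= (EFin \o l) x.
Proof. by rewrite lee_fin. Qed.

Let K0 : (0 <= K)%R.
Proof. by rewrite -lee_fin -KE; apply: integral_ge0 => x _; exact: l0'. Qed.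

(** The dilation x -> s x carries the unit ball to the ball of radius s and leaves [l] unchanged.
    For s <= 0 the set is empty, hence [Num.max s 0]. *)
Lemma integral_homogeneous_ball (s : R) :
  \int[mu]_(x in nrm @^-1` `]-oo, s[%classic) (l x)%:E = (K * Num.max s 0 ^+ N)%:E.
Proof.
have [s0|s0] := ltP 0%R s; last first.
  rewrite expr0n gtn_eqF// mulr0; apply: integral0_eq => x.
  by rewrite /= in_itv/= => xs; have := is_norm_ge0 hnrm x; rewrite leNgt (lt_le_trans xs).
rewrite [LHS]integral_mkcond -(integral_rV_affine 0%R s0); last 2 first.
- apply/(measurable_restrictT _ _).1; last exact: measurable_funTS.
  by apply: measurable_preimage_norm; exact: measurable_itv.
- by move=> x; rewrite patchE; case: ifP; rewrite ?lee_fin.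
rewrite mulrC EFinM -KE; congr (_ * _); rewrite [RHS]integral_mkcond.
apply: eq_integral => x _; rewrite addr0 !patchE lhom//.
rewrite (_ : ((s *: x)%R \in _) = (x \in nrm @^-1` `]-oo, 1%R[%classic))//.
have E : (nrm (s *: x)%R < s)%R = (nrm x < 1)%R.
  by rewrite (is_normZ hnrm) gtr0_norm// -ltr_pdivlMl// mulVf ?gt_eqF.
by apply/idP/idP => /set_mem H; apply/mem_set; move: H; rewrite /= !in_itv/= E.
Qed.

(** The derivative of K s^N for s > 0: the density of the image of l dL^N under the norm. *)
Let w (r : R) : R := (K * N%:R * (if 0 < r then r ^+ N.-1 else 0))%R.

Let mw : measurable_fun setT (EFin \o (w : measurableTypeR R -> R)).
Proof.
apply/measurable_EFinP; apply: measurable_funM => //.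
apply: measurable_fun_ifT => //; exact: measurable_fun_ltr.
Qed.

Let w0 r : 0 <= (EFin \o w) r.
Proof.
rewrite lee_fin mulr_ge0// ?mulr_ge0//.
by case: ifP => // r0; rewrite exprn_ge0// ltW.
Qed.

(* Both sides are measures in A, so it suffices to compare them on half-lines,
   where homogeneity and scaling give K s^N. *)
Lemma homogeneous_pushforward (A : set (measurableTypeR R)) : measurable A ->
  \int[mu]_(x in nrm @^-1` A) (l x)%:E = \int[lebesgue_measure]_(r in A) (w r)%:E.
Proof.
have mn : measurable_fun setT (nrm : 'rV[R]_N -> measurableTypeR R).
  exact: measurable_is_norm.
pose nu1 : {measure set (measurableTypeR R) -> \bar R} :=
  mpushforward (density mu ml' l0') mn.
pose nu2 : {measure set (measurableTypeR R) -> \bar R} :=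
  density lebesgue_measure mw w0.
have nu1E B : nu1 B = \int[mu]_(x in nrm @^-1` B) (l x)%:E by [].
have nu2E B : nu2 B = \int[lebesgue_measure]_(r in B) (w r)%:E by [].
rewrite -nu1E -nu2E.
move=> mA.
refine (@measure_unique _ R (measurableTypeR R) (@RGenInftyO.G R)
  (fun n => `]-oo, (n%:R : R)[%classic) _ _ _ _ nu1 nu2 _ _ A mA).
- exact: RGenInftyO.measurableE.
- move=> _ _ [x ->] [y ->]; exists (Num.min x y).
  by apply/seteqP; split => z; rewrite /= !in_itv/= lt_min; [case=> -> ->|move/andP].
- by move=> n; exists (n%:R)%R.
- apply/seteqP; split => // x _; exists (Num.truncn `|x|).+1 => //.
  by rewrite /= in_itv/= (le_lt_trans (ler_norm _))// truncnS_gt.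
- move=> _ [s ->]; rewrite nu1E nu2E integral_homogeneous_ball.
  have [s0|s0] := ltP 0%R s; last first.
    rewrite expr0n gtn_eqF// mulr0; apply/esym/integral0_eq => x.
    rewrite /= in_itv/= => xs; rewrite /w ltNge (ltW (lt_le_trans xs s0))/=.
    by rewrite mulr0.
  transitivity (\int[lebesgue_measure]_(r in `]0%R, s[) ((K * N%:R)%:E * (r ^+ N.-1)%:E)).
    rewrite ge0_integralZl//.
    - rewrite integral_power ?(ltW s0)// -EFinM; congr (_%:E); field.
      by rewrite pnatr_eq0 -lt0n.
    - by apply/measurable_EFinP; exact: exprn_measurable.
    - by move=> r; rewrite /= in_itv/= => /andP[r0 _]; rewrite lee_fin exprn_ge0// ltW.
    - by rewrite lee_fin mulr_ge0.
  rewrite integral_mkcond [RHS]integral_mkcond; apply: eq_integral => r _.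
  rewrite !patchE.
  have [r0|r0] := ltP 0%R r.
    rewrite (_ : (r \in `]0%R, s[%classic) = (r \in `]-oo, s[%classic)).
      by case: ifP => // _; rewrite /w r0 -EFinM.
    by apply/idP/idP => /set_mem H; apply/mem_set; move: H; rewrite /= !in_itv/= r0.
  rewrite memNset; last by rewrite /= in_itv/= ltNge r0.
  by case: ifP => // _; rewrite /w ltNge r0/= mulr0.
- by move=> n; rewrite nu1E integral_homogeneous_ball ltry.
Qed.

(** The layer cake formula is used twice: to reach level sets of psi, where the measure can be moved
    to the half-line, and to return from there. *)
Lemma homogeneous_polar (psi : R -> R) : measurable_fun setT psi ->
  (forall r, 0 <= psi r)%R -> (forall r, r <= 0 -> psi r = 0)%R ->
  \int[mu]_x (l x * psi (nrm x))%:E =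
  (N%:R)%:E * \int[mu]_(x in pointed_ball) (l x)%:E *
    \int[lebesgue_measure]_(r in `]0%R, +oo[) (r ^+ N.-1 * psi r)%:E.
Proof.
move=> mpsi psi0 psiz.
have mpn : measurable_fun setT (psi \o nrm) := measurableT_comp mpsi measurable_is_norm.
rewrite (layer_cake mu ml mpn l0 (fun x => psi0 (nrm x))).
have mwR : measurable_fun setT (w : measurableTypeR R -> R) by exact/measurable_EFinP.
have w0R r : (0 <= w r)%R by rewrite -lee_fin; exact: w0.
have mA (t : R) : measurable ([set r | (0 <= t < psi r)%R] : set (measurableTypeR R)).
  have [t0|t0] := leP 0%R t; last first.
    by rewrite (_ : mkset _ = set0)//; apply/seteqP; split.
  rewrite (_ : mkset _ = psi @^-1` `]t, +oo[%classic).
    by rewrite -[X in measurable X]setTI; apply: mpsi => //; exact: measurable_itv.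
  by apply/seteqP; split => r; rewrite /= in_itv/= andbT.
transitivity (\int[lebesgue_measure]_t \int[lebesgue_measure]_(r in
    [set r | (0 <= t < psi r)%R]) (w r)%:E).
  by apply: eq_integral => t _; exact: (homogeneous_pushforward (mA t)).
rewrite -(layer_cake lebesgue_measure mwR mpsi w0R psi0).
(* K is the integral over the open ball. The origin does not count because [l] vanishes there, nor
   does the sphere: on the half-line it is an endpoint of an interval. *)
have -> : \int[mu]_(x in pointed_ball) (l x)%:E = K%:E.
  transitivity (\int[mu]_(x in nrm @^-1` `]-oo, 1%R]%classic) (l x)%:E).
    rewrite integral_mkcond [RHS]integral_mkcond; apply: eq_integral => x _.
    rewrite !patchE; have [->|x0] := eqVneq x 0%R.
      by rewrite lz; case: ifP; case: ifP.
    rewrite (_ : (x \in pointed_ball) = (x \in nrm @^-1` `]-oo, 1%R]%classic))//.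
    by apply/idP/idP => /set_mem H; apply/mem_set; move: H;
      rewrite /pointed_ball /= in_itv/= (is_norm_gt0 hnrm x0).
  rewrite (homogeneous_pushforward (measurable_itv `]-oo, 1%R])).
  have mwi (b : bool) : measurable_fun
      [set` Interval -oo%O (BSide b (1%R : R))] (fun r : R => (w r)%:E).
    by apply: measurable_funTS; exact: mw.
  by rewrite -integral_itv_bndo_bndc// -homogeneous_pushforward// KE.
rewrite [in RHS]integral_mkcond -EFinM -ge0_integralZl//.
- apply: eq_integral => r _; rewrite patchE /w.
  have [r0|r0] := ltP 0%R r.
    rewrite mem_set; last by rewrite /= in_itv/= r0.
    by rewrite -EFinM mulrA [(_ * K)%R]mulrC.
  rewrite memNset; last by rewrite /= in_itv/= ltNge r0.
  by rewrite !mulr0 mul0r mule0.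
- apply/(measurable_restrictT _ _).1 => //; apply: measurable_funTS.
  by apply/measurable_EFinP; apply: measurable_funM.
- move=> r _; rewrite patchE; case: ifPn => // /set_mem; rewrite /= in_itv/= andbT => r0.
  by rewrite lee_fin mulr_ge0// exprn_ge0// ltW.
- by rewrite lee_fin mulr_ge0.
Qed.

End homogeneous.

(* sphere_measure is a bare set function: it is the restriction to the sphere of
   N times the image of Lebesgue measure under x |-> x / nrm x on the pointed
   ball. *)
Lemma integral_sphere_measure (G : 'rV[R]_N -> \bar R) : measurable_fun setT G ->
  (forall v, 0 <= G v) ->
  \int[sphere_measure nrm]_(v in norm_sphere nrm) G v =
  (N%:R)%:E * \int[mu]_(x in pointed_ball) G ((nrm x)^-1 *: x)%R.
Proof.
move=> mG G0.
(* Radial projection made total: elsewhere its value 0 lies off the sphere, so the preimage of a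
   subset of the sphere is exactly its cone. *)
pose proj (x : 'rV[R]_N) : 'rV[R]_N :=
  (if 0 < nrm x <= 1 then (nrm x `^ (-1)) *: x else 0)%R.
have mb : measurable_fun setT (fun x : 'rV[R]_N => (0 < nrm x <= 1)%R).
  apply: measurable_and.
    by apply: measurable_fun_ltr => //; exact: measurable_is_norm.
  by apply: measurable_fun_ler => //; exact: measurable_is_norm.
have mproj : measurable_fun setT proj.
  apply: measurable_fun_rVP => i.
  rewrite (_ : (fun _ => _) = fun x : 'rV[R]_N =>
     (if 0 < nrm x <= 1 then (nrm x `^ (-1)) * x ord0 i else 0)%R); last first.
    by apply/funext => x; rewrite /proj; case: ifP; rewrite mxE.
  apply: measurable_fun_ifT => //; apply: measurable_funM.
    exact: (measurableT_comp (measurable_powR _) measurable_is_norm).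
  exact: measurable_coord.
have mS : measurable (norm_sphere nrm).
  rewrite (_ : norm_sphere nrm = nrm @^-1` [set 1%R])//.
  exact: measurable_preimage_norm.
have proj_ball x : pointed_ball x -> proj x = ((nrm x)^-1 *: x)%R.
  by rewrite /pointed_ball /proj /= => x1; rewrite x1 powR_inv1// ltW//; case/andP: x1.
have projS A : A `<=` norm_sphere nrm -> proj @^-1` A = cone A.
  move=> AS; apply/seteqP; split => x /=.
    move=> Ax; have x1 : pointed_ball x.
      have := AS _ Ax; rewrite /norm_sphere /pointed_ball /proj /=; case: ifP => //.
      by rewrite is_norm0// => _ /eqP; rewrite eq_sym oner_eq0.
    have /andP[x0 xle] := x1.
    exists (proj x) => //; exists (nrm x); first by rewrite x0.
    by rewrite proj_ball// scalerA divff ?scale1r// gt_eqF.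
  case=> v Av [t /andP[t0 t1] ->{x}].
  have v1 : nrm v = 1%R := AS _ Av.
  have tv : nrm (t *: v)%R = t by rewrite (is_normZ hnrm) v1 mulr1 gtr0_norm.
  rewrite proj_ball ?/pointed_ball/= ?tv ?t0//.
  by rewrite scalerA mulVf ?scale1r// gt_eqF.
have ballE : proj @^-1` norm_sphere nrm = pointed_ball.
  rewrite projS//; apply/seteqP; split => [x [v v1 [t /andP[t0 t1] ->]]|x /andP[x0 x1]].
    by rewrite /pointed_ball /= (is_normZ hnrm) v1 mulr1 gtr0_norm// t0.
  exists ((nrm x)^-1 *: x)%R.
    by rewrite /norm_sphere /= (is_normZ hnrm) gtr0_norm ?invr_gt0// mulVf// gt_eqF.
  exists (nrm x); first by rewrite x0.
  by rewrite scalerA divff ?scale1r// gt_eqF.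
pose sigma := mscale (NngNum (ler0n R N)) (mpushforward mu mproj).
pose tau : {measure set _ -> \bar R} := mrestr sigma mS.
have sphereE A : sphere_measure nrm A = tau A.
  by rewrite /tau/= /mrestr /sigma /= /mscale /= /pushforward projS//; exact: subIsetr.
(* The equality holds on every set, so the bare set function may be replaced by a genuine measure
   under the integral. *)
rewrite (_ : sphere_measure nrm = tau); last exact/funext.
rewrite (eq_measure_integral sigma); last first.
  by move=> A mA AS; rewrite /tau /= /mrestr (setIidl AS).
rewrite ge0_integral_mscale//; last exact: measurable_funTS.
congr (_ * _); rewrite ge0_integral_pushforward//; last exact: measurable_funTS.
rewrite ballE; apply: eq_integral => x /set_mem x1.
by rewrite /= proj_ball.
Qed.

End polar.

(** * Concentration of the mollifiers *)

(** A is the expected constant, B the weight of the error e, and C the limit of the kernel masses I.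
    The bound M may depend on e, since it multiplies a tail t that tends to 0 once e is fixed. *)
Lemma cvg_squeeze_eps {R : realType} (a : nat -> \bar R) (A B C : R) :
  0 <= A -> 0 <= B -> 0 <= C ->
  (forall e, 0 < e -> exists I t : nat -> \bar R, exists2 M, 0 <= M &
    [/\ I n @[n --> \oo] --> C%:E, t n @[n --> \oo] --> 0%E &
     forall n, (a n <= (A + e * B)%:E * I n + M%:E * t n /\
                A%:E * I n <= a n + (e * B)%:E * I n)%E]) ->
  a n @[n --> \oo] --> (A * C)%:E.
Proof.
move=> A0 B0 C0 H.
have {}H (d : R) : 0 < d -> \forall n \near \oo,
    ((A * C - d)%:E <= a n <= (A * C + d)%:E)%E.
  (* Once I n <= C + 1, this choice of e makes the error e B I n at most d/2. *)
  move=> d0; pose K := B * (C + 1) + 1.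
  have K0 : 0 < K by rewrite ltr_wpDl// mulr_ge0// addr_ge0.
  have [|I [t [M M0 [IC t0 Hn]]]] := H (d / (2 * K)); first by rewrite divr_gt0// mulr_gt0.
  set e := d / (2 * K) in Hn.
  have e0 : 0 < e by rewrite divr_gt0// mulr_gt0.
  have eB : e * B * (C + 1) <= d / 2.
    rewrite (_ : d / 2 = e * K); last by rewrite /e; field; rewrite gt_eqF.
    by rewrite -mulrA ler_wpM2l ?(ltW e0)// lerDl.
  (* Tolerance for I n and t n: g <= 1 for the bound C + 1, and (A + M) g <= d/2 for the remaining
     error. *)
  pose g := Num.min 1 (d / (2 * (A + M + 1))).
  have AM : 0 < A + M + 1 by rewrite ltr_wpDl// addr_ge0.
  have g0 : 0 < g by rewrite lt_min ltr01 divr_gt0// mulr_gt0.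
  have g1 : g <= 1 by rewrite ge_min lexx.
  have Ag : (A + M) * g <= d / 2.
    apply: (@le_trans _ _ ((A + M + 1) * g)); first by rewrite ler_wpM2r ?ltW// ltrDl.
    rewrite mulrC -ler_pdivlMr// ge_min; apply/orP; right.
    by rewrite invfM mulrA.
  move/fine_cvgP : IC => [If /cvgrPdist_le /(_ _ g0) IC].
  move/fine_cvgP : t0 => [tf /cvgrPdist_le /(_ _ g0) t0].
  near=> n.
  have [H1 H2] := Hn n.
  have In : I n = (fine (I n))%:E by rewrite fineK//; near: n.
  have tn : t n = (fine (t n))%:E by rewrite fineK//; near: n.
  have ICn : `|C - fine (I n)| <= g by near: n.
  have t0n : `|0 - fine (t n)| <= g by near: n.
  move: H1 H2; rewrite In tn; move: ICn t0n.
  move: (fine (I n)) (fine (t n)) => i u + + H1 H2; move: H1 H2.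
  move: (a n) => [r| |]; rewrite -?EFinM -?EFinD ?lee_fin// => H1 H2.
  rewrite sub0r normrN !ler_norml => /andP[i1 i2] /andP[u1 u2].
  have eB0 : 0 <= e * B by rewrite mulr_ge0// ltW.
  have i3 : i <= C + g by lra.
  have eBi : e * B * i <= d / 2.
    by apply: le_trans eB; rewrite ler_wpM2l//; lra.
  have Ai1 : A * i <= A * C + A * g by rewrite -mulrDr ler_wpM2l.
  have Ai2 : A * C - A * g <= A * i by rewrite -mulrBr ler_wpM2l//; lra.
  have Mu : M * u <= M * g by rewrite ler_wpM2l.
  have AgM : A * g + M * g <= d / 2 by rewrite -mulrDl.
  have Mg : 0 <= M * g by rewrite mulr_ge0// ltW.
  apply/andP; split; first by lra.
  apply: (le_trans H1); rewrite mulrDl; lra.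
apply/fine_cvgP; split.
  near=> n; have /andP[] : ((A * C - 1)%:E <= a n <= (A * C + 1)%:E)%E by near: n; exact: H.
  by case: (a n).
apply/cvgrPdist_le => d d0; near=> n.
have /andP[] : ((A * C - d)%:E <= a n <= (A * C + d)%:E)%E by near: n; exact: H.
case E : (a n) => [r| |] //; rewrite !lee_fin => r1 r2 /=.
by rewrite E /= ler_norml; lra.
Unshelve. all: by end_near. Qed.

(** Composition with exp turns monotonicity on the open half-line into monotonicity on the whole
    line; ln then leads back. *)
Lemma measurable_nonincreasing_gt0 {R : realType} (g : R -> R) :
  (forall r s, 0 < r -> r <= s -> g s <= g r) ->
  measurable_fun setT (fun r : R => if 0 < r then g r else 0).
Proof.
move=> ng; rewrite (_ : (fun _ => _) = fun r : R => if 0 < r then g (expR (ln r)) else 0).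
  apply: measurable_fun_ifT => //; first exact: measurable_fun_ltr.
  apply: (measurableT_comp (f := g \o expR)); last exact: measurable_ln.
  apply: nonincreasing_measurable => // x y xy /=.
  by rewrite ng ?expR_gt0// ler_expR.
by apply/funext => r; case: ifPn => // r0; rewrite lnK// posrE.
Qed.

Section concentration.
Context {R : realType} {N : nat} (hN : (1 <= N)%N) (nrm : 'rV[R]_N -> R).
Hypothesis hnrm : is_norm nrm.
Notation mu := (lebesgue_rV N).
Local Open Scope ereal_scope.
Implicit Types (l tau : 'rV[R]_N -> R) (psi : R -> R).

(** Boundedness makes the integrals over balls finite, so that the constant of the polar formula is
    a real number. *)
Lemma bounded_homogeneous_polar l (C : R) : measurable_fun setT l ->
  (forall x, 0 <= l x <= C)%R -> l 0%R = 0%R ->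
  (forall c x, (0 < c)%R -> l (c *: x)%R = l x) ->
  exists2 K : R, (0 <= K)%R &
    \int[mu]_(x in pointed_ball nrm) (l x)%:E = K%:E /\
    forall psi, measurable_fun setT psi -> (forall r, 0 <= psi r)%R ->
      (forall r, r <= 0 -> psi r = 0)%R ->
      \int[mu]_x (l x * psi (nrm x))%:E =
      (N%:R * K)%:E * \int[lebesgue_measure]_(r in `]0%R, +oo[) (r ^+ N.-1 * psi r)%:E.
Proof.
move=> ml lC l0 lhom.
have l_ge0 x : (0 <= l x)%R by case/andP: (lC x).
have mball : measurable (nrm @^-1` `]-oo, 1%R]%classic).
  by apply: measurable_preimage_norm => //; exact: measurable_itv.
have lfin A : measurable A -> A `<=` nrm @^-1` `]-oo, 1%R]%classic ->
    exists2 K : R, (0 <= K)%R & \int[mu]_(x in A) (l x)%:E = K%:E.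
  move=> mA Ab; have A0 : 0 <= \int[mu]_(x in A) (l x)%:E.
    by apply: integral_ge0 => x _; rewrite lee_fin.
  exists (fine (\int[mu]_(x in A) (l x)%:E)); first exact: fine_ge0.
  rewrite fineK// ge0_fin_numE//.
  apply: (@le_lt_trans _ _ (\int[mu]_(x in A) C%:E)).
    apply: ge0_le_integral => //.
    - by move=> x _; rewrite lee_fin.
    - by apply: measurable_funTS; exact/measurable_EFinP.
    - by move=> x _; rewrite lee_fin; case/andP: (lC x).
  rewrite integral_cst//; apply: lte_mul_pinfty => //.
  - by rewrite lee_fin; case/andP: (lC 0%R) => /le_trans; apply.
  - apply: le_lt_trans (lebesgue_norm_ball hnrm 1).
    by apply: le_measure; rewrite ?inE.
have [K K0 KE] : exists2 K : R, (0 <= K)%R &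
    \int[mu]_(x in pointed_ball nrm) (l x)%:E = K%:E.
  apply: lfin; first exact: measurable_pointed_ball.
  by move=> x /andP[_ x1]; rewrite /= in_itv.
have [K' _ KE'] : exists2 K : R, (0 <= K)%R &
    \int[mu]_(x in nrm @^-1` `]-oo, 1%R[%classic) (l x)%:E = K%:E.
  apply: lfin; first by apply: measurable_preimage_norm => //; exact: measurable_itv.
  by move=> x; rewrite /= !in_itv/= => /ltW.
exists K => //; split=> // psi mpsi psi0 psiz.
by rewrite (homogeneous_polar hN hnrm ml l_ge0 l0 lhom KE' mpsi psi0 psiz) KE EFinM.
Qed.

Variables (rho : nat -> 'rV[R]_N -> 'rV[R]_N -> R) (rhot : nat -> R -> R) (C0 : R).
Hypothesis hrho : mollifiers nrm rho rhot C0.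

(* The value of rhot n at 0 is unconstrained, but it only occurs on the
   diagonal, where the integrand vanishes because of x / 0 = 0. *)
Definition profile n (r : R) : R := if (0 < r)%R then rhot n r else 0%R.

Lemma profile_ge0 n r : (0 <= profile n r)%R.
Proof.
have [_ _ rhot0 _ _ _ _ _] := hrho; rewrite /profile; case: ifPn => // r0.
by rewrite rhot0// ltW.
Qed.

Lemma measurable_profile n : measurable_fun setT (profile n).
Proof.
have [_ _ _ rhot_noninc _ _ _ _] := hrho.
exact: (measurable_nonincreasing_gt0 (rhot_noninc n)).
Qed.

(** Within radius d, tau is replaced by l up to e, and the polar formula evaluates the result
    exactly; beyond d, tau is bounded and the kernels lose their mass. *)
Lemma mollifier_concentration l tau (C : R) : measurable_fun setT l ->
  (forall x, 0 <= l x <= C)%R -> l 0%R = 0%R ->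
  (forall c x, (0 < c)%R -> l (c *: x)%R = l x) ->
  measurable_fun setT tau -> (forall x, 0 <= tau x)%R ->
  (forall e : R, (0 < e)%R -> exists2 d : R, (0 < d)%R &
    forall h, (0 < nrm h < d)%R -> (tau h <= l h + e)%R /\ (l h <= tau h + e)%R) ->
  (forall d : R, (0 < d)%R -> exists2 M : R, (0 <= M)%R &
    forall h, (d <= nrm h)%R -> (tau h <= M)%R) ->
  \int[mu]_h (tau h * profile n (nrm h))%:E @[n --> \oo] -->
  (C0%:E * (N%:R%:E * \int[mu]_(x in pointed_ball nrm) (l x)%:E))%E.
Proof.
move=> ml lC l0 lhom mtau tau0 near_tau far_tau.
have [_ _ _ _ rhoE C0_gt0 rhoC0 rho_tail] := hrho.
have mnrm : measurable_fun setT nrm := measurable_is_norm hnrm.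
(* The indicator of nonzero vectors is itself homogeneous of degree 0 and vanishes at 0, so the
   polar formula also evaluates the error term e. *)
pose J (h : 'rV[R]_N) : R := if (0 < nrm h)%R then 1%R else 0%R.
have mJ : measurable_fun setT J.
  by apply: measurable_fun_ifT => //; exact: measurable_fun_ltr.
have J1 x : (0 <= J x <= 1)%R by rewrite /J; case: ifP => _; rewrite !lexx ler01.
have J0 : J 0%R = 0%R by rewrite /J is_norm0// ltxx.
have Jhom (c : R) x : (0 < c)%R -> J (c *: x)%R = J x.
  by move=> c0; rewrite /J (is_normZ hnrm) gtr0_norm// pmulr_rgt0.
have [K K0 [KE polar_l]] := bounded_homogeneous_polar ml lC l0 lhom.
have [K1 K10 [_ polar_J]] := bounded_homogeneous_polar mJ J1 J0 Jhom.
rewrite KE -!EFinM [(C0 * _)%R]mulrC.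
apply: (@cvg_squeeze_eps _ _ _ (N%:R * K1)%R); rewrite ?mulr_ge0 ?(ltW C0_gt0)//.
move=> e e0; have [d d0 Hd] := near_tau _ e0; have [M M0 HM] := far_tau _ d0.
exists (fun n => \int[lebesgue_measure]_(r in `]0%R, d[) (r ^+ N.-1 * rhot n r)%:E).
(* The kernels are radial, so the tail condition at the single point 0 suffices. *)
exists (fun n => \int[mu]_(y in [set y | (d <= nrm (0 - y))%R]) (rho n 0%R y)%:E).
exists M => //; split; [exact: rhoC0|exact: rho_tail|].
move=> n.
(* [psi] and [chi] split the kernel at radius d. *)
pose psi r : R := if (r < d)%R then profile n r else 0%R.
pose chi h : R := if (d <= nrm h)%R then profile n (nrm h) else 0%R.
have mpsi : measurable_fun setT psi.
  apply: measurable_fun_ifT => //; first exact: measurable_fun_ltr.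
  exact: measurable_profile.
have mprof : measurable_fun setT (fun h => profile n (nrm h)).
  exact: (measurableT_comp (measurable_profile n) mnrm).
have mchi : measurable_fun setT chi.
  by apply: measurable_fun_ifT => //; exact: measurable_fun_ler.
have psi0 r : (0 <= psi r)%R by rewrite /psi; case: ifP => // _; exact: profile_ge0.
have chi0 h : (0 <= chi h)%R by rewrite /chi; case: ifP => // _; exact: profile_ge0.
have psiz (r : R) : (r <= 0 -> psi r = 0)%R.
  by rewrite leNgt => /negbTE r0; rewrite /psi /profile r0; case: ifP.
have mpsin : measurable_fun setT (fun h => psi (nrm h)) := measurableT_comp mpsi mnrm.
have -> : \int[lebesgue_measure]_(r in `]0%R, d[) (r ^+ N.-1 * rhot n r)%:E =
    \int[lebesgue_measure]_(r in `]0%R, +oo[) (r ^+ N.-1 * psi r)%:E.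
  rewrite integral_mkcond [RHS]integral_mkcond; apply: eq_integral => r _.
  rewrite !patchE; have [r0|r0] := ltP 0%R r; last first.
    by rewrite !memNset//= in_itv/= ltNge r0.
  rewrite [in RHS]mem_set; last by rewrite /= in_itv/= r0.
  rewrite /psi /profile r0; have [rd|rd] := ltP r d.
    by rewrite mem_set//= in_itv/= r0.
  by rewrite mulr0 memNset//= in_itv/= r0 ltNge rd.
have -> : \int[mu]_(y in [set y | (d <= nrm (0 - y))%R]) (rho n 0%R y)%:E =
    \int[mu]_h (chi h)%:E.
  rewrite integral_mkcond; apply: eq_integral => h _.
  rewrite patchE rhoE sub0r (is_normN hnrm) /chi /profile.
  case: ifPn => [/set_mem|/negP Hn].
    by rewrite /= sub0r (is_normN hnrm) => dh; rewrite dh (lt_le_trans d0 dh).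
  by case: ifPn => // dh; case: Hn; apply/mem_set; rewrite /= sub0r (is_normN hnrm).
pose I := \int[lebesgue_measure]_(r in `]0%R, +oo[) (r ^+ N.-1 * psi r)%:E.
rewrite -/I.
have I0 : 0 <= I.
  apply: integral_ge0 => r; rewrite /= in_itv/= andbT => r0.
  by rewrite lee_fin mulr_ge0// exprn_ge0// ltW.
have NK0 : 0 <= (N%:R * K)%:E by rewrite lee_fin mulr_ge0.
have NK10 : 0 <= (e * (N%:R * K1))%:E by rewrite lee_fin !mulr_ge0// ltW.
have eI : (e * (N%:R * K1))%:E * I = \int[mu]_h (e * (J h * psi (nrm h)))%:E.
  rewrite EFinM -muleA -(polar_J _ mpsi psi0 psiz) -ge0_integralZl//.
  - by apply/measurable_EFinP; exact: measurable_funM.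
  - by move=> x _; rewrite lee_fin mulr_ge0//; case/andP: (J1 x).
  - by rewrite lee_fin ltW.
have mlp : measurable_fun setT (fun h => (l h * psi (nrm h))%:E).
  by apply/measurable_EFinP; exact: measurable_funM.
have mJp : measurable_fun setT (fun h => (e * (J h * psi (nrm h)))%:E).
  by apply/measurable_EFinP; apply: measurable_funM => //; exact: measurable_funM.
have mtp : measurable_fun setT (fun h => (tau h * profile n (nrm h))%:E).
  by apply/measurable_EFinP; exact: measurable_funM.
have mMc : measurable_fun setT (fun h => (M * chi h)%:E).
  by apply/measurable_EFinP; exact: measurable_funM.
have lp0 h : 0 <= (l h * psi (nrm h))%:E by rewrite lee_fin mulr_ge0//; case/andP: (lC h).
have Jp0 h : 0 <= (e * (J h * psi (nrm h)))%:E.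
  by rewrite lee_fin !mulr_ge0// ?(ltW e0)//; case/andP: (J1 h).
have tp0 h : 0 <= (tau h * profile n (nrm h))%:E by rewrite lee_fin mulr_ge0// profile_ge0.
have Mc0 h : 0 <= (M * chi h)%:E by rewrite lee_fin mulr_ge0.
have cM : M%:E * \int[mu]_h (chi h)%:E = \int[mu]_h (M * chi h)%:E.
  rewrite -ge0_integralZl//; first exact/measurable_EFinP.
  by move=> h _; rewrite lee_fin.
have psiE h : (0 < nrm h < d)%R -> psi (nrm h) = profile n (nrm h) /\ chi h = 0%R.
  by move=> /andP[_ hd]; rewrite /psi /chi hd leNgt hd.
have chiE h : (d <= nrm h)%R -> psi (nrm h) = 0%R /\ chi h = profile n (nrm h).
  by move=> hd; rewrite /psi /chi hd ltNge hd.
have JE h : (0 < nrm h)%R -> J h = 1%R by rewrite /J => ->.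
have prof0 h : (nrm h <= 0)%R -> profile n (nrm h) = 0%R.
  by rewrite /profile leNgt => /negbTE ->.
(* Both bounds hold pointwise: tau * profile <= (l + e J) psi + M chi, and l psi <= tau * profile +
   e J psi. *)
split.
  rewrite EFinD ge0_muleDl// eI -(polar_l _ mpsi psi0 psiz) cM.
  have mS : measurable_fun setT
      (fun h => (l h * psi (nrm h))%:E + (e * (J h * psi (nrm h)))%:E).
    exact: emeasurable_funD.
  have S0 h : 0 <= (l h * psi (nrm h))%:E + (e * (J h * psi (nrm h)))%:E.
    exact: adde_ge0.
  rewrite -(ge0_integralD mu measurableT (fun h _ => lp0 h) mlp (fun h _ => Jp0 h) mJp).
  rewrite -(ge0_integralD mu measurableT (fun h _ => S0 h) mS (fun h _ => Mc0 h) mMc).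
  apply: ge0_le_integral => //.
  - exact: emeasurable_funD.
  move=> h _; have [h0|h0] := ltP 0%R (nrm h); last first.
    rewrite prof0// mulr0; exact: adde_ge0.
  rewrite -!EFinD lee_fin (JE _ h0); have [hd|hd] := ltP (nrm h) d.
    have h0d : (0 < nrm h < d)%R by rewrite h0.
    have [-> ->] := psiE _ h0d; have [tl _] := Hd _ h0d.
    by rewrite mulr0 addr0 mul1r -mulrDl ler_wpM2r// profile_ge0.
  have [-> ->] := chiE _ hd.
  by rewrite !mulr0 !add0r ler_wpM2r ?profile_ge0// HM.
rewrite eI -(polar_l _ mpsi psi0 psiz).
rewrite -(ge0_integralD mu measurableT (fun h _ => tp0 h) mtp (fun h _ => Jp0 h) mJp).
apply: ge0_le_integral => //.
- exact: emeasurable_funD.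
move=> h _; have [h0|h0] := ltP 0%R (nrm h); last first.
  rewrite [X in X%:E <= _](_ : _ = 0%R) ?psiz ?mulr0//; exact: adde_ge0.
rewrite -EFinD lee_fin (JE _ h0); have [hd|hd] := ltP (nrm h) d.
  have h0d : (0 < nrm h < d)%R by rewrite h0.
  have [-> _] := psiE _ h0d; have [_ lt] := Hd _ h0d.
  by rewrite mul1r -mulrDl ler_wpM2r// profile_ge0.
by have [-> _] := chiE _ hd; rewrite !mulr0 addr0 mulr_ge0// profile_ge0.
Qed.

End concentration.

(** * Difference quotients as functions of the increment *)

Section quotient.
Context {R : realType} {N : nat} (nrm : 'rV[R]_N -> R) (p : R).
Hypotheses (hnrm : is_norm nrm) (p0 : 0 < p).
Variable F : 'rV[R]_N * 'rV[R]_N -> R.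
Hypothesis mF : measurable_fun setT F.
Notation mu := (lebesgue_rV N).
Local Open Scope ereal_scope.
Hypothesis Fy : forall h, pint mu p (fun x => F (x, h)) < +oo.

(** Serves both for increments of f and for the slopes Df . h. By [Fy], [fine] loses nothing; at h =
    0 the value is 0, as a division by 0. *)
Definition pint_quotient (h : 'rV[R]_N) : R :=
  (fine (pint mu p (fun x => F (x, h))) / nrm h `^ p)%R.

Lemma measurable_powR_is_norm r : measurable_fun setT (fun h => (nrm h `^ r)%R).
Proof. exact: (measurableT_comp (measurable_powR _) (measurable_is_norm hnrm)). Qed.

Lemma measurable_powR_pair :
  measurable_fun setT (fun z : 'rV[R]_N * 'rV[R]_N => (`|F z| `^ p)%:E).
Proof. exact: measurable_pint. Qed.

Lemma measurable_pint_quotient : measurable_fun setT pint_quotient.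
Proof.
apply: measurable_funM.
  apply: (measurableT_comp (f := fine)); first exact: fine_measurable.
  apply: (measurable_fun_fubini_tonelli_G (m1 := mu) _ measurable_powR_pair).
  by move=> z; rewrite lee_fin powR_ge0.
by under eq_fun do rewrite -powRN; exact: measurable_powR_is_norm.
Qed.

Lemma pint_quotient_ge0 h : (0 <= pint_quotient h)%R.
Proof. by rewrite divr_ge0 ?powR_ge0// fine_ge0// pint_ge0. Qed.

Let measurable_weighted (g : 'rV[R]_N -> R) : measurable_fun setT g ->
  measurable_fun setT (fun z : 'rV[R]_N * 'rV[R]_N =>
    (`|F z| `^ p / nrm z.2 `^ p * g z.2)%:E).
Proof.
move=> mg; apply/measurable_EFinP; apply: measurable_funM.
  apply: measurable_funM; first exact: measurable_powR_norm.
  under eq_fun do rewrite -powRN.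
  exact: (measurableT_comp (measurable_powR_is_norm _) measurable_snd).
exact: (measurableT_comp mg measurable_snd).
Qed.

Let weighted_ge0 (g : 'rV[R]_N -> R) : (forall h, 0 <= g h)%R ->
  forall z : 'rV[R]_N * 'rV[R]_N, 0 <= (`|F z| `^ p / nrm z.2 `^ p * g z.2)%:E.
Proof. by move=> g0 z; rewrite lee_fin !mulr_ge0// ?invr_ge0 powR_ge0. Qed.

Lemma measurable_weighted_integral (g : 'rV[R]_N -> R) :
  measurable_fun setT g -> (forall h, 0 <= g h)%R ->
  measurable_fun setT (fun x => \int[mu]_h (`|F (x, h)| `^ p / nrm h `^ p * g h)%:E).
Proof.
move=> mg g0; apply: (measurable_fun_fubini_tonelli_F (m2 := mu) _ (measurable_weighted mg)).
exact: weighted_ge0.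
Qed.

(** Tonelli, for both sides of the theorem: g is the kernel profile for the increments and the
    indicator of the pointed ball for the slopes. *)
Lemma integral_pint_quotient (g : 'rV[R]_N -> R) :
  measurable_fun setT g -> (forall h, 0 <= g h)%R ->
  \int[mu]_x \int[mu]_h (`|F (x, h)| `^ p / nrm h `^ p * g h)%:E =
  \int[mu]_h (pint_quotient h * g h)%:E.
Proof.
move=> mg g0.
rewrite (fubini_tonelli _ (measurable_weighted mg) (weighted_ge0 g0)).
apply: eq_integral => h _ /=.
have mFh : measurable_fun setT (fun x => F (x, h)).
  exact: (measurableT_comp mF (pair2_measurable _)).
transitivity (\int[mu]_x ((g h / nrm h `^ p)%:E * (`|F (x, h)| `^ p)%:E)).
  by apply: eq_integral => x _; rewrite -EFinM; congr (_%:E); rewrite mulrAC (mulrC _ (g h)) mulrAC.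
rewrite integralZ_pint//; last by rewrite divr_ge0// powR_ge0.
rewrite /pint_quotient -[X in _ * X = _]fineK; last exact: pint_fin_num.
by rewrite -EFinM; congr (_%:E); rewrite mulrC mulrA mulrAC.
Qed.

End quotient.

Section difference_quotients.
Context {R : realType} {N : nat} (p : R) (nrm : 'rV[R]_N -> R).
Hypotheses (p1 : 1 < p) (hnrm : is_norm nrm).
Variables (f : 'rV[R]_N -> R) (Df : 'rV[R]_N -> 'rV[R]_N).
Hypothesis sf : sobolev_W1 p f Df.
Notation mu := (lebesgue_rV N).
Local Open Scope ereal_scope.

Definition increment (z : 'rV[R]_N * 'rV[R]_N) : R := (f (z.1 + z.2) - f z.1)%R.
Definition slope (z : 'rV[R]_N * 'rV[R]_N) : R := dot (Df z.1) z.2.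

Let p0 : (0 < p)%R := lt_trans ltr01 p1.

Let mf : measurable_fun setT f.
Proof. by have [fp _ _] := sf; have [] := Lfun_pint (ltW p1) fp. Qed.

Let fy : pint mu p f < +oo.
Proof. by have [fp _ _] := sf; have [] := Lfun_pint (ltW p1) fp. Qed.

Lemma measurable_increment_pair : measurable_fun setT increment.
Proof.
apply: measurable_funB; last exact: (measurableT_comp mf measurable_fst).
apply: (measurableT_comp mf (f := f)); apply: measurable_fun_rVP => i.
under eq_fun do rewrite mxE.
apply: measurable_funD.
  exact: (measurableT_comp (measurable_coord i) measurable_fst).
exact: (measurableT_comp (measurable_coord i) measurable_snd).
Qed.

Lemma measurable_slope : measurable_fun setT slope.
Proof.
rewrite /slope /dot; apply: measurable_sum => i; apply: measurable_funM.
  have [_ Dp _] := sf; have [mD _] := Lfun_pint (ltW p1) (Dp i).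
  exact: (measurableT_comp mD measurable_fst).
exact: (measurableT_comp (measurable_coord i) measurable_snd).
Qed.

(** The bound does not involve h, by translation invariance; this controls the difference quotient
    away from 0. *)
Lemma pint_increment_le h :
  pint mu p (fun x => increment (x, h)) <= (2 `^ p)%:E * (pint mu p f + pint mu p f).
Proof.
have -> : pint mu p f + pint mu p f =
    pint mu p (fun x : 'rV[R]_N => f (x + h)%R) + pint mu p (fun x => - f x)%R.
  rewrite (pint_shift _ h mf); congr (_ + _); apply: eq_integral => x _.
  by rewrite normrN.
apply: pintD_le => //; first exact: measurable_fun_shift.
exact: measurableT_comp.
Qed.

Lemma pint_increment_lty h : pint mu p (fun x => increment (x, h)) < +oo.
Proof.
apply: (le_lt_trans (pint_increment_le h)).
apply: lte_mul_pinfty; rewrite ?lee_fin ?powR_ge0//.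
exact: lte_add_pinfty.
Qed.

Lemma pint_slope_lty h : pint mu p (fun x => slope (x, h)) < +oo.
Proof.
have [C C0 HC] := pint_dot_le p1 sf hnrm.
exact: (le_lt_trans (HC h) (ltry _)).
Qed.

Let tau := pint_quotient nrm p increment.
Let l := pint_quotient nrm p slope.

Lemma slope_quotient_bounded :
  exists C : R, forall h, (0 <= l h <= C)%R.
Proof.
have [C C0 HC] := pint_dot_le p1 sf hnrm; exists C => h.
rewrite pint_quotient_ge0/= /l /pint_quotient.
have [h0|h0] := ltP 0%R (nrm h).
  rewrite ler_pdivrMr ?powR_gt0//.
  by rewrite -lee_fin fineK; [exact: HC|apply: pint_fin_num; exact: pint_slope_lty].
have -> : nrm h = 0%R by apply/le_anti; rewrite h0 is_norm_ge0.
by rewrite powR0 ?gt_eqF// invr0 mulr0.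
Qed.

Lemma slope_quotient0 : l 0%R = 0%R.
Proof. by rewrite /l /pint_quotient (is_norm0 hnrm) powR0 ?gt_eqF// invr0 mulr0. Qed.

Lemma slope_quotient_homogeneous (c : R) h : (0 < c)%R -> l (c *: h)%R = l h.
Proof.
move=> c0; rewrite /l /pint_quotient (is_normZ hnrm) gtr0_norm// powRM ?(ltW c0) ?is_norm_ge0//.
have -> : pint mu p (fun x => slope (x, c *: h)%R) =
    (c `^ p)%:E * pint mu p (fun x => slope (x, h)).
  rewrite -[in RHS](gtr0_norm c0) -pintZ; last exact: (measurable_dot p1 sf).
  apply: eq_integral => x _; congr ((`|_| `^ _)%:E).
  by rewrite /slope /dot mulr_sumr; apply: eq_bigr => i _; rewrite mxE mulrCA.
rewrite fineM//; last by apply: pint_fin_num; exact: pint_slope_lty.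
by rewrite invfM mulrACA mulrA divff ?mul1r// gt_eqF// powR_gt0.
Qed.

(** [increment_dot_near] divided by the p-th power of the norm of h. *)
Lemma quotients_near (e : R) : (0 < e)%R -> exists2 d : R, (0 < d)%R &
  forall h, (0 < nrm h < d)%R -> (tau h <= l h + e)%R /\ (l h <= tau h + e)%R.
Proof.
move=> e0; have [d d0 Hd] := increment_dot_near p1 sf hnrm e0; exists d => // h /andP[h0 hd].
have [a aE] : exists a, pint mu p (fun x => increment (x, h)) = a%:E.
  exists (fine (pint mu p (fun x => increment (x, h)))).
  by rewrite (fineK (pint_fin_num (pint_increment_lty h))).
have [b bE] : exists b, pint mu p (fun x => slope (x, h)) = b%:E.
  exists (fine (pint mu p (fun x => slope (x, h)))).
  by rewrite (fineK (pint_fin_num (pint_slope_lty h))).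
have [] : pint mu p (fun x => increment (x, h)) <=
    pint mu p (fun x => slope (x, h)) + (e * nrm h `^ p)%:E /\
    pint mu p (fun x => slope (x, h)) <=
    pint mu p (fun x => increment (x, h)) + (e * nrm h `^ p)%:E := Hd _ hd.
rewrite /tau /l /pint_quotient aE bE -!EFinD !lee_fin /=.
have : (0 < nrm h `^ p)%R by rewrite powR_gt0.
clear Hd; move: (nrm h `^ p)%R => c c0.
by rewrite !ler_pdivrMr// !mulrDl !divfK// gt_eqF.
Qed.

Lemma increment_quotient_far (d : R) : (0 < d)%R -> exists2 M : R, (0 <= M)%R &
  forall h, (d <= nrm h)%R -> (tau h <= M)%R.
Proof.
move=> d0; have [G GE] : exists G, pint mu p f = G%:E.
  by exists (fine (pint mu p f)); rewrite fineK// pint_fin_num.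
have G0 : (0 <= G)%R by rewrite -lee_fin -GE pint_ge0.
exists (2 `^ p * (G + G) / d `^ p)%R.
  by rewrite divr_ge0 ?powR_ge0// mulr_ge0 ?powR_ge0// addr_ge0.
move=> h dh; rewrite /tau /pint_quotient.
apply: ler_pM; rewrite ?invr_ge0 ?powR_ge0 ?fine_ge0 ?pint_ge0//.
  rewrite -lee_fin fineK; last exact: pint_fin_num (pint_increment_lty h).
  by apply: (le_trans (pint_increment_le h)); rewrite GE.
rewrite lef_pV2 ?posrE ?powR_gt0//; last exact: lt_le_trans dh.
by rewrite ge0_ler_powR ?nnegrE// ltW//; exact: lt_le_trans dh.
Qed.

(** At v = h / nrm h the integrand |Df . v|^p is |Df . h|^p / (nrm h)^p, so the spherical integral
    is N times an integral of the slope quotient over the pointed ball. *)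
Lemma integral_slope_sphere :
  \int[mu]_x \int[sphere_measure nrm]_(v in norm_sphere nrm) (`|dot (Df x) v| `^ p)%:E =
  N%:R%:E * \int[mu]_(h in pointed_ball nrm) (l h)%:E.
Proof.
have mb := measurable_pointed_ball hnrm.
have mg : measurable_fun setT (\1_(pointed_ball nrm) : 'rV[R]_N -> R) by exact: measurable_indic.
have g0 h : (0 <= (\1_(pointed_ball nrm) h : R))%R by [].
have -> : \int[mu]_(h in pointed_ball nrm) (l h)%:E =
    \int[mu]_h (l h * \1_(pointed_ball nrm) h)%:E.
  rewrite integral_mkcond; apply: eq_integral => h _.
  by rewrite patchE indicE; case: ifP => _; rewrite ?mulr1 ?mulr0.
rewrite -(integral_pint_quotient hnrm p0 measurable_slope pint_slope_lty mg g0).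
rewrite -ge0_integralZl//; first last.
- by move=> x _; apply: integral_ge0 => h _; rewrite lee_fin !mulr_ge0// ?invr_ge0 ?powR_ge0.
- exact: (measurable_weighted_integral p hnrm measurable_slope mg g0).
apply: eq_integral => x _; rewrite integral_sphere_measure//.
- congr (_ * _); rewrite integral_mkcond; apply: eq_integral => h _.
  rewrite patchE indicE; case: ifPn => [/set_mem/andP[h0 _]|_]; last by rewrite mulr0.
  rewrite mulr1; congr (_%:E).
  have -> : dot (Df x) ((nrm h)^-1 *: h) = ((nrm h)^-1 * slope (x, h))%R.
    by rewrite /slope /dot mulr_sumr; apply: eq_bigr => i _; rewrite mxE mulrCA.
  rewrite normrM powRM// gtr0_norm ?invr_gt0// mulrC; congr (_ * _)%R.
  by rewrite -powR_inv1 ?(ltW h0)// -powRrM mulN1r powRN.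
- apply: measurable_pint; rewrite /dot; apply: measurable_sum => i.
  by apply: measurable_funM => //; exact: measurable_coord.
Qed.

Lemma integral_increment_profile (rho : nat -> 'rV[R]_N -> 'rV[R]_N -> R)
    (rhot : nat -> R -> R) (C0 : R) (hrho : mollifiers nrm rho rhot C0) n :
  \int[mu]_y \int[mu]_x (`|f x - f y| `^ p / nrm (x - y) `^ p * rho n x y)%:E =
  \int[mu]_h (tau h * profile rhot n (nrm h))%:E.
Proof.
have mprof : measurable_fun setT (fun h => profile rhot n (nrm h)).
  exact: (measurableT_comp (measurable_profile hrho n) (measurable_is_norm hnrm)).
have prof0 h : (0 <= profile rhot n (nrm h))%R by exact: (profile_ge0 hrho).
rewrite -(integral_pint_quotient hnrm p0 measurable_increment_pair pint_increment_lty mprof prof0).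
apply: eq_integral => y _.
pose G (x : 'rV[R]_N) : \bar R :=
  (`|f x - f y| `^ p / nrm (x - y) `^ p * profile rhot n (nrm (x - y)))%:E.
have mshift (g : 'rV[R]_N -> R) : measurable_fun setT g ->
    measurable_fun setT (fun x : 'rV[R]_N => g (x - y)%R).
  by move=> mg; exact: (measurable_fun_shift (- y)%R mg).
transitivity (\int[mu]_x G x).
  apply: eq_integral => x _; have [_ _ _ _ -> _ _ _] := hrho; rewrite /G /profile.
  (* Where [profile] and [rhot] may differ, x = y and the quotient is 0. *)
  case: ifPn => //; rewrite -leNgt => xy0.
  have -> : nrm (x - y)%R = 0%R by apply/le_anti; rewrite xy0 is_norm_ge0.
  by rewrite powR0 ?gt_eqF// invr0 mulr0 !mul0r.
rewrite -(integral_rV_translate y (F := G)).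
- apply: eq_integral => h _; rewrite /G /increment /= addrK; congr ((`|f _ - _| `^ _ / _ * _)%:E).
  exact: addrC.
- apply/measurable_EFinP; apply: measurable_funM; last exact: (mshift _ mprof).
  apply: measurable_funM.
    by apply/measurable_powR_norm; exact: measurable_funB.
  by under eq_fun do rewrite -powRN; exact: (mshift _ (measurable_powR_is_norm hnrm _)).
- by move=> x; rewrite lee_fin !mulr_ge0// ?invr_ge0 ?powR_ge0.
Qed.

End difference_quotients.

Theorem proposition4p1 (R : realType) (N : nat) (hN : (1 <= N)%N)
  (nrm : 'rV[R]_N -> R) (hnrm : is_norm nrm)
  (p : R) (hp : 1 < p)
  (rho : nat -> 'rV[R]_N -> 'rV[R]_N -> R) (rhot : nat -> R -> R) (C0 : R)
  (hrho : mollifiers nrm rho rhot C0)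
  (f : 'rV[R]_N -> R) (Df : 'rV[R]_N -> 'rV[R]_N) (hf : sobolev_W1 p f Df) :
  (\int[lebesgue_rV N]_y \int[lebesgue_rV N]_x
     (`|f x - f y| `^ p / nrm (x - y) `^ p * rho n x y)%R%:E)%E
    @[n --> \oo] -->
  (C0%:E * \int[lebesgue_rV N]_x
     \int[sphere_measure nrm]_(v in norm_sphere nrm)
       (`|dot (Df x) v| `^ p)%R%:E)%E.
Proof.
have [C lC] := slope_quotient_bounded hp hnrm hf.
rewrite (integral_slope_sphere hp hnrm hf).
under eq_fun do rewrite (integral_increment_profile hp hnrm hf hrho).
apply: (mollifier_concentration hN hnrm hrho _ lC).
- exact: (measurable_pint_quotient p hnrm (measurable_slope hp hf)).
- exact: (slope_quotient0 hp hnrm).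
- by move=> c h; exact: (slope_quotient_homogeneous hp hnrm hf).
- exact: (measurable_pint_quotient p hnrm (measurable_increment_pair hp hf)).
- by move=> h; exact: pint_quotient_ge0.
- by move=> e; exact: (quotients_near hp hnrm hf).
- by move=> d; exact: (increment_quotient_far _ hp hf).
Qed.
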